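(* Let $\mathbb{K}$ be a field with more than $2$ elements. Let $U$ and $V$ be finite-dimensional vector spaces over $\mathbb{K}$ with $p:=\dim U\geq 1$ and $n:=\dim V\geq 2$, and let $\mathcal{S}$ be a linear subspace of $\mathcal{L}(U,V)$ with $\operatorname{codim}_{\mathcal{L}(U,V)}\mathcal{S}\leq 2n-3$. Then: (a) every range-compatible linear map on $\mathcal{S}$ is local; (b) if $\mathcal{S}$ has none of Types 1, 2, 3, then every range-compatible group homomorphism on $\mathcal{S}$ is local; (c) if $\mathcal{S}$ has Type 1, then, for any $x\in U$ with $\dim \mathcal{S}x=1$, the range-compatible homomorphisms on $\mathcal{S}$ are exactly the sums of a local map and a map $s\mapsto \alpha(s(x))$, where $\alpha:\mathcal{S}x\to\mathcal{S}x$ is a group homomorphism; (d) if $\mathcal{S}$ has Type 2, then, for any bases of $U$ and $V$ in which $\mathcal{S}$ is represented by $\mathrm{S}_2(\mathbb{K})\vee \mathrm{M}_{n-2,p-2}(\mathbb{K})$, the range-compatible homomorphisms on $\mathcal{S}$ are exactly those represented by the sums of a local map and a map $M\mapsto \begin{bmatrix}\alpha(m_{1,1})& \alpha(m_{2,2}) & 0&\cdots&0\end{bmatrix}^T$, where $\alpha$ is a root-linear form on $\mathbb{K}$; (e) if $\mathcal{S}$ has Type 3, then, for any bases of $U$ and $V$ in which $\mathcal{S}$ is represented by $\mathrm{S}_3(\mathbb{K})\coprod \mathrm{M}_{3,p-3}(\mathbb{K})$, the range-compatible homomorphisms on $\mathcal{S}$ are exactly those represented by the sums of a local map and a map $M\mapsto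 \begin{bmatrix}\alpha(m_{1,1})& \alpha(m_{2,2}) & \alpha(m_{3,3})\end{bmatrix}^T$, where $\alpha$ is a root-linear form on $\mathbb{K}$.
   Context: For $\mathcal{S}\subset\mathcal{L}(U,V)$, a map $F:\mathcal{S}\to V$ is range-compatible when $F(s)\in\operatorname{im}s$ for all $s$, and local when there is $x\in U$ with $F(s)=s(x)$ for all $s$; ''homomorphism'' means homomorphism of additive groups. For $x\in U$, $\mathcal{S}x:=\{s(x): s\in\mathcal{S}\}$. A map is represented in bases by the corresponding map between matrix spaces (matrices of operators, coordinate vectors). $\mathrm{S}_r(\mathbb{K})$ is the space of $r\times r$ symmetric matrices. For sets $\mathcal{A}\subset \mathrm{M}_{m,p}(\mathbb{K})$, $\mathcal{B}\subset\mathrm{M}_{n,q}(\mathbb{K})$, $\mathcal{A}\vee\mathcal{B}$ is the set of matrices $\begin{bmatrix}A & C\\ 0 & B\end{bmatrix}$ with $A\in\mathcal{A}$, $B\in\mathcal{B}$, $C\in \mathrm{M}_{m,q}(\mathbb{K})$ arbitrary; for $\mathcal{A}\subset \mathrm{M}_{n,p}(\mathbb{K})$, $\mathcal{B}\subset\mathrm{M}_{n,q}(\mathbb{K})$, $\mathcal{A}\coprod\mathcal{B}$ is the set of matrices $\begin{bmatrix}A & B\end{bmatrix}$ with $A\in\mathcal{A}$, $B\in\mathcal{B}$. If $\mathbb{K}$ has characteristic $2$, a map $\alpha$ between $\mathbb{K}$-vector spaces is root-linear when it is additive and $\alpha(\lambda^2x)=\lambda\alpha(x)$ for all scalars $\lambda$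 and vectors $x$. With $p=\dim U$, $n=\dim V$: $\mathcal{S}$ has Type 1 when some $x\in U$ satisfies $\dim\mathcal{S}x=1$; Type 2 when $\mathbb{K}$ has characteristic $2$ and in some bases of $U,V$ the space $\mathcal{S}$ is represented by $\mathrm{S}_2(\mathbb{K})\vee \mathrm{M}_{n-2,p-2}(\mathbb{K})$; Type 3 when $\mathbb{K}$ has characteristic $2$ and in some bases $\mathcal{S}$ is represented by $\mathrm{S}_3(\mathbb{K})\coprod\mathrm{M}_{3,p-3}(\mathbb{K})$ (so $n=3$). *)

(* Defs.v *)
From HB Require Import structures.
From mathcomp Require Import all_boot all_order all_algebra.
Set Implicit Arguments. Unset Strict Implicit. Unset Printing Implicit Defensive.
Import Order.TTheory GRing.Theory Num.Theory.
Local Open Scope ring_scope.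

Section RangeCompatible.
Variables (K : fieldType) (U V : vectType K).

Definition range_compatible (S : {vspace 'Hom(U, V)}) (F : 'Hom(U, V) -> V) : Prop :=
  forall s, s \in S -> F s \in limg s.

Definition local_map (S : {vspace 'Hom(U, V)}) (F : 'Hom(U, V) -> V) : Prop :=
  exists x : U, forall s, s \in S -> F s = s x.

Definition hom_on (S : {vspace 'Hom(U, V)}) (F : 'Hom(U, V) -> V) : Prop :=
  forall s t, s \in S -> t \in S -> F (s + t) = F s + F t.

Definition linear_on (S : {vspace 'Hom(U, V)}) (F : 'Hom(U, V) -> V) : Prop :=
  hom_on S F /\ forall (a : K) s, s \in S -> F (a *: s) = a *: F s.

(* S x = { s(x) | s in S }, as a subspace of V (spanned by the images of a
   basis of S). *)
Definition Sx (S : {vspace 'Hom(U, V)}) (x : U) : {vspace V} :=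
  span [seq (s : 'Hom(U, V)) x | s <- (vbasis S : seq 'Hom(U, V))].

Definition matof (eU : (\dim {:U}).-tuple U) (eV : (\dim {:V}).-tuple V)
  (s : 'Hom(U, V)) : 'M[K]_(\dim {:V}, \dim {:U}) :=
  \matrix_(i, j) coord eV i (s (tnth eU j)).

Definition represented_by (S : {vspace 'Hom(U, V)}) (eU : (\dim {:U}).-tuple U)
  (eV : (\dim {:V}).-tuple V) (T : 'M[K]_(\dim {:V}, \dim {:U}) -> Prop) : Prop :=
  (forall s, s \in S -> T (matof eU eV s)) /\
  (forall M, T M -> exists2 s, s \in S & matof eU eV s = M).

End RangeCompatible.

(* Entry (i, j) (0-based) of a matrix, 0 if out of range. *)
Definition mxent (K : fieldType) (n p : nat) (M : 'M[K]_(n, p)) (i j : nat) : K :=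
  match (insub i : option 'I_n), (insub j : option 'I_p) with
  | Some i', Some j' => M i' j'
  | _, _ => 0
  end.

Definition S2_vee_M (K : fieldType) (n p : nat) (M : 'M[K]_(n, p)) : Prop :=
  (2 <= n)%N /\ (2 <= p)%N /\
  (forall i j : nat, (i < 2)%N -> (j < 2)%N -> mxent M i j = mxent M j i) /\
  (forall i j : nat, (2 <= i)%N -> (i < n)%N -> (j < 2)%N -> mxent M i j = 0).

Definition S3_coprod_M (K : fieldType) (n p : nat) (M : 'M[K]_(n, p)) : Prop :=
  n = 3%N /\ (3 <= p)%N /\
  (forall i j : nat, (i < 3)%N -> (j < 3)%N -> mxent M i j = mxent M j i).

Definition char2 (K : fieldType) : Prop := (2 \in [pchar K])%N.

Definition root_linear (K : fieldType) (alpha : K -> K) : Prop :=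
  (forall x y, alpha (x + y) = alpha x + alpha y) /\
  (forall l x, alpha (l ^+ 2 * x) = l * alpha x).

Definition Type1 (K : fieldType) (U V : vectType K) (S : {vspace 'Hom(U, V)}) : Prop :=
  exists x : U, \dim (Sx S x) = 1%N.

Definition Type2 (K : fieldType) (U V : vectType K) (S : {vspace 'Hom(U, V)}) : Prop :=
  char2 K /\
  exists (eU : (\dim {:U}).-tuple U) (eV : (\dim {:V}).-tuple V),
    [/\ basis_of fullv eU, basis_of fullv eV & represented_by S eU eV (@S2_vee_M K _ _)].

Definition Type3 (K : fieldType) (U V : vectType K) (S : {vspace 'Hom(U, V)}) : Prop :=
  char2 K /\
  exists (eU : (\dim {:U}).-tuple U) (eV : (\dim {:V}).-tuple V),
    [/\ basis_of fullv eU, basis_of fullv eV & represented_by S eU eV (@S3_coprod_M K _ _)].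

(* Main.v *)
Require Import Defs.
From HB Require Import structures.
From mathcomp Require Import all_boot all_order all_algebra.
From mathcomp Require Import ring zify.
From Stdlib Require Import Classical ClassicalEpsilon.
Set Implicit Arguments. Unset Strict Implicit. Unset Printing Implicit Defensive.
Import GRing.Theory.
Local Open Scope ring_scope.

(** In fixed bases the operators become transposed matrices [s] acting on coordinate rows by
    [x *m s], and the operator space is handled through its orthogonal [T] for the trace form:
    membership is [orth T s], [\dim T] is the codimension, and the hypothesis reads
    [\dim T + 3 <= 2 * n]. A rank one matrix [c *m x] lies in [T] exactly when [c] annihilates
    [x *m s] for every [s] in the space, so each linear constraint on the values of the operators
    produces elements of [T], which are counted against the bound.

    The core is [classification]: a range-compatible homomorphism is local, or else it is not linear
    and comes from an exceptional configuration. Types 2 and 3 are treated together, as spaces of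
    those [s] for which [J *m s] is symmetric, with [J] of rank 2, or of rank 3 when [n = 3]. On
    such spaces [sym_form] computes the homomorphisms: the range condition on rank one symmetric
    matrices is a functional equation whose solutions are a linear part plus a root-linear [alpha]
    on the diagonal, and [root_linear_quadratic] makes the diagonal part independent of the bases.

    The classification goes by induction on [n]. Dividing the target by the line of [y] turns [F]
    into a range-compatible homomorphism and lowers [\dim T] by [\dim (ev y T)] ([quot_dim]). When
    this drop is at least 2, [y] being then called adapted, the bound survives and the induction
    hypothesis applies. Three situations are settled directly: very small codimension
    ([local_small]), a nonzero vector whose values all lie on one line ([type1_form]), and [n = 2]
    ([main2]). Otherwise adapted vectors exist ([exists_adapted]) and, the field having more than
    two elements, no proper subspace contains all of them ([adapted_outside]). That hypothesis is
    used through a scalar [lam] other than 0 and 1.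

    Modulo an adapted vector, [F] is local, of Type 1, or of symmetric type. If the symmetric type
    occurs, [caseI], [caseII] and [caseIII] extend the symmetry from the quotient to the whole
    space. If it never occurs, several independent adapted vectors are compared: unless [F] is
    local, the relations found fill up all of [T], so a certain rank two operator belongs to the
    space ([configuration]), and range-compatibility fails on it ([all_low_linear],
    [all_low_nonlinear]). *)

Section Dot.

(** * Pairing of rows with columns, and separation by linear forms *)

Variable K : fieldType.

Definition dot n (a : 'rV[K]_n) (c : 'cV[K]_n) : K := (a *m c) 0 0.

Lemma dotDl n (a b : 'rV[K]_n) c : dot (a + b) c = dot a c + dot b c.
Proof. by rewrite /dot mulmxDl mxE. Qed.
Lemma dotDr n (a : 'rV[K]_n) c d : dot a (c + d) = dot a c + dot a d.
Proof. by rewrite /dot mulmxDr mxE. Qed.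
Lemma dotNl n (a : 'rV[K]_n) c : dot (- a) c = - dot a c.
Proof. by rewrite /dot mulNmx mxE. Qed.
Lemma dotNr n (a : 'rV[K]_n) c : dot a (- c) = - dot a c.
Proof. by rewrite /dot mulmxN mxE. Qed.
Lemma dotZl n k (a : 'rV[K]_n) c : dot (k *: a) c = k * dot a c.
Proof. by rewrite /dot -scalemxAl mxE. Qed.
Lemma dotZr n k (a : 'rV[K]_n) c : dot a (k *: c) = k * dot a c.
Proof. by rewrite /dot -scalemxAr mxE. Qed.
Lemma dot0l n (c : 'cV[K]_n) : dot 0 c = 0.
Proof. by rewrite /dot mul0mx mxE. Qed.
Lemma dot0r n (a : 'rV[K]_n) : dot a 0 = 0.
Proof. by rewrite /dot mulmx0 mxE. Qed.
Lemma dotA n p (x : 'rV[K]_p) (s : 'M_(p, n)) c : dot x (s *m c) = dot (x *m s) c.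
Proof. by rewrite /dot mulmxA. Qed.
Definition dotE := (dotDl, dotDr, dotNl, dotNr, dotZl, dotZr, dot0l, dot0r).

Lemma mulmx_dot n p (a : 'rV[K]_n) (c : 'cV[K]_n) (b : 'rV[K]_p) :
  a *m (c *m b) = dot a c *: b.
Proof. by rewrite mulmxA [a *m c]mx11_scalar mul_scalar_mx. Qed.

Lemma mulmx_dotr n p (b : 'cV[K]_p) (a : 'rV[K]_n) (c : 'cV[K]_n) :
  (b *m a) *m c = dot a c *: b.
Proof. by rewrite -mulmxA [a *m c]mx11_scalar mul_mx_scalar. Qed.

Lemma dot_trC n (a b : 'rV[K]_n) : dot a b^T = dot b a^T.
Proof. by rewrite /dot -[a in LHS]trmxK -trmx_mul mxE. Qed.

Lemma dot_tr n (a : 'rV[K]_n) (c : 'cV[K]_n) : dot c^T a^T = dot a c.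
Proof. by rewrite dot_trC trmxK. Qed.

Lemma row_dotP n (a b : 'rV[K]_n) : (forall c, dot a c = dot b c) -> a = b.
Proof.
move=> e; apply/rowP=> i; have := e (delta_mx i 0).
by rewrite /dot -!colE !mxE.
Qed.

Lemma col_dotP n (a b : 'cV[K]_n) : (forall c, dot c a = dot c b) -> a = b.
Proof.
move=> e; apply/colP=> i; have := e (delta_mx 0 i).
by rewrite /dot -!rowE !mxE.
Qed.

Lemma trace_dot n p (s : 'M[K]_(p, n)) (c : 'cV_n) (x : 'rV_p) :
  \tr (s *m (c *m x)) = dot (x *m s) c.
Proof. by rewrite mulmxA mxtrace_mulC mulmxA /mxtrace big_ord1. Qed.

Lemma mulmx_eq0_dot n m (A : 'M[K]_(m, n)) (c : 'cV_n) :
  (forall v, (v <= A)%MS -> dot v c = 0) -> A *m c = 0.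
Proof.
move=> h; apply/row_matrixP=> i; rewrite row_mul row0.
by rewrite [_ *m c]mx11_scalar [(_ *m c) 0 0]h ?row_sub // raddf0.
Qed.

Lemma dot_sub n m (A : 'M[K]_(m, n)) (v : 'rV_n) c :
  (v <= A)%MS -> A *m c = 0 -> dot v c = 0.
Proof. by case/submxP=> D -> e; rewrite /dot -mulmxA e mulmx0 mxE. Qed.

Lemma sep n m (A : 'M[K]_(m, n)) (v : 'rV_n) :
  ~~ (v <= A)%MS -> exists2 c : 'cV_n, A *m c = 0 & dot v c = 1.
Proof.
rewrite submxE => /rV0Pn[j vj].
exists (((v *m cokermx A) 0 j)^-1 *: col j (cokermx A)).
  by rewrite -scalemxAr colE (mulmxA A) mulmx_coker mul0mx scaler0.
by rewrite dotZr colE dotA /dot -colE [X in _ * X]mxE mulVf.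
Qed.

Lemma sub_sep n m (A : 'M[K]_(m, n)) (v : 'rV_n) :
  (forall c : 'cV_n, A *m c = 0 -> dot v c = 0) -> (v <= A)%MS.
Proof.
move=> h; apply/negPn/negP=> /sep[c] /h -> /eqP.
by rewrite eq_sym oner_eq0.
Qed.

Lemma sep1 n (v : 'rV[K]_n) : v != 0 -> exists c : 'cV_n, dot v c = 1.
Proof.
move=> v0; have : ~~ (v <= (0 : 'M[K]_n))%MS by rewrite submx0.
by case/sep=> c _; exists c.
Qed.

Lemma sep1c n (c : 'cV[K]_n) : c != 0 -> exists v : 'rV_n, dot v c = 1.
Proof.
move=> c0; have : c^T != 0 by rewrite -[0]trmx0 (inj_eq trmx_inj).
by case/sep1=> d e; exists d^T; rewrite -[c]trmxK dot_trC trmxK.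
Qed.

Lemma exists_not_sub m n (A : 'M[K]_(m, n)) : (\rank A < n)%N ->
  exists v : 'rV_n, ~~ (v <= A)%MS.
Proof.
move=> rA; apply: NNPP => e; have : (1%:M <= A)%MS.
  by apply/row_subP => i; apply/negPn/negP => h; apply: e; exists (row i 1%:M).
by move/mxrankS; rewrite mxrank1 leqNgt rA.
Qed.

Lemma sub1P n (a v : 'rV[K]_n) : (v <= a)%MS -> exists k, v = k *: a.
Proof. by case/submxP=> D ->; exists (D 0 0); rewrite {1}[D]mx11_scalar mul_scalar_mx. Qed.

Lemma sub2P n (a b v : 'rV[K]_n) : (v <= col_mx a b)%MS ->
  exists k l, v = k *: a + l *: b.
Proof.
case/submxP=> D ->; exists (lsubmx D 0 0), (rsubmx D 0 0).
by rewrite -{1}[D]hsubmxK mul_row_col [lsubmx D in LHS]mx11_scalar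
  [rsubmx D in LHS]mx11_scalar !mul_scalar_mx.
Qed.

Lemma sub_col2 n (a b : 'rV[K]_n) k l : ((k *: a + l *: b)%R <= col_mx a b)%MS.
Proof. by apply/submxP; exists (row_mx (k%:M : 'M_1) (l%:M : 'M_1)); rewrite mul_row_col !mul_scalar_mx. Qed.

Lemma col2_eq0 n (a b : 'rV[K]_n) (c : 'cV_n) :
  (col_mx a b *m c = 0) <-> (dot a c = 0 /\ dot b c = 0).
Proof.
rewrite mul_col_mx [a *m c]mx11_scalar [b *m c]mx11_scalar -/(dot a c) -/(dot b c).
split=> [/eqP|[-> ->]]; last by rewrite raddf0 col_mx0.
rewrite col_mx_eq0 => /andP[/eqP/matrixP/(_ 0 0) + /eqP/matrixP/(_ 0 0)].
by rewrite !mxE !mulr1n.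
Qed.

Lemma row1_eq0 n (a : 'rV[K]_n) (c : 'cV_n) : (a *m c = 0) <-> (dot a c = 0).
Proof.
rewrite [a *m c]mx11_scalar -/(dot a c); split=> [/matrixP/(_ 0 0)|->]; last by rewrite raddf0.
by rewrite !mxE.
Qed.

(* [P] is the projection onto the quotient of [rV_n] by the line of [y],
   [P'] a section of it. *)
Lemma quotient_line n (y : 'rV[K]_n) : y != 0 ->
  exists m (P : 'M[K]_(n, m)) (P' : 'M[K]_(m, n)) (C : 'cV[K]_n),
    [/\ n = m.+1, P' *m P = 1%:M, 1%:M - P *m P' = C *m y & y *m P = 0].
Proof.
move=> y0; exists (\rank (cokermx y)), (col_base (cokermx y)).
have [P' P'P] : exists P', P' *m col_base (cokermx y) = 1%:M.
  by exists (pinvmx (col_base (cokermx y)));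
     rewrite mulVpmx // col_base_full.
have rk : \rank y = 1%N by rewrite rank_rV y0.
have n0 : (0 < n)%N by have := rank_leq_col y; rewrite rk.
have yP : y *m col_base (cokermx y) = 0.
  have : y *m cokermx y = 0 by rewrite mulmx_coker.
  rewrite -{1}[cokermx y]mulmx_base mulmxA => e.
  apply: (row_free_inj (row_base_free (cokermx y))).
  by rewrite e mul0mx.
have /submxP[C eC] : (1%:M - col_base (cokermx y) *m P' <= y)%MS.
  rewrite submxE mulmxBl mul1mx subr_eq0; apply/eqP; symmetry.
  transitivity (col_base (cokermx y) *m P' *m (col_base (cokermx y) *m row_base (cokermx y))).
    by rewrite mulmx_base.
  by rewrite -mulmxA (mulmxA P') P'P mul1mx mulmx_base.
exists P', C; split => //.
by rewrite mxrank_coker rk subn1 prednK.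
Qed.
End Dot.
Arguments dot {K n} a c.

(** * Trace duality between spaces of matrices *)

Section Spaces.
Variable K : fieldType.

Lemma hom_of_linear (A B : vectType K) (f : A -> B) :
  (forall k u v, f (k *: u + v) = k *: f u + f v) ->
  exists g : 'Hom(A, B), forall u, g u = f u.
Proof.
move=> fl.
pose m := GRing.isLinear.Build K A B *:%R f fl.
pose fL : {linear A -> B} := HB.pack f m.
by exists (linfun fL) => u; rewrite lfunE.
Qed.

Lemma functional_sep (A : vectType K) (X : {vspace A}) (v : A) : v \notin X ->
  exists f : A -> K, [/\ forall k a b, f (k *: a + b) = k * f a + f b,
    forall a, a \in X -> f a = 0 & f v = 1].
Proof.
move=> vX; pose g := (\1 - projv X)%VF; pose b := vbasis {:A}.
have gE a : g a = a - projv X a by rewrite add_lfunE opp_lfunE id_lfunE.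
have [j vj] : exists j, coord b j (g v) != 0.
  apply/existsP; rewrite -negb_forall; apply: contra vX => /forallP e.
  have : g v = 0.
    rewrite (coord_vbasis (memvf (g v))) big1 // => i _.
    by rewrite (eqP (e i)) scale0r.
  by rewrite gE => /eqP; rewrite subr_eq0 => /eqP ->; apply: memv_proj.
exists (fun a => (coord b j (g v))^-1 * coord b j (g a)); split=> [k a c|a aX|].
- by rewrite !linearP /=; ring.
- by rewrite (gE a) projv_id // subrr linear0 mulr0.
- by rewrite mulVf.
Qed.

Lemma functional_trace n p (f : 'M[K]_(p, n) -> K) :
  (forall k a b, f (k *: a + b) = k * f a + f b) ->
  exists t, forall s, f s = \tr (s *m t).
Proof.
move=> fl.
have f0 : f 0 = 0.
  have := fl 1 0 0; rewrite scaler0 addr0 mul1r => /eqP.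
  by rewrite -subr_eq0 opprD addNKr oppr_eq0 => /eqP.
have fD a b : f (a + b) = f a + f b by have := fl 1 a b; rewrite scale1r mul1r.
have fZ k a : f (k *: a) = k * f a by have := fl k a 0; rewrite f0 !addr0.
exists (\matrix_(j, i) f (delta_mx i j)) => s.
rewrite {1}[s]matrix_sum_delta (big_morph f fD f0) /mxtrace.
apply: eq_bigr => i _; rewrite mxE (big_morph f fD f0); apply: eq_bigr => j _.
by rewrite fZ mxE.
Qed.

(** An operator space is always given by its orthogonal [T]; [orth T] is membership in it. *)
Definition orth n p (T : {vspace 'M[K]_(n, p)}) (s : 'M[K]_(p, n)) : Prop :=
  forall t, t \in T -> \tr (s *m t) = 0.

Lemma orth0 n p (T : {vspace 'M[K]_(n, p)}) : orth T 0.
Proof. by move=> t _; rewrite mul0mx mxtrace0. Qed.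
Lemma orthD n p (T : {vspace 'M[K]_(n, p)}) s s' :
  orth T s -> orth T s' -> orth T (s + s').
Proof. by move=> h h' t tT; rewrite mulmxDl mxtraceD h ?h' ?addr0. Qed.
Lemma orthZ n p (T : {vspace 'M[K]_(n, p)}) k s : orth T s -> orth T (k *: s).
Proof. by move=> h t tT; rewrite -scalemxAl mxtraceZ h ?mulr0. Qed.
Lemma orthN n p (T : {vspace 'M[K]_(n, p)}) s : orth T s -> orth T (- s).
Proof. by move=> h; rewrite -scaleN1r; apply: orthZ. Qed.
Lemma orthB n p (T : {vspace 'M[K]_(n, p)}) s s' :
  orth T s -> orth T s' -> orth T (s - s').
Proof. by move=> h h'; apply/orthD/orthN. Qed.

Lemma double_orth n p (T : {vspace 'M[K]_(n, p)}) t :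
  (forall s, orth T s -> \tr (s *m t) = 0) -> t \in T.
Proof.
move=> h; apply/negPn/negP => /functional_sep[f [fl fT ft]].
have [s es] := functional_trace fl.
have : \tr (s *m t) = 0.
  by apply: h => t' t'T; rewrite mxtrace_mulC -es fT.
by rewrite mxtrace_mulC -es ft => /eqP; rewrite oner_eq0.
Qed.

(** The dictionary used throughout: confining the values at [x] to a subspace of rows means that [T]
    contains [c *m x] for all [c] annihilating that subspace. *)
Lemma rank1_orthP n p (T : {vspace 'M[K]_(n, p)}) (c : 'cV_n) (x : 'rV_p) :
  c *m x \in T <-> (forall s, orth T s -> dot (x *m s) c = 0).
Proof.
split=> [cx s /(_ _ cx)|h]; first by rewrite trace_dot.
by apply: double_orth => s /h; rewrite trace_dot.
Qed.

Lemma rank1_orth n p (T : {vspace 'M[K]_(n, p)}) (c : 'cV_n) (x : 'rV_p) s :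
  c *m x \in T -> orth T s -> dot (x *m s) c = 0.
Proof. by move=> /rank1_orthP; apply. Qed.

Lemma perp_exists n p (T : {vspace 'M[K]_(n, p)}) :
  exists X : {vspace 'M[K]_(p, n)}, forall s, s \in X <-> orth T s.
Proof.
have [g eg] := @hom_of_linear _ _
  (fun s : 'M[K]_(p, n) => \row_(i < \dim T) \tr (s *m (vbasis T)`_i))
  (fun k u v => ltac:(by apply/rowP => i;
     rewrite !mxE mulmxDl -scalemxAl mxtraceD mxtraceZ)).
exists (lker g) => s; rewrite memv_ker eg; split => [/eqP e t tT|h]; last first.
  by apply/eqP/rowP => i; rewrite !mxE h // vbasis_mem // mem_nth ?size_tuple.
rewrite (coord_vbasis tT) mulmx_sumr raddf_sum big1 // => i _ /=.
by rewrite -scalemxAr mxtraceZ; have /rowP/(_ i) := e; rewrite !mxE => ->; rewrite mulr0.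
Qed.

Lemma dim_perp n p (X : {vspace 'M[K]_(p, n)}) :
  exists T : {vspace 'M[K]_(n, p)},
    (forall s, s \in X <-> orth T s) /\ (\dim T + \dim X = p * n)%N.
Proof.
have [T eT] := perp_exists X; exists T; split => [s|].
  split=> [sX t /eT /(_ s sX)|h]; first by rewrite mxtrace_mulC.
  by apply: double_orth => t /eT tT; rewrite mxtrace_mulC h.
have [g eg] := @hom_of_linear _ _
  (fun s : 'M[K]_(n, p) => \row_(i < \dim X) \tr (s *m (vbasis X)`_i))
  (fun k u v => ltac:(by apply/rowP => i;
     rewrite !mxE mulmxDl -scalemxAl mxtraceD mxtraceZ)).
have eT' : T = lker g.
  apply/vspaceP => t; rewrite memv_ker eg; apply/idP/eqP => [/eT h|e].
    by apply/rowP => i; rewrite !mxE h // vbasis_mem // mem_nth ?size_tuple.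
  apply/eT => s sX; rewrite (coord_vbasis sX) mulmx_sumr raddf_sum big1 // => i _ /=.
  by rewrite -scalemxAr mxtraceZ; have /rowP/(_ i) := e; rewrite !mxE => ->; rewrite mulr0.
have := limg_ker_dim g fullv; rewrite capfv -eT' dimvf /dim /= mulnC => <-; congr (_ + _)%N.
(* Surjectivity is nondegeneracy: a functional vanishing on the image would be a linear relation
   between the vectors of a basis of [X]. *)
have -> : limg g = fullv.
  apply/eqP; rewrite eqEsubv subvf /=; apply/subvP => v _.
  apply/negPn/negP => /functional_sep[f [fl fT fv]].
  have f0 : f 0 = 0 by rewrite fT ?mem0v.
  have fD a c : f (a + c) = f a + f c by have := fl 1 a c; rewrite scale1r mul1r.
  have fZ k a : f (k *: a) = k * f a by have := fl k a 0; rewrite f0 !addr0.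
  have fE u : f u = \sum_i u 0 i * f (delta_mx 0 i).
    rewrite {1}[u]row_sum_delta (big_morph f fD f0).
    by apply: eq_bigr => k _; rewrite fZ.
  have : \sum_i f (delta_mx 0 i) *: (vbasis X)`_i = 0.
    have [//|] := eqVneq (\sum_i f (delta_mx 0 i) *: (vbasis X)`_i) 0.
    have : \sum_i f (delta_mx 0 i) *: (vbasis X)`_i \notin 0%VS -> False.
      move=> /functional_sep[h [hl _]].
      have [t et] := functional_trace hl; rewrite et.
      have := fT (g t) (memv_img _ (memvf t)); rewrite fE eg => e.
      rewrite mxtrace_mulC mulmx_sumr raddf_sum.
      under eq_bigr => k _ do rewrite -scalemxAr /= mxtraceZ.
      have -> : \sum_i f (delta_mx 0 i) * \tr (t *m (vbasis X)`_i) = 0.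
        by rewrite -[RHS]e; apply: eq_bigr => k _; rewrite mxE mulrC.
      by move/eqP; rewrite eq_sym oner_eq0.
    by rewrite memv0 => h /h.
  move/freeP: (basis_free (vbasisP X)) => h /h b0.
  by move: fv => /eqP; rewrite fE big1 ?[0 == _]eq_sym ?oner_eq0 // => k _; rewrite b0 mulr0.
by rewrite dimvf /dim /= mul1n.
Qed.
End Spaces.

(** * Range-compatible homomorphisms in dual form, and their quotients *)

Section RC.
Variable K : fieldType.

(** For the action on rows the image of [s] is its row space, hence the condition [F s <= s]. *)
Definition rc n p (T : {vspace 'M[K]_(n, p)}) (F : 'M[K]_(p, n) -> 'rV[K]_n) : Prop :=
  (forall s s', orth T s -> orth T s' -> F (s + s') = F s + F s') /\
  (forall s, orth T s -> (F s <= s)%MS).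

Definition rc_local n p (T : {vspace 'M[K]_(n, p)}) (F : 'M[K]_(p, n) -> 'rV[K]_n) : Prop :=
  exists z, forall s, orth T s -> F s = z *m s.

Lemma rc0 n p (T : {vspace 'M[K]_(n, p)}) F : rc T F -> F 0 = 0.
Proof. by case=> _ /(_ 0 (@orth0 _ _ _ _)) /submx0null. Qed.

Lemma rcN n p (T : {vspace 'M[K]_(n, p)}) F s : rc T F -> orth T s -> F (- s) = - F s.
Proof.
move=> h os; have := h.1 _ _ (orthN os) os; rewrite addNr (rc0 h) => e.
by apply/eqP; rewrite -addr_eq0 -e.
Qed.

Lemma rcB n p (T : {vspace 'M[K]_(n, p)}) F s s' :
  rc T F -> orth T s -> orth T s' -> F (s - s') = F s - F s'.
Proof. by move=> h os os'; rewrite (h.1 _ _ os (orthN os')) (rcN h os'). Qed.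

Lemma rc_dot n p (T : {vspace 'M[K]_(n, p)}) F s c :
  rc T F -> orth T s -> s *m c = 0 -> dot (F s) c = 0.
Proof. by move=> h os; apply: dot_sub; apply: h.2. Qed.

Lemma rc_sub_local n p (T : {vspace 'M[K]_(n, p)}) F z :
  rc T F -> rc T (fun s => F s - z *m s).
Proof.
case=> hD hr; split=> [s s' os os'|s os]; first by rewrite hD // mulmxDr opprD addrACA.
by rewrite addmx_sub ?hr // eqmx_opp submxMl.
Qed.

Lemma rc_sum n p (T : {vspace 'M[K]_(n, p)}) F I (r : seq I) (P : pred I) (f : I -> 'M_(p, n)) :
  rc T F -> (forall i, P i -> orth T (f i)) ->
  orth T (\sum_(i <- r | P i) f i) /\
  F (\sum_(i <- r | P i) f i) = \sum_(i <- r | P i) F (f i).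
Proof.
move=> h hf; elim: r => [|i r [o e]]; first by rewrite !big_nil; split; [apply: orth0|apply: rc0 h].
rewrite !big_cons; case: ifP => // Pi; split; first by apply: orthD => //; apply: hf.
by rewrite h.1 ?e //; apply: hf.
Qed.

(** The orthogonal of the space of all [s *m P], that is, of the operators followed by the
    projection [P] of the target ([quot_orth], [quot_lift]). *)
Definition quot_space n m p (P : 'M[K]_(n, m)) (T : {vspace 'M[K]_(n, p)}) : {vspace 'M[K]_(m, p)} :=
  (linfun (mulmx P : 'M_(m, p) -> 'M_(n, p)) @^-1: T)%VS.

Lemma mem_quot n m p (P : 'M[K]_(n, m)) (T : {vspace 'M[K]_(n, p)}) t :
  (t \in quot_space P T) = (P *m t \in T).
Proof. by rewrite -memv_preim lfunE. Qed.

Lemma quot_orth n m p (P : 'M[K]_(n, m)) (T : {vspace 'M[K]_(n, p)}) s :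
  orth T s -> orth (quot_space P T) (s *m P).
Proof. by move=> os t; rewrite mem_quot -mulmxA => /os. Qed.

Lemma quot_lift n m p (P : 'M[K]_(n, m)) (T : {vspace 'M[K]_(n, p)}) s' :
  orth (quot_space P T) s' -> exists2 s, orth T s & s *m P = s'.
Proof.
move=> os'; have [X eX] := perp_exists T.
have : s' \in (linfun (mulmxr P : 'M_(p, n) -> 'M_(p, m)) @: X)%VS.
  apply/negPn/negP => /functional_sep[f [fl fX fs]].
  have [t et] := functional_trace fl.
  have /os' : t \in quot_space P T.
    rewrite mem_quot; apply: double_orth => s /eX sX.
    by have := fX _ (memv_img _ sX); rewrite lfunE /= et mulmxA.
  by rewrite -et fs => /eqP; rewrite oner_eq0.
by case/memv_imgP=> s /eX os ->; exists s; rewrite ?lfunE.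
Qed.

(** [F s *m P] depends only on [s *m P]: if [s *m P = 0], then [P] kills the row space of [s], which
    contains [F s]. *)
Lemma quot_rc n m p (P : 'M[K]_(n, m)) (T : {vspace 'M[K]_(n, p)}) F : rc T F ->
  exists2 F', rc (quot_space P T) F' & forall s, orth T s -> F' (s *m P) = F s *m P.
Proof.
move=> h.
pose F' s' := if excluded_middle_informative (exists2 s, orth T s & s *m P = s') is left e
  then F (proj1_sig (constructive_indefinite_description _
    (let: ex_intro2 s a b := e in ex_intro (fun s => orth T s /\ s *m P = s') s (conj a b)))) *m P
  else 0.
have F'E s : orth T s -> F' (s *m P) = F s *m P.
  move=> os; rewrite /F'; case: excluded_middle_informative => [e|]; last by case; exists s.
  case: constructive_indefinite_description => s1 /= [os1 e1].
  apply/eqP; rewrite -subr_eq0 -mulmxBl -(rcB h) //.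
  have /submxP[D ->] := h.2 _ (orthB os1 os).
  by rewrite -mulmxA mulmxBl e1 subrr mulmx0.
exists F' => //; split=> [s s' /quot_lift[s1 o1 <-] /quot_lift[s2 o2 <-]|s /quot_lift[s1 o1 <-]].
  by rewrite -mulmxDl !F'E ?h.1 ?mulmxDl //; apply: orthD.
by rewrite F'E //; apply/submxMr/h.2.
Qed.

Definition ev n p (y : 'rV[K]_n) (T : {vspace 'M[K]_(n, p)}) : {vspace 'rV[K]_p} :=
  (linfun (mulmx y : 'M_(n, p) -> 'rV_p) @: T)%VS.

Lemma mem_ev n p (y : 'rV[K]_n) (T : {vspace 'M[K]_(n, p)}) t : t \in T -> y *m t \in ev y T.
Proof. by move=> tT; have := memv_img (linfun (mulmx y)) tT; rewrite lfunE. Qed.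

Lemma evP n p (y : 'rV[K]_n) (T : {vspace 'M[K]_(n, p)}) v :
  v \in ev y T -> exists2 t, t \in T & v = y *m t.
Proof. by case/memv_imgP=> t tT ->; exists t; rewrite ?lfunE. Qed.

Section Quotient.
Variables (n m p : nat) (y : 'rV[K]_n) (P : 'M[K]_(n, m)) (P' : 'M[K]_(m, n)) (C : 'cV[K]_n).
Hypotheses (P'P : P' *m P = 1%:M) (PP' : 1%:M - P *m P' = C *m y) (yP : y *m P = 0).
Variable T : {vspace 'M[K]_(n, p)}.

Lemma quot_factor (t : 'M[K]_(n, p)) : y *m t = 0 -> t = P *m (P' *m t).
Proof.
move=> yt; apply/eqP; rewrite -subr_eq0 mulmxA -{1}[t]mul1mx -mulmxBl PP' -mulmxA yt.
by rewrite mulmx0.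
Qed.

Lemma quot_line (v : 'rV[K]_n) : v *m P = 0 -> v = dot v C *: y.
Proof.
move=> vP; rewrite -mulmx_dot -PP' mulmxBr mulmx1 mulmxA vP mul0mx subr0 //.
Qed.

Lemma quot_col (c : 'cV[K]_n) : dot y c = 0 -> c = P *m (P' *m c).
Proof.
move=> yc; apply/eqP; rewrite -subr_eq0 mulmxA -{1}[c]mul1mx -mulmxBl PP'.
by rewrite mulmx_dotr yc scale0r.
Qed.

(** Rank-nullity for [t |-> y *m t] on [T]: an element killed by [y] factors uniquely through [P],
    so the kernel is a copy of [quot_space P T]. *)
Lemma quot_dim : (\dim (quot_space P T) + \dim (ev y T))%N = \dim T.
Proof.
rewrite /ev -(limg_ker_dim (linfun (mulmx y : 'M_(n, p) -> 'rV_p)) T); congr (_ + _)%N.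
pose f := linfun (mulmx P : 'M_(m, p) -> 'M_(n, p)).
have f0 : (quot_space P T :&: lker f)%VS = 0%VS.
  apply/eqP; rewrite -subv0; apply/subvP => t; rewrite memv_cap memv_ker lfunE /= memv0.
  case/andP=> _ /eqP e; rewrite -[t]mul1mx -P'P -mulmxA e mulmx0 //.
rewrite -(limg_dim_eq f0); congr (\dim _); apply/vspaceP => t.
apply/memv_imgP/idP => [[t' t'T ->]|]; rewrite memv_cap memv_ker !lfunE /=.
  by rewrite mulmxA yP mul0mx eqxx andbT -mem_quot.
case/andP=> tT /eqP yt; exists (P' *m t); last by rewrite lfunE /= -quot_factor.
by rewrite mem_quot -quot_factor.
Qed.
End Quotient.

(* Restriction to the operators that vanish at [x], seen on the quotient by [x]. *)
Lemma restrict_space n m p (Q : 'M[K]_(p, m)) (T : {vspace 'M[K]_(n, p)}) :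
  exists T' : {vspace 'M[K]_(n, m)},
    (forall s, orth T' s <-> orth T (Q *m s)) /\
    T' = (linfun (mulmxr Q : 'M_(n, p) -> 'M_(n, m)) @: T)%VS.
Proof.
exists (linfun (mulmxr Q : 'M_(n, p) -> 'M_(n, m)) @: T)%VS; split=> // s; split=> h t tT.
  have := h _ (memv_img (linfun (mulmxr Q)) tT).
  by rewrite lfunE /= mulmxA mxtrace_mulC mulmxA.
case/memv_imgP: tT => u uT ->.
by rewrite lfunE /= mulmxA mxtrace_mulC mulmxA h.
Qed.

End RC.

(** * Small codimension, and the maps of Type 1 *)

Section Small.
Variable K : fieldType.

(** Additivity at [v] and [e0] forces the same factor on two independent vectors; a vector on the
    line of [e0] is compared after adding [e1]. *)
Lemma pointwise_scalar n (f : 'rV[K]_n -> 'rV[K]_n) : (2 <= n)%N ->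
  (forall u v, f (u + v) = f u + f v) -> (forall v, (f v <= v)%MS) ->
  exists k, forall v, f v = k *: v.
Proof.
move=> n2 fD fv.
pose i0 : 'I_n := Ordinal (ltnW n2); pose i1 : 'I_n := Ordinal n2.
pose e0 : 'rV[K]_n := delta_mx 0 i0; pose e1 : 'rV[K]_n := delta_mx 0 i1.
have /sub1P[k0 ek0] := fv e0.
have off v : ~~ (v <= e0)%MS -> f v = k0 *: v.
  case/sep=> c /row1_eq0 e0c vc.
  have /sub1P[k ek] := fv v; have /sub1P[k' ek'] := fv (v + e0).
  have kk' : k = k'.
    have := congr1 (dot^~ c) (fD v e0).
    by rewrite ek ek0 ek' !dotE e0c vc !(mulr0, addr0, mulr1).
  have : (k0 - k) *: e0 = 0.
    have := fD v e0; rewrite ek ek0 ek' kk' scalerDr => /addrI.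
    by rewrite scalerBl => <-; rewrite subrr.
  move/eqP; rewrite scaler_eq0 subr_eq0 => /orP[/eqP -> //|/eqP/matrixP/(_ 0 i0)].
  by rewrite !mxE !eqxx => /eqP; rewrite oner_eq0.
have e1e0 : ~~ (e1 <= e0)%MS.
  apply/negP => /sub1P[k /matrixP/(_ 0 i1)]; rewrite !mxE !eqxx /= mulr0 => /eqP.
  by rewrite oner_eq0.
exists k0 => v; have [ve0|] := boolP (v <= e0)%MS; last exact: off.
have /off : ~~ ((v + e1)%R <= e0)%MS.
  apply: contra e1e0 => h; rewrite -[e1](addKr v) addmx_sub // eqmx_opp //.
by rewrite fD (off e1) // scalerDr => /addIr.
Qed.

Lemma full_local n p F : (2 <= n)%N -> rc (0%VS : {vspace 'M[K]_(n, p)}) F -> rc_local 0%VS F.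
Proof.
move=> n2 h.
have o0 s : orth (0%VS : {vspace 'M[K]_(n, p)}) s.
  by move=> t; rewrite memv0 => /eqP ->; rewrite mulmx0 mxtrace0.
have /fin_all_exists[k ek] : forall i : 'I_p, exists k, forall v : 'rV_n,
    F (delta_mx i (0 : 'I_1) *m v) = k *: v.
  move=> i; apply: pointwise_scalar => // [u v|v]; first by rewrite mulmxDr h.1.
  by apply: submx_trans (submxMl (delta_mx i 0) v); apply: h.2.
exists (\row_i k i) => s _.
have es : s = \sum_i delta_mx i (0 : 'I_1) *m row i s.
  by rewrite {1}[s]matrix_sum_delta; apply: eq_bigr => i _;
     rewrite [row i s in RHS]row_sum_delta mulmx_sumr; apply: eq_bigr => j _;
     rewrite -scalemxAr mul_delta_mx mxE.
have [_ eF] := rc_sum (index_enum 'I_p) (P := xpredT)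
  (f := fun i => delta_mx i (0 : 'I_1) *m row i s) h (fun i _ => o0 _).
rewrite {1}es eF mulmx_sum_row; apply: eq_bigr => i _; rewrite ek mxE //.
Qed.

Lemma colspace_dim n m (A : 'M[K]_(m, n)) : exists X : {vspace 'cV[K]_n},
  (forall c, c \in X <-> A *m c = 0) /\ (n <= \dim X + m)%N.
Proof.
pose f := linfun (mulmx A : 'cV_n -> 'cV_m); exists (lker f); split.
  by move=> c; rewrite memv_ker lfunE /=; split=> /eqP.
have := limg_ker_dim f fullv; rewrite capfv dimvf /dim /= muln1 => e.
rewrite -[leqLHS]e leq_add2l; apply: leq_trans (dimvS (subvf _)) _.
by rewrite dimvf /dim /= muln1.
Qed.

Lemma tensor_dim n p (X : {vspace 'cV[K]_n}) (x : 'rV[K]_p) : x != 0 ->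
  exists A : {vspace 'M[K]_(n, p)},
    (forall t, t \in A <-> exists2 c, c \in X & t = c *m x) /\ \dim A = \dim X.
Proof.
move=> x0; have [d xd] := sep1 x0.
pose f := linfun (mulmxr x : 'cV[K]_n -> 'M_(n, p)); exists (f @: X)%VS; split.
  move=> t; split=> [/memv_imgP[c cX ->]|[c cX ->]]; first by exists c; rewrite ?lfunE.
  by have := memv_img f cX; rewrite lfunE.
apply: limg_dim_eq; apply/eqP; rewrite -subv0; apply/subvP => c.
rewrite memv_cap memv_ker memv0 lfunE /= => /andP[_ /eqP e].
have := congr1 (mulmx^~ d) e; rewrite mulmx_dotr xd scale1r mul0mx => ->.
by [].
Qed.

(** Induction on [n]. For a nonzero [t] in [T], dividing by a [y] with [y *m t != 0] lowers
    [\dim T], so [F] is local modulo [y]. Two independent such vectors give [z1] and [z2]; if these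
    differ, [(z1 - z2) *m s] always lies in the plane of [y1] and [y2], and the resulting rank one
    elements already fill [T], although [y1] kills them and not [t]. *)
Lemma local_small n p (T : {vspace 'M[K]_(n, p)}) F :
  (\dim T + 2 <= n)%N -> rc T F -> rc_local T F.
Proof.
elim: n T F => [|n IH] T F dT h; first by lia.
have [T0|] := eqVneq T 0%VS; first by rewrite T0 in h *; apply: full_local => //; lia.
rewrite -dimv_eq0 => dT0.
have [t tT t0] : exists2 t, t \in T & t != 0.
  exists (vpick T); rewrite ?memv_pick // vpick0 -dimv_eq0 //.
have modloc y : y *m t != 0 -> exists z, forall s, orth T s -> exists k, F s - z *m s = k *: y.
  move=> yt.
  have y0 : y != 0 by apply: contraNneq yt => ->; rewrite mul0mx.
  have [m [P [P' [C [em P'P PP' yP]]]]] := quotient_line y0.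
  case: em => em; subst m.
  have [F' h' eF'] := quot_rc P h.
  have ev0 : (0 < \dim (ev y T))%N.
    rewrite lt0n dimv_eq0; apply: contraNneq yt => e.
    by have := mem_ev y tT; rewrite e memv0.
  have dq := quot_dim P'P PP' yP T.
  have [z ez] := IH (quot_space P T) F' ltac:(lia) h'.
  exists z => s os; exists (dot (F s - z *m s) C).
  apply: (quot_line PP'); rewrite mulmxBl -eF' // ez ?mulmxA ?subrr //.
  exact: quot_orth.
have [y1 y1t] : exists y1 : 'rV_n.+1, y1 *m t != 0.
  case/matrix0Pn: t0 => i [j tij]; exists (delta_mx 0 i); rewrite -rowE.
  by apply/rV0Pn; exists j; rewrite mxE.
have [y2 y2t y2y1] : exists2 y2 : 'rV_n.+1, y2 *m t != 0 & ~~ (y2 <= y1)%MS.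
  have [v vy1] : exists v : 'rV_n.+1, ~~ (v <= y1)%MS.
    by apply: exists_not_sub; apply: leq_ltn_trans (rank_leq_row _) _; lia.
  have [vt|] := eqVneq (v *m t) 0; last by exists v.
  exists (v + y1); first by rewrite mulmxDl vt add0r.
  by apply: contra vy1 => e; rewrite -[v](addrK y1) addmx_sub // eqmx_opp.
have [z1 ez1] := modloc _ y1t; have [z2 ez2] := modloc _ y2t.
have [e12|ne] := eqVneq z1 z2.
  exists z1 => s os; have [k1 ek1] := ez1 s os; have [k2 ek2] := ez2 s os.
  apply/eqP; rewrite -subr_eq0 ek1; subst z2.
  have [c /row1_eq0 y1c y2c] := sep y2y1.
  have : k2 = 0.
    by have := congr1 (dot^~ c) ek1; rewrite ek2 !dotE y1c y2c mulr1 mulr0.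
  by move=> k20; rewrite -ek1 ek2 k20 scale0r.
have [X [eX dX]] := colspace_dim (col_mx y1 y2).
have [A [eA dA]] : _ := tensor_dim X (x := z1 - z2) ltac:(by rewrite subr_eq0).
have AT : (A <= T)%VS.
  apply/subvP => u /eA[c /eX/col2_eq0[y1c y2c] ->].
  apply/rank1_orthP => s os; have [k1 ek1] := ez1 s os; have [k2 ek2] := ez2 s os.
  have -> : (z1 - z2) *m s = k2 *: y2 - k1 *: y1.
    by rewrite -ek1 -ek2 mulmxBl; apply/rowP => i; rewrite !mxE; ring.
  by rewrite !dotE y1c y2c !mulr0 subrr.
have eAT : A = T by apply/eqP; rewrite eqEdim AT dA; lia.
move: tT; rewrite -eAT => /eA[c /eX/col2_eq0[y1c _] et].
by move: y1t; rewrite et mulmx_dot y1c scale0r eqxx.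
Qed.

(** All operators vanish at [x], so the source may be divided by [x]. This removes the [n]
    dimensions of the matrices [c *m x] from [T], whence the weaker bound. *)
Lemma local_small_restrict n p (T : {vspace 'M[K]_(n, p)}) F (x : 'rV[K]_p) :
  x != 0 -> (forall c, c *m x \in T) -> (\dim T + 2 <= 2 * n)%N -> rc T F -> rc_local T F.
Proof.
move=> x0 xT dT h.
have [m [Q [R [C [em RQ QR xQ]]]]] := quotient_line x0.
have [T' [oT' eT']] := restrict_space Q T.
have h' : rc T' (fun s => F (Q *m s)).
  split=> [s s' /oT' os /oT' os'|s /oT' os]; first by rewrite mulmxDr h.1.
  by apply: submx_trans (submxMl Q s); apply: h.2.
have [A [eA dA]] := tensor_dim {:'cV[K]_n} x0.
have dT' : (\dim T' + n <= \dim T)%N.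
  rewrite eT' addnC -(limg_ker_dim (linfun (mulmxr Q : 'M_(n, p) -> 'M_(n, m))) T) leq_add2r.
  move: dA; rewrite dimvf /dim /= muln1 => dA; rewrite -[leqLHS]dA.
  apply: dimvS; apply/subvP => t /eA[c _ ->].
  by rewrite memv_cap xT memv_ker lfunE /= -mulmxA xQ mulmx0 eqxx.
have [z ez] := local_small (T := T') ltac:(lia) h'.
exists (z *m R) => s os.
have es : s = Q *m (R *m s).
  apply/eqP; rewrite -subr_eq0 mulmxA -{1}[s]mul1mx -mulmxBl QR -mulmxA.
  suff -> : x *m s = 0 by rewrite mulmx0.
  by apply: row_dotP => c; rewrite dot0l; apply: rank1_orth os.
by rewrite {1}es ez ?mulmxA //; apply/oT'; rewrite -es.
Qed.

Lemma orthD_line n p (T : {vspace 'M[K]_(n, p)}) (c : 'cV_n) (x : 'rV_p) s :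
  orth (T + <[c *m x]>)%VS s <-> orth T s /\ dot (x *m s) c = 0.
Proof.
split=> [h|[os h] t /memv_addP[u uT [v /vlineP[k ->] ->]]].
  split; first by move=> t tT; apply: h; apply: subvP (addvSl _ _) _ tT.
  by rewrite -trace_dot; apply: h; apply: subvP (addvSr _ _) _ (memv_line _).
by rewrite mulmxDr mxtraceD -scalemxAr mxtraceZ trace_dot h mulr0 addr0 os.
Qed.

Lemma dimvD_line (A : vectType K) (T : {vspace A}) v : (\dim (T + <[v]>)%VS <= \dim T + 1)%N.
Proof.
apply: leq_trans (dimv_add_leqif _ _).1 _; rewrite leq_add2l dim_vline.
by case: (v != 0).
Qed.

(** On the operators vanishing at [x], [F] is local by [local_small_restrict]. After subtracting
    that local map, [F s] depends only on [m], where [x *m s = m *: w]; what remains is to see that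
    its values lie on the line of [w]. *)
Lemma type1_form n p (T : {vspace 'M[K]_(n, p)}) F (x : 'rV[K]_p) (w : 'rV[K]_n) :
  x != 0 -> w != 0 -> (forall c, dot w c = 0 -> c *m x \in T) ->
  (\dim T + 3 <= 2 * n)%N -> rc T F ->
  exists (z : 'rV_p) (alpha : K -> K), (forall a b, alpha (a + b) = alpha a + alpha b) /\
    forall s, orth T s -> exists2 m, x *m s = m *: w & F s = z *m s + alpha m *: w.
Proof.
move=> x0 w0 wT dT h.
have [phi wphi] := sep1 w0.
have xsE s : orth T s -> x *m s = dot (x *m s) phi *: w.
  move=> os; have /sub1P[k ->] : (x *m s <= w)%MS; last by rewrite dotZl wphi mulr1.
  by apply: sub_sep => c /row1_eq0 /wT cT; apply: rank1_orth os.
(* The orthogonal of the subspace of operators that vanish at [x]. *)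
pose T0 := (T + <[phi *m x]>)%VS.
have dT0 : (\dim T0 <= \dim T + 1)%N := dimvD_line _ _.
have xT0 c : c *m x \in T0.
  rewrite -[c](subrK (dot w c *: phi)) mulmxDl memv_add //.
    by apply: wT; rewrite !dotE wphi mulr1 subrr.
  by rewrite -scalemxAl memvZ // memv_line.
have h0 : rc T0 F.
  by split=> [s s' /orthD_line[os _] /orthD_line[os' _]|s /orthD_line[os _]]; apply h.
have [z ez] := local_small_restrict x0 xT0 ltac:(lia) h0.
have h1 := rc_sub_local z h; pose F1 s := F s - z *m s; rewrite -/F1 in h1.
have F10 s : orth T s -> x *m s = 0 -> F1 s = 0.
  by move=> os xs; rewrite /F1 ez ?subrr //; apply/orthD_line; rewrite xs dot0l.
have [[s0 [os0 xs0]]|none] := classic (exists s, orth T s /\ x *m s = w); last first.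
  exists z, (fun=> 0); split=> [a b|s os]; first by rewrite addr0.
  have [e|e] := eqVneq (dot (x *m s) phi) 0.
    exists 0; first by rewrite (xsE s os) e.
    by rewrite scale0r addr0 -[F s](subrK (z *m s)) -/(F1 s) F10 ?add0r // (xsE s os) e scale0r.
  case: none; exists ((dot (x *m s) phi)^-1 *: s); split; first exact: orthZ.
  by rewrite -scalemxAr (xsE s os) dotZl wphi mulr1 scalerA mulVf // scale1r.
have xas0 a : x *m (a *: s0) = a *: w by rewrite -scalemxAr xs0.
have F1E s m : orth T s -> x *m s = m *: w -> F1 s = F1 (m *: s0).
  move=> os xs; apply/eqP; rewrite -subr_eq0 -(rcB h1) //; last exact: orthZ.
  rewrite F10 //; first by apply: orthB => //; apply: orthZ.
  by rewrite mulmxBr xs xas0 subrr.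
suff Gw a : (F1 (a *: s0) <= w)%MS.
  exists z, (fun a => dot (F1 (a *: s0)) phi); split=> [a b|s os].
    by rewrite scalerDl h1.1 ?dotDl //; apply: orthZ.
  exists (dot (x *m s) phi); first exact: xsE.
  rewrite -[F s](subrK (z *m s)) -/(F1 s) addrC; congr (_ + _).
  rewrite (F1E _ _ os (xsE _ os)).
  by have /sub1P[k ->] := Gw (dot (x *m s) phi); rewrite dotZl wphi mulr1.
(* If [x] is outside [ev w T], some rank one operator [C *m w] of the space sends [x] to [w], and
   its range is the line of [w]. Otherwise [ev w T] is nonzero, and dividing by [w] lowers [\dim T]
   enough for [local_small_restrict]. *)
have [xw|xw] := boolP (x \in ev w T); last first.
  have [f [fl fev fx]] := functional_sep xw.
  have [C eC] := functional_trace fl.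
  have dC v : dot v C = f v by rewrite eC /mxtrace big_ord1.
  have oC : orth T (a *: (C *m w)).
    apply: orthZ => t tT; rewrite -mulmxA mxtrace_mulC /mxtrace big_ord1 -/(dot _ _) dC fev //.
    exact: mem_ev.
  rewrite -(F1E (a *: (C *m w))) //; last by rewrite -scalemxAr mulmx_dot dC fx scale1r.
  apply: submx_trans (h1.2 _ oC) _; apply: submx_trans (scalemx_sub _ (submx_refl _)) _.
  exact: submxMl.
have [m [P [P' [C [em P'P PP' wP]]]]] := quotient_line w0.
have [F' h' eF'] := quot_rc P h1.
have dq := quot_dim P'P PP' wP T.
have evd : (0 < \dim (ev w T))%N.
  rewrite lt0n dimv_eq0; apply: contraTneq xw => ->; rewrite memv0 //.
have [z' ez'] := local_small_restrict (T := quot_space P T) x0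
  (fun c => ltac:(by rewrite mem_quot mulmxA wT // dotA wP dot0l)) ltac:(lia) h'.
have F1P s : orth T s -> F1 s *m P = z' *m (s *m P).
  by move=> os; rewrite -eF' // ez' //; apply: quot_orth.
(* If not, [T0] contains every [c *m x] and every [c *m z'] with [c] annihilated by [w], in direct
   sum: at least [2 * n - 1] dimensions, one too many. *)
have z'x : (z' <= x)%MS.
  apply/negPn/negP => /sep[d2 /row1_eq0 xd2 zd2].
  have z'0 : z' != 0 by apply: contra_eq_neq zd2 => ->; rewrite dot0l eq_sym oner_eq0.
  have [X [eX dX]] := colspace_dim w.
  have [A [eA dA]] := tensor_dim {:'cV[K]_n} x0.
  have [B [eB dB]] := tensor_dim X z'0.
  have AT : (A <= T0)%VS by apply/subvP => t /eA[c _ ->].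
  have BT : (B <= T0)%VS.
    apply/subvP => t /eB[c /eX/row1_eq0 wc ->]; apply/rank1_orthP => s /orthD_line[os xs].
    rewrite (quot_col PP' wc) dotA -(mulmxA z') -F1P //.
    by rewrite F10 ?mul0mx ?dot0l // (xsE s os) xs scale0r.
  have AB : (A :&: B)%VS = 0%VS.
    apply/eqP; rewrite -subv0; apply/subvP => t; rewrite memv_cap => /andP[/eA[c _ ->] /eB[c' _ e]].
    have := congr1 (mulmx^~ d2) e; rewrite !mulmx_dotr xd2 zd2 scale0r scale1r => c'0.
    by rewrite memv0 e -c'0 mul0mx.
  have := dimv_disjoint_sum AB; rewrite dA dB dimvf /dim /= muln1 => dAB.
  have /dimvS : (A + B <= T0)%VS by rewrite subv_add AT BT.
  by lia.
have /sub1P[k ek] := z'x.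
apply: sub_sep => c /row1_eq0 wc.
rewrite (quot_col PP' wc) dotA F1P; last exact: orthZ.
by rewrite ek mulmxA -scalemxAl xas0 -!scalemxAl wP !scaler0 dot0l.
Qed.
End Small.

(** * Homomorphisms on spaces of symmetric type *)

Section SymmetricForm.
Variable K : fieldType.

Lemma additive0 (f : K -> K) : (forall a b, f (a + b) = f a + f b) -> f 0 = 0.
Proof. by move=> fD; have := fD 0 0; rewrite addr0 -{1}[f 0]addr0 => /addrI. Qed.

Lemma additiveN (f : K -> K) : (forall a b, f (a + b) = f a + f b) -> forall a, f (- a) = - f a.
Proof.
by move=> fD a; apply/eqP; rewrite -addr_eq0 -fD addNr additive0.
Qed.

(* The range condition on the rank-one matrices [t (u,v)^T (u,v)] of [S_2(K)]. *)
Lemma S2_functional_equation (f1 f2 g2 g3 : K -> K) :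
  (forall a b, f1 (a + b) = f1 a + f1 b) -> (forall a b, f2 (a + b) = f2 a + f2 b) ->
  (forall a b, g2 (a + b) = g2 a + g2 b) -> (forall a b, g3 (a + b) = g3 a + g3 b) ->
  (forall t u v, v * (f1 (t * u ^+ 2) + f2 (t * u * v)) =
                 u * (g2 (t * u * v) + g3 (t * v ^+ 2))) ->
  exists (z1 z2 : K) (alpha : K -> K), [/\ root_linear alpha,
    2%:R != 0 :> K -> forall t, alpha t = 0,
    forall t, f1 t = z1 * t + alpha t /\ f2 t = z2 * t &
    forall t, g2 t = z1 * t /\ g3 t = z2 * t + alpha t].
Proof.
move=> f1D f2D g2D g3D H.
(* Polarising in [v] eliminates [g] and the unknown [x]. The polarised identity at [(1, t, 1)] and
   at [(t, 1, 1)] has the same right-hand side, which gives linearity of [f]. *)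
have half (f g h : K -> K) : (forall a b, f (a + b) = f a + f b) ->
    (forall a b, g (a + b) = g a + g b) -> (forall a b, h (a + b) = h a + h b) ->
    (forall t, exists x, forall v, v * x + v * f (t * v) = g (t * v) + h (t * v ^+ 2)) ->
    forall t, f t = f 1 * t.
  move=> fD gD hD e.
  have pol t v w : v * f (t * w) + w * f (t * v) = h (t * v * w) + h (t * v * w).
    have [x ex] := e t.
    have e1 := ex v; have e2 := ex w; have := ex (v + w).
    rewrite (_ : t * (v + w) ^+ 2 = t * v ^+ 2 + t * w ^+ 2 + (t * v * w + t * v * w));
      last by ring.
    rewrite mulrDr fD gD !hD => e3; apply/eqP; rewrite -subr_eq0.
    rewrite (_ : _ - _ = ((v + w) * x + (v + w) * (f (t * v) + f (t * w))
      - (g (t * v) + g (t * w) + (h (t * v ^+ 2) + h (t * w ^+ 2) +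
          (h (t * v * w) + h (t * v * w)))))
      - (v * x + v * f (t * v) - (g (t * v) + h (t * v ^+ 2)))
      - (w * x + w * f (t * w) - (g (t * w) + h (t * w ^+ 2)))); last by ring.
    by rewrite e1 e2 e3 !subrr.
  move=> t; have := pol 1 t 1; rewrite !mul1r !mulr1 => e1.
  have := pol t 1 1; rewrite !mulr1 !mul1r => e2.
  by move: e1; rewrite -e2 => /addIr <-; rewrite mulrC.
have f2l : forall t, f2 t = f2 1 * t.
  apply: (half f2 g2 g3) => // t; exists (f1 t) => v.
  by have := H t 1 v; rewrite expr1n !mulr1 mul1r mulrDr.
have g2l : forall t, g2 t = g2 1 * t.
  apply: (half g2 f2 f1) => // t; exists (g3 t) => v.
  by have := H t v 1; rewrite expr1n !mulr1 mul1r mulrDr => e; rewrite addrC -e addrC.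
pose alpha t := f1 t - g2 1 * t.
have g3E t : g3 t = f2 1 * t + alpha t.
  have := H t 1 1; rewrite expr1n !mulr1 !mul1r (f2l t) (g2l t) /alpha => e.
  by rewrite addrA (addrC (f2 1 * t)) e; ring.
have aD a b : alpha (a + b) = alpha a + alpha b by rewrite /alpha f1D; ring.
have al l x : alpha (l ^+ 2 * x) = l * alpha x.
  have := H x 1 l; rewrite expr1n !mulr1 mul1r (f2l (x * l)) (g2l (x * l)) g3E => e.
  rewrite (mulrC _ x) /alpha; rewrite /alpha in e.
  transitivity (g2 1 * (x * l) + (f2 1 * (x * l ^+ 2) + (f1 (x * l ^+ 2) - g2 1 * (x * l ^+ 2)))
     - g2 1 * (x * l) - f2 1 * (x * l ^+ 2)); first by ring.
  by rewrite -e; ring.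
exists (g2 1), (f2 1), alpha; split => [//|n2 t|t|t]; last by rewrite g3E g2l.
- have := al (1 + 1) t; rewrite (_ : (1 + 1) ^+ 2 * t = t + t + (t + t)); last by ring.
  rewrite !aD => e; have : 2%:R * alpha t = 0.
    rewrite (_ : 2%:R * _ = (alpha t + alpha t + (alpha t + alpha t)) - (1 + 1) * alpha t);
      last by ring.
    by rewrite e subrr.
  by move/eqP; rewrite mulf_eq0 (negPf n2) => /eqP.
- by rewrite f2l /alpha; split=> //; ring.
Qed.

(** Range-compatibility on a space given by equations rather than by its orthogonal, suited to
    symmetry conditions. *)
Definition rc_on p n (X : 'M[K]_(p, n) -> Prop) (F : 'M[K]_(p, n) -> 'rV[K]_n) : Prop :=
  [/\ X 0, forall s s', X s -> X s' -> X (s + s') /\ F (s + s') = F s + F s' &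
    forall s, X s -> (F s <= s)%MS].

Lemma rc_on_sum p n (X : 'M[K]_(p, n) -> Prop) F I (r : seq I) (P : pred I) (f : I -> 'M_(p, n)) :
  rc_on X F -> (forall i, P i -> X (f i)) ->
  X (\sum_(i <- r | P i) f i) /\
  F (\sum_(i <- r | P i) f i) = \sum_(i <- r | P i) F (f i).
Proof.
move=> [X0 XD XF] hf; elim: r => [|i r [o e]].
  by rewrite !big_nil; split=> //; apply: (@submx0null _ _ p); apply: XF.
rewrite !big_cons; case: ifP => // Pi; have [oD eD] := XD _ _ (hf i Pi) o.
by rewrite eD e.
Qed.

Lemma rc_on_col p n (X : 'M[K]_(p, n) -> Prop) F (s : 'M[K]_(p, n)) k : rc_on X F -> X s ->
  col k s = 0 -> F s 0 k = 0.
Proof.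
move=> [_ _ XF] Xs e; have /submxP[D ->] := XF s Xs.
have := congr1 (mulmx D) e; rewrite colE mulmxA -colE mulmx0 => /matrixP/(_ 0 0).
by rewrite [LHS]mxE [RHS]mxE.
Qed.

Section Block.
Variables (r n' p' : nat) (F : 'M[K]_(r + p', r + n') -> 'rV[K]_(r + n')).

(** The transposed form of $\mathrm{S}_r\vee\mathrm{M}_{n',p'}$; for [n' = 0] it is
    $\mathrm{S}_r\coprod\mathrm{M}_{r,p'}$. *)
Definition block_sym (s : 'M[K]_(r + p', r + n')) : Prop :=
  (forall i j : 'I_r, s (lshift p' i) (lshift n' j) = s (lshift p' j) (lshift n' i)) /\
  (forall (i : 'I_r) (k : 'I_n'), s (lshift p' i) (rshift r k) = 0).

Lemma block_symD s s' : block_sym s -> block_sym s' -> block_sym (s + s').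
Proof.
move=> [h1 h2] [h1' h2']; split=> [i j|i k]; first by rewrite !mxE h1 h1'.
by rewrite !mxE h2 h2' addr0.
Qed.

Lemma block_symN s : block_sym s -> block_sym (- s).
Proof.
move=> [h1 h2]; split=> [i j|i k]; first by rewrite !mxE h1.
by rewrite !mxE h2 oppr0.
Qed.

Definition diag_gen (i : 'I_r) (t : K) : 'M[K]_(r + p', r + n') :=
  t *: delta_mx (lshift p' i) (lshift n' i).
Definition off_gen (i j : 'I_r) (t : K) : 'M[K]_(r + p', r + n') :=
  t *: (delta_mx (lshift p' i) (lshift n' j) + delta_mx (lshift p' j) (lshift n' i)).
Definition low_gen (i : 'I_p') (v : 'rV[K]_(r + n')) : 'M[K]_(r + p', r + n') :=
  delta_mx (rshift r i) (0 : 'I_1) *m v.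

Lemma low_genE i v a b : low_gen i v a b = (a == rshift r i)%:R * v 0 b.
Proof. by rewrite mxE big_ord1 !mxE eqxx andbT. Qed.

Lemma diag_sym i t : block_sym (diag_gen i t).
Proof.
split=> [a b|a k]; rewrite !mxE ?eq_lshift ?eq_rlshift ?andbF ?mulr0 //.
by rewrite andbC.
Qed.
Lemma off_sym i j t : block_sym (off_gen i j t).
Proof.
split=> [a b|a k]; rewrite !mxE ?eq_lshift ?eq_rlshift ?andbF ?addr0 ?mulr0 //.
by rewrite addrC [in LHS](andbC (a == j)) [in LHS](andbC (a == i)).
Qed.
Lemma low_sym i v : block_sym (low_gen i v).
Proof. by split=> [a b|a k]; rewrite !low_genE !eq_lrshift !mul0r. Qed.

Hypothesis h : rc_on block_sym F.
Hypothesis r2 : (2 <= r)%N.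
Variable lam : K.
Hypotheses (lam0 : lam != 0) (lam1 : lam != 1).

Let FD s s' : block_sym s -> block_sym s' -> F (s + s') = F s + F s'.
Proof. by case: h => _ hD _ hs hs'; have [] := hD s s' hs hs'. Qed.

Lemma low_form : exists z : 'I_p' -> K, forall i v, F (low_gen i v) = z i *: v.
Proof.
apply: (@fin_all_exists _ (fun=> K) (fun i k => forall v, F (low_gen i v) = k *: v)) => i.
apply: pointwise_scalar => [|u v|v]; first by apply: leq_trans r2 _; rewrite leq_addr.
  by rewrite -FD; [rewrite -mulmxDr|apply: low_sym|apply: low_sym].
by apply: submx_trans (submxMl (delta_mx (rshift r i) 0) v); case: h => _ _; apply; apply: low_sym.
Qed.

Lemma diag_genD i a b : diag_gen i (a + b) = diag_gen i a + diag_gen i b.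
Proof. by rewrite /diag_gen scalerDl. Qed.
Lemma off_genD i j a b : off_gen i j (a + b) = off_gen i j a + off_gen i j b.
Proof. by rewrite /off_gen scalerDl. Qed.

(** Tested on the rank one symmetric matrices built from [t] and the vector with entries [u], [v] in
    places [i], [j], the range condition is the hypothesis of [S2_functional_equation]. *)
Lemma pair_form (i j : 'I_r) : i != j -> exists (z1 z2 : K) (alpha : K -> K),
  [/\ root_linear alpha, 2%:R != 0 :> K -> forall t, alpha t = 0,
    forall t, F (diag_gen i t) 0 (lshift n' i) = z1 * t + alpha t /\
              F (off_gen i j t) 0 (lshift n' i) = z2 * t &
    forall t, F (off_gen i j t) 0 (lshift n' j) = z1 * t /\
              F (diag_gen j t) 0 (lshift n' j) = z2 * t + alpha t].
Proof.
move=> ij; apply: S2_functional_equation => [a b|a b|a b|a b|t u v].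
- by rewrite diag_genD FD ?mxE //; apply: diag_sym.
- by rewrite off_genD FD ?mxE //; apply: off_sym.
- by rewrite off_genD FD ?mxE //; apply: off_sym.
- by rewrite diag_genD FD ?mxE //; apply: diag_sym.
pose s := diag_gen i (t * u ^+ 2) + off_gen i j (t * u * v) + diag_gen j (t * v ^+ 2).
have hs : block_sym s by do 2?[apply: block_symD]; [apply: diag_sym|apply: off_sym|apply: diag_sym].
have es : s = (t *: (u *: delta_mx (lshift p' i) 0 + v *: delta_mx (lshift p' j) 0)) *m
    (u *: delta_mx (0 : 'I_1) (lshift n' i) + v *: delta_mx 0 (lshift n' j)).
  rewrite -scalemxAl mulmxDl !mulmxDr -!scalemxAl -!scalemxAr !mul_delta_mx.
  by rewrite /s /diag_gen /off_gen; apply/matrixP => a b; rewrite !mxE; ring.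
have /sub1P[k ek] : (F s <= (u *: delta_mx (0 : 'I_1) (lshift n' i) + v *: delta_mx 0 (lshift n' j))%R)%MS.
  by case: h => _ _ /(_ s hs) /submx_trans; apply; rewrite es submxMl.
have Fs : F s = F (diag_gen i (t * u ^+ 2)) + F (off_gen i j (t * u * v)) + F (diag_gen j (t * v ^+ 2)).
  rewrite /s (FD (block_symD (diag_sym _ _) (off_sym _ _ _)) (diag_sym _ _)).
  by rewrite (FD (diag_sym _ _) (off_sym _ _ _)).
have zero a b t' : a != b -> F (diag_gen a t') 0 (lshift n' b) = 0.
  move=> ab; apply: rc_on_col h (diag_sym _ _) _; apply/colP => c.
  by rewrite !mxE eq_lshift [b == a]eq_sym (negPf ab) andbF mulr0.
have ei : k * u = F (diag_gen i (t * u ^+ 2)) 0 (lshift n' i) + F (off_gen i j (t * u * v)) 0 (lshift n' i).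
  have := congr1 (fun A : 'rV_(r + n') => A 0 (lshift n' i)) Fs.
  rewrite ek !mxE !eqxx !eq_lshift (negPf ij) /= !mulr1 !mulr0 addr0 => ->.
  by rewrite [F (diag_gen j _) _ _]zero ?addr0 // eq_sym.
have ej : k * v = F (off_gen i j (t * u * v)) 0 (lshift n' j) + F (diag_gen j (t * v ^+ 2)) 0 (lshift n' j).
  have := congr1 (fun A : 'rV_(r + n') => A 0 (lshift n' j)) Fs.
  rewrite ek !mxE !eqxx !eq_lshift eq_sym (negPf ij) /= !mulr1 !mulr0 add0r => ->.
  by rewrite [F (diag_gen i _) _ _]zero ?add0r.
by rewrite -ei -ej; ring.
Qed.

Lemma off_genC i j t : off_gen i j t = off_gen j i t.
Proof. by rewrite /off_gen addrC. Qed.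

(** At [lam] it gives [c * lam ^+ 2 = lam * c]. This rigidity makes linear and root-linear parts
    separate. *)
Lemma linear_root_linear (c : K) : root_linear (fun t => c * t) -> c = 0.
Proof.
case=> _ /(_ lam 1); rewrite !mulr1 => /eqP; rewrite -subr_eq0.
rewrite (_ : _ - _ = c * (lam * (lam - 1))); last by ring.
by rewrite !mulf_eq0 subr_eq0 (negPf lam0) (negPf lam1) !orbF => /eqP.
Qed.

(** The data of [pair_form] glue: for fixed [i], two choices of [j] give linear coefficients whose
    difference is both linear and root-linear, hence zero. *)
Lemma diag_form : exists (z : 'I_r -> K) (alpha : K -> K),
  [/\ root_linear alpha, 2%:R != 0 :> K -> forall t, alpha t = 0,
    forall i t, F (diag_gen i t) 0 (lshift n' i) = z i * t + alpha t &
    forall i j t, i != j -> F (off_gen i j t) 0 (lshift n' j) = z i * t].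
Proof.
pose A i t := F (diag_gen i t) 0 (lshift n' i).
pose z i j := F (off_gen i j 1) 0 (lshift n' j).
have key i j : i != j -> [/\ root_linear (fun t => A i t - z i j * t),
    2%:R != 0 :> K -> forall t, A i t - z i j * t = 0,
    forall t, A i t - z i j * t = A j t - z j i * t &
    forall t, F (off_gen i j t) 0 (lshift n' j) = z i j * t].
  move=> ij; have [z1 [z2 [alpha [[aD al] a0 e1 e2]]]] := pair_form ij.
  have ez1 : z i j = z1 by rewrite /z (e2 1).1 mulr1.
  have ez2 : z j i = z2 by rewrite /z off_genC (e1 1).2 mulr1.
  have eA t : A i t - z i j * t = alpha t by rewrite /A (e1 t).1 ez1; ring.
  have eA' t : A j t - z j i * t = alpha t by rewrite /A (e2 t).2 ez2; ring.
  split=> [|n2 t|t|t]; first by split=> [x y|l x]; rewrite !eA ?aD ?al.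
  - by rewrite eA a0.
  - by rewrite eA eA'.
  - by rewrite ez1 (e2 t).1.
have zE i j k : i != j -> i != k -> z i j = z i k.
  move=> ij ik; apply/eqP; rewrite -subr_eq0; apply/eqP/linear_root_linear.
  have [[D1 l1] _ _ _] := key i j ij; have [[D2 l2] _ _ _] := key i k ik.
  split=> [x y|l x]; first by rewrite mulrDr.
  transitivity (A i (l ^+ 2 * x) - z i k * (l ^+ 2 * x) - (A i (l ^+ 2 * x) - z i j * (l ^+ 2 * x))).
    by ring.
  by rewrite l1 l2; ring.
pose i0 : 'I_r := Ordinal (ltnW r2); pose i1 : 'I_r := Ordinal r2.
pose pt i := if i == i0 then i1 else i0.
have ipt i : i != pt i by rewrite /pt; have [->|] := eqVneq i i0.
exists (fun i => z i (pt i)), (fun t => A i0 t - z i0 (pt i0) * t).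
have [rl a0 _ _] := key _ _ (ipt i0); split => // [i t|i j t ij].
  have [->|i_i0] := eqVneq i i0; first by rewrite /A; ring.
  have [_ _ e _] := key _ _ i_i0.
  rewrite -/(A i t) (zE i0 (pt i0) i) // ?[i0 == i]eq_sym //.
  by rewrite -e (zE i (pt i) i0) //; ring.
by have [_ _ _ ->] := key _ _ ij; rewrite (zE i j (pt i)).
Qed.

(** By range-compatibility entry [k] of [F s] depends only on column [k] of [s] ([rc_on_col]), so
    [s] may be replaced by a sum of generators having the same column. *)
Lemma block_form : exists (z : 'rV[K]_(r + p')) (alpha : K -> K),
  [/\ root_linear alpha, 2%:R != 0 :> K -> forall t, alpha t = 0 &
   forall s, block_sym s ->
    (forall j, F s 0 (lshift n' j) = (z *m s) 0 (lshift n' j) + alpha (s (lshift p' j) (lshift n' j))) /\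
    (forall k, F s 0 (rshift r k) = (z *m s) 0 (rshift r k))].
Proof.
have [zE eE] := low_form; have [zA [alpha [rl a0 eD eO]]] := diag_form.
exists (row_mx (\row_i zA i) (\row_i zE i)), alpha; split=> // s hs.
have lowE k : let M := \sum_i low_gen i (s (rshift r i) k *: delta_mx 0 k) in
    [/\ block_sym M, F M 0 k = \sum_i zE i * s (rshift r i) k &
     forall a, M a k = \sum_i (a == rshift r i)%:R * s (rshift r i) k].
  move=> M; have [hM eM] := rc_on_sum (index_enum 'I_p') (P := xpredT)
    (f := fun i => low_gen i (s (rshift r i) k *: delta_mx 0 k)) h (fun i _ => low_sym i _).
  split=> //; first by rewrite eM summxE; apply: eq_bigr => i _; rewrite eE !mxE !eqxx mulr1.
  by move=> a; rewrite summxE; apply: eq_bigr => i _; rewrite low_genE !mxE !eqxx mulr1.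
have colE k M : block_sym M -> (forall a, M a k = s a k) -> F s 0 k = F M 0 k.
  move=> hM e; apply/eqP; rewrite -subr_eq0; apply/eqP.
  have -> : F s 0 k - F M 0 k = F (s - M) 0 k.
    have := FD (block_symD hs (block_symN hM)) hM; rewrite subrK => ->.
    by rewrite [X in X - _]mxE addrK.
  apply: rc_on_col h (block_symD hs (block_symN hM)) _.
  by apply/colP => a; rewrite !mxE e subrr.
have zs k : (row_mx (\row_i zA i) (\row_i zE i) *m s) 0 k =
    \sum_i zA i * s (lshift p' i) k + \sum_i zE i * s (rshift r i) k.
  rewrite mxE big_split_ord /=; congr (_ + _); apply: eq_bigr => i _.
    by rewrite row_mxEl mxE.
  by rewrite row_mxEr mxE.
split=> [j|k].
  have [hL FL ML] := lowE (lshift n' j); set L := \sum_i _ in hL FL ML.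
  pose O := \sum_(i | i != j) off_gen i j (s (lshift p' i) (lshift n' j)).
  have [hO FO] := rc_on_sum (index_enum 'I_r) (P := fun i => i != j)
    (f := fun i => off_gen i j (s (lshift p' i) (lshift n' j))) h (fun i _ => off_sym i j _).
  rewrite (colE _ (O + diag_gen j (s (lshift p' j) (lshift n' j)) + L)).
  - rewrite (FD (block_symD hO (diag_sym _ _)) hL) (FD hO (diag_sym _ _)) mxE mxE FL FO.
    rewrite eD zs summxE (eq_bigr (fun i => zA i * s (lshift p' i) (lshift n' j))).
      by rewrite [in RHS](bigD1 j) //=; ring.
    by move=> i ij; apply: eO.
  - exact: block_symD (block_symD hO (diag_sym _ _)) hL.
  move=> a; rewrite 2!mxE ML summxE [diag_gen _ _ _ _]mxE mxE eqxx andbT.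
  case: (split_ordP a) => i ->; rewrite ?eq_lshift ?eq_rlshift ?mulr0 ?addr0.
    rewrite [X in _ + X]big1 ?addr0 => [|k _]; last by rewrite eq_lrshift mul0r.
    have [->|ij] := eqVneq i j.
      rewrite big1 ?add0r ?mulr1 // => k kj.
      by rewrite !mxE !eq_lshift eqxx [j == k]eq_sym (negPf kj) /= addr0 mulr0.
    rewrite mulr0 addr0 (bigD1 i) //= big1 ?addr0 => [|k /andP[kj ki]].
      by rewrite !mxE !eq_lshift !eqxx [j == i]eq_sym (negPf ij) /= addr0 mulr1.
    by rewrite !mxE !eq_lshift [i == k]eq_sym (negPf ki) (negPf ij) /= addr0 mulr0.
  rewrite big1 ?add0r => [|k kj]; last by rewrite !mxE !eq_rlshift /= addr0 mulr0.
  rewrite (bigD1 i) //= eqxx mul1r big1 ?addr0 // => k ki.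
  by rewrite eq_rshift [i == k]eq_sym (negPf ki) mul0r.
have [hL FL ML] := lowE (rshift r k); set L := \sum_i _ in hL FL ML.
rewrite (colE _ L) // => [|a]; first by rewrite FL zs [X in X + _]big1 ?add0r // => i _; rewrite hs.2 mulr0.
rewrite ML; case: (split_ordP a) => i ->.
  by rewrite hs.2 big1 // => j _; rewrite eq_lrshift mul0r.
rewrite (bigD1 i) //= eqxx mul1r big1 ?addr0 // => j ji.
by rewrite eq_rshift [i == j]eq_sym (negPf ji) mul0r.
Qed.
End Block.

Lemma pid_block_sym r n' p' (s : 'M[K]_(r + p', r + n')) :
  (pid_mx r *m s : 'M_(r + n')) ^T = pid_mx r *m s <-> block_sym s.
Proof.
have e : (pid_mx r *m s : 'M_(r + n')) = block_mx (ulsubmx s) (ursubmx s) 0 0.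
  by rewrite pid_mx_block -{1}[s]submxK mulmx_block !mul1mx !mul0mx !addr0.
rewrite e tr_block_mx; split=> [/eq_block_mx[e1 _ e3 _]|[h1 h2]].
  split=> [i j|i k]; first by have /matrixP/(_ j i) := e1; rewrite !mxE => ->.
  by have /matrixP/(_ k i) := e3; rewrite !mxE => ->.
have -> : ursubmx s = 0 by apply/matrixP => i k; rewrite !mxE h2.
rewrite !trmx0; congr (block_mx _ _ _ _); apply/matrixP => i j; rewrite !mxE; exact: h1.
Qed.

Lemma root_linear0 (alpha : K -> K) : root_linear alpha -> alpha 0 = 0.
Proof. by case=> aD _; apply: additive0. Qed.

(* In characteristic 2 a symmetric form is additive on the diagonal, so that a
   root-linear form turns it into a linear one. *)
Lemma root_linear_quadratic n (B : 'M[K]_n) (alpha : K -> K) (l : 'rV[K]_n) :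
  2%:R = 0 :> K -> B^T = B -> root_linear alpha ->
  alpha (dot (l *m B) l^T) = dot (\row_i alpha (B i i)) l^T.
Proof.
move=> c2 sB rl; pose q (l : 'rV[K]_n) := dot (l *m B) l^T.
have qD a b : q (a + b) = q a + q b.
  have ab : dot (b *m B) a^T = dot (a *m B) b^T.
    by rewrite -dotA -{1}sB -trmx_mul dot_trC.
  transitivity (q a + q b + 2%:R * dot (a *m B) b^T).
    by rewrite /q linearD mulmxDl !dotE ab; ring.
  by rewrite c2 mul0r addr0.
have q0 : q 0 = 0 by rewrite /q mul0mx dot0l.
rewrite -/(q l) [in LHS](row_sum_delta l) (big_morph q qD q0).
rewrite (big_morph alpha rl.1 (root_linear0 rl)) [RHS]mxE; apply: eq_bigr => i _.
rewrite [in RHS]mxE [l^T _ _]mxE mulrC -rl.2; congr (alpha _).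
rewrite /q linearZ /= -scalemxAl !dotE -rowE trmx_delta /dot -colE !mxE.
by ring.
Qed.

Variable lam : K.
Hypotheses (lam0 : lam != 0) (lam1 : lam != 1).

(** The substitution [tau] carries the block space onto the given one. The diagonal term survives
    the congruence by [L] because in characteristic 2 it is intrinsic, and in other characteristics
    [alpha] vanishes. *)
Lemma sym_form_normal r n p (L : 'M[K]_n) (R : 'M[K]_p) F :
  (2 <= r)%N -> (r <= n)%N -> (r <= p)%N -> L \in unitmx -> R \in unitmx ->
  rc_on (fun s => (L *m pid_mx r *m R *m s)^T = L *m pid_mx r *m R *m s) F ->
  exists (z : 'rV_p) (alpha : K -> K),
    [/\ root_linear alpha, 2%:R != 0 :> K -> forall t, alpha t = 0 &
     forall s, (L *m pid_mx r *m R *m s)^T = L *m pid_mx r *m R *m s ->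
       F s = z *m s + \row_i alpha ((L *m pid_mx r *m R *m s) i i)].
Proof.
move=> r2 rn rp.
have [n' en] : exists n', n = (r + n')%N by exists (n - r)%N; lia.
have [p' ep] : exists p', p = (r + p')%N by exists (p - r)%N; lia.
subst n p => uL uR [X0 XD Xr].
pose tau (s : 'M[K]_(r + p', r + n')) := invmx R *m s *m L^T.
have uLT : L^T \in unitmx by rewrite unitmx_tr.
have Xtau s : block_sym s <->
    (L *m pid_mx r *m R *m tau s)^T = L *m pid_mx r *m R *m tau s.
  have e : L *m pid_mx r *m R *m tau s = L *m (pid_mx r *m s) *m L^T.
    by rewrite /tau !mulmxA mulmxK.
  rewrite e -pid_block_sym; split=> [e1|].
    by rewrite !trmx_mul trmxK -trmx_mul e1 !mulmxA.
  rewrite trmx_mul trmxK trmx_mul mulmxA => /(congr1 (mulmx (invmx L))).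
  rewrite -!mulmxA !mulKmx // !mulmxA => /(congr1 (mulmx^~ (invmx L^T))).
  by rewrite !mulmxK.
have h : rc_on (@block_sym r n' p') (fun s => F (tau s) *m invmx L^T).
  split=> [|s s' /Xtau hs /Xtau hs'|s /Xtau hs].
  - by split=> *; rewrite !mxE.
  - have [h1 h2] := XD _ _ hs hs'.
    have e : tau (s + s') = tau s + tau s' by rewrite /tau mulmxDr mulmxDl.
    by split; [apply/Xtau; rewrite e|rewrite e h2 mulmxDl].
  - apply: submx_trans (submxMr _ (Xr _ hs)) _.
    by rewrite /tau mulmxK // submxMl.
have [z [alpha [rl a0 e]]] := block_form h r2 lam0 lam1.
exists (z *m R), alpha; split => // s hs.
pose s' := R *m s *m invmx L^T.
have es : s = tau s' by rewrite /tau /s' !mulmxA mulVmx // mul1mx mulmxKV.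
have hs' : block_sym s' by apply/Xtau; rewrite -es.
have eF : F s *m invmx L^T = z *m s' + \row_i alpha ((pid_mx r *m s' : 'M_(r + n')) i i).
  have pE i j : (pid_mx r *m s' : 'M_(r + n')) i j = block_mx (ulsubmx s') (ursubmx s') 0 0 i j.
    by rewrite pid_mx_block -{1}[s']submxK mulmx_block !mul1mx !mul0mx !addr0.
  apply/rowP => i; rewrite [RHS]mxE [X in _ + X]mxE pE {1}es.
  case: (split_ordP i) => k ->; first by rewrite (e _ hs').1 block_mxEul !mxE.
  by rewrite (e _ hs').2 block_mxEdr [X in alpha X]mxE (root_linear0 rl) addr0.
have -> : F s = F s *m invmx L^T *m L^T by rewrite mulmxKV.
rewrite eF mulmxDl; congr (_ + _); first by rewrite /s' !mulmxA mulmxKV.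
have eJ : L *m pid_mx r *m R *m s = L *m (pid_mx r *m s') *m L^T.
  by rewrite /s' !mulmxA mulmxKV.
have [c2|c2] := eqVneq (2%:R : K) 0; last first.
  by apply/rowP => i; rewrite !mxE big1 ?a0 // => j _; rewrite mxE a0 // mul0r.
apply/rowP => i; rewrite [RHS]mxE eJ.
rewrite (_ : (L *m (pid_mx r *m s') *m L^T) i i = dot (row i L *m (pid_mx r *m s')) (row i L)^T).
  rewrite (root_linear_quadratic _ c2 _ rl); last by apply/pid_block_sym.
  rewrite [LHS]mxE /dot [RHS]mxE; apply: eq_bigr => j _; congr (_ * _).
  by rewrite !mxE.
rewrite /dot -row_mul [LHS]mxE [RHS]mxE; apply: eq_bigr => j _.
by rewrite [row _ _ _ _]mxE [L^T _ _]mxE [(row i L)^T _ _]mxE [row i L _ _]mxE.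
Qed.

Lemma sym_form n p (J : 'M[K]_(n, p)) F : (2 <= \rank J)%N ->
  rc_on (fun s => (J *m s)^T = J *m s) F ->
  exists (z : 'rV_p) (alpha : K -> K),
    [/\ root_linear alpha, 2%:R != 0 :> K -> forall t, alpha t = 0 &
     forall s, (J *m s)^T = J *m s -> F s = z *m s + \row_i alpha ((J *m s) i i)].
Proof.
move=> r2 h; have eJ := mulmx_ebase J.
rewrite -{1 2 3 4 5}eJ in h *.
exact: (sym_form_normal r2 (rank_leq_row J) (rank_leq_col J)
  (col_ebase_unit J) (row_ebase_unit J)).
Qed.
End SymmetricForm.

(** * Quotients of symmetric type *)

Section Kinds.
Variable K : fieldType.
Definition linear_at n p (T : {vspace 'M[K]_(n, p)}) (F : 'M[K]_(p, n) -> 'rV[K]_n) (c : 'cV[K]_n) :=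
  forall s k, orth T s -> dot (F (k *: s)) c = k * dot (F s) c.

(** Modulo the line of [y] the space is the symmetric type defined by [J], with a nonzero
    root-linear part in the quotient map; [kJdim] says that the quotient attains the codimension
    bound. *)
Record kindJ n p (T : {vspace 'M[K]_(n, p)}) (F : 'M[K]_(p, n) -> 'rV[K]_n) (y : 'rV[K]_n)
    m (P : 'M[K]_(n, m)) (P' : 'M[K]_(m, n)) (C : 'cV[K]_n) (J : 'M[K]_(m, p))
    (z : 'rV[K]_p) (alpha : K -> K) : Prop := KindJ {
  kJn : n = m.+1;
  kJP : P' *m P = 1%:M;
  kJC : 1%:M - P *m P' = C *m y;
  kJy : y *m P = 0;
  kJdim : (\dim (quot_space P T) + 3 = 2 * m)%N;
  kJrk : (2 <= \rank J)%N;
  kJrk3 : \rank J = 2%N \/ m = 3%N;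
  kJX : forall s, orth (quot_space P T) s <-> (J *m s)^T = J *m s;
  kJchar : 2%:R = 0 :> K;
  kJrl : root_linear alpha;
  kJa : exists t, alpha t != 0;
  kJF : forall s, orth T s ->
    F s *m P = z *m (s *m P) + \row_i alpha ((J *m (s *m P)) i i) }.

(** Modulo [v], nonlinearity shows in at most one direction [w]; local and Type 1 quotients are of
    this sort. *)
Definition low n p (T : {vspace 'M[K]_(n, p)}) F (v : 'rV[K]_n) :=
  exists w : 'rV[K]_n, forall c, dot v c = 0 -> dot w c = 0 -> linear_at T F c.

Lemma two_rows n m (A : 'M[K]_(m, n)) : (2 <= \rank A)%N ->
  exists a b : 'rV_m, a *m A != 0 /\ ~~ (b *m A <= a *m A)%MS.
Proof.
move=> rA; have /rowV0Pn[v vA v0] : A != 0 by rewrite -mxrank_eq0; lia.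
case/submxP: vA => a ea.
have [i hi] : exists i, ~~ (row i A <= v)%MS.
  apply/existsP; rewrite -negb_forall; apply/negP => /forallP h.
  have : (A <= v)%MS by apply/row_subP.
  by move/mxrankS; rewrite leqNgt (leq_ltn_trans (rank_leq_row v)) // ltnW.
exists a, (delta_mx 0 i); rewrite -ea -rowE; split=> //.
Qed.

Lemma ev2_sub n p (T : {vspace 'M[K]_(n, p)}) v (a b u : 'rV[K]_p) :
  (\dim (ev v T) <= 2)%N -> a \in ev v T -> b \in ev v T -> a != 0 -> ~~ (b <= a)%MS ->
  u \in ev v T -> (u <= col_mx a b)%MS.
Proof.
move=> d2 aT bT a0 ba uT.
have abT : (<[a]> + <[b]> <= ev v T)%VS by rewrite subv_add -!memvE aT bT.
have dab : \dim (<[a]> + <[b]>) = 2%N.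
  rewrite dimv_disjoint_sum ?dim_vline ?a0.
    by rewrite (_ : b != 0) //; apply: contraNneq ba => ->; apply: sub0mx.
  apply/eqP; rewrite -subv0; apply/subvP => c; rewrite memv_cap memv0.
  case/andP=> /vlineP[k ->] /vlineP[l e].
  have [->|k0] := eqVneq k 0; first by rewrite scale0r.
  have [l0|l0] := eqVneq l 0; first by rewrite e l0 scale0r.
  by case/negP: ba; rewrite -[b](scalerK l0) -e !scalemx_sub.
have e : (<[a]> + <[b]>)%VS = ev v T by apply/eqP; rewrite eqEdim abT dab.
move: uT; rewrite -e => /memv_addP[_ /vlineP[k ->] [_ /vlineP[l ->] ->]].
exact: sub_col2.
Qed.

Section KindJ.
Variables (n p : nat) (T : {vspace 'M[K]_(n, p)}) (F : 'M[K]_(p, n) -> 'rV[K]_n) (y : 'rV[K]_n)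
    (m : nat) (P : 'M[K]_(n, m)) (P' : 'M[K]_(m, n)) (C : 'cV[K]_n) (J : 'M[K]_(m, p))
    (z : 'rV[K]_p) (alpha : K -> K).
Hypothesis k : kindJ T F y P P' C J z alpha.

Lemma kindJ_sym s : orth T s -> (J *m (s *m P))^T = J *m (s *m P).
Proof. by move=> os; apply/(kJX k)/quot_orth. Qed.

Lemma kindJ_swap s (a b : 'rV[K]_m) : orth T s ->
  dot (a *m J *m s) (P *m b^T) = dot (b *m J *m s) (P *m a^T).
Proof.
move=> os; have e x x' : dot (x *m J *m s) (P *m x'^T) = dot (x *m (J *m (s *m P))) x'^T.
  by rewrite dotA !mulmxA.
by rewrite !e -dotA -{1}(kindJ_sym os) -trmx_mul dot_trC.
Qed.

(** The symmetry of [J *m s *m P] written as explicit elements of [T]; applying a row [v] to them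
    bounds [ev v T] from below. *)
Lemma kindJ_mem (a b : 'rV[K]_m) : (P *m a^T) *m (b *m J) - (P *m b^T) *m (a *m J) \in T.
Proof.
apply: double_orth => s os.
by rewrite mulmxBr raddfB /= !trace_dot (kindJ_swap a b os) subrr.
Qed.

Lemma kindJ_ev (v : 'rV[K]_n) (a b : 'rV[K]_m) :
  dot v (P *m a^T) *: (b *m J) - dot v (P *m b^T) *: (a *m J) \in ev v T.
Proof. by have := mem_ev v (kindJ_mem a b); rewrite mulmxBr !mulmx_dot. Qed.

Lemma kindJ_form s (c : 'cV[K]_m) : orth T s ->
  dot (F s) (P *m c) = dot (z *m (s *m P)) c + alpha (dot (c^T *m J *m (s *m P)) c).
Proof.
move=> os; rewrite dotA (kJF k) // dotDl; congr (_ + _).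
have := root_linear_quadratic c^T (kJchar k) (kindJ_sym os) (kJrl k).
by rewrite trmxK !mulmxA.
Qed.

Lemma kindJ_linear (c : 'cV[K]_m) : c^T *m J = 0 -> linear_at T F (P *m c).
Proof.
move=> e s l os; rewrite !kindJ_form ?e //; last exact: orthZ.
by rewrite !mul0mx dot0l (root_linear0 (kJrl k)) !addr0 -!scalemxAl -!scalemxAr dotZl.
Qed.

(** On multiples of a lift of the rank one operator [d *m (J *m d)^T], the pairing with [P *m c]
    contains [alpha] itself; were it linear, [alpha] would be linear and root-linear, hence zero. *)
Lemma kindJ_nonlinear (lam : K) (lam0 : lam != 0) (lam1 : lam != 1) (c : 'cV[K]_m) : c^T *m J != 0 -> ~ linear_at T F (P *m c).
Proof.
case/sep1=> d ed lin.
have /quot_lift[s os es] : orth (quot_space P T) (d *m (J *m d)^T).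
  by apply/(kJX k); rewrite mulmxA trmx_mul trmxK.
have q : dot (c^T *m J *m (s *m P)) c = 1.
  by rewrite es mulmx_dot ed scale1r -dot_tr trmxK dotA ed.
have al t : alpha t = alpha 1 * t.
  have := lin s t os; rewrite !kindJ_form //; last exact: orthZ.
  rewrite -!scalemxAl -!scalemxAr !dotZl q mulr1 mulrDr => /addrI ->.
  by rewrite mulrC.
have a0 : alpha 1 = 0.
  apply: (linear_root_linear lam0 lam1); split=> [a b|l x]; first by rewrite mulrDr.
  by rewrite -!al; apply: (kJrl k).2.
by have [t] := kJa k; rewrite al a0 mul0r eqxx.
Qed.

Lemma kindJ_row_sub : (forall i : 'rV[K]_m, i *m P^T = 0 -> i = 0).
Proof.
by move=> i e; rewrite -[i]mulmx1 -[1%:M]trmx1 -(kJP k) trmx_mul mulmxA e mul0mx.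
Qed.

(** [P] and [phi] together span the columns, so [J3] is determined by its restrictions [J] and [x3].
    The quotient gives symmetry on the block of [P]; the elements of [T] supplied as hypothesis give
    the mixed block. *)
Lemma glue (phi : 'cV[K]_n) (x3 : 'rV[K]_p) : dot y phi = 1 ->
  (forall t, t \in T -> (y *m t <= J)%MS) ->
  (forall a : 'rV_m, phi *m (a *m J) - (P *m a^T) *m x3 \in T) ->
  exists J3 : 'M[K]_(n, p), [/\ forall s, orth T s <-> (J3 *m s)^T = J3 *m s,
    P^T *m J3 = J, phi^T *m J3 = x3 & x3 = 0 -> (\rank J3 <= \rank J)%N].
Proof.
move=> yphi yT hT.
have yphiM : y *m phi = 1%:M by rewrite [LHS]mx11_scalar -/(dot y phi) yphi.
pose J3 := (1%:M - y^T *m phi^T) *m P'^T *m J + y^T *m x3.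
have Py : P^T *m y^T = 0 by rewrite -trmx_mul (kJy k) trmx0.
have PP : P^T *m P'^T = 1%:M by rewrite -trmx_mul (kJP k) trmx1.
have phiy : phi^T *m y^T = 1%:M by rewrite -trmx_mul yphiM trmx1.
have PJ3 : P^T *m J3 = J.
  by rewrite mulmxDr !mulmxA Py mul0mx addr0 mulmxBr mulmx1 mulmxA Py mul0mx subr0 PP mul1mx.
have phiJ3 : phi^T *m J3 = x3.
  rewrite mulmxDr !mulmxA phiy mul1mx mulmxBr mulmx1 mulmxA phiy mul1mx subrr !mul0mx.
  by rewrite add0r.
exists J3; split=> // [s|x30]; last first.
  by rewrite /J3 x30 mulmx0 addr0 mxrankM_maxr.
split=> [os|sJ t tT].
  pose Q := P' *m (1%:M - phi *m y); pose B := J3 *m s.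
  have eI : 1%:M = P *m Q + phi *m y.
    have e : (1%:M - P *m P') *m (1%:M - phi *m y) = 0.
      by rewrite (kJC k) -mulmxA mulmxBr mulmx1 mulmxA yphiM mul1mx subrr mulmx0.
    by apply/eqP; rewrite -subr_eq0 opprD addrA addrAC -{1}[_ - phi *m y]mul1mx mulmxA -mulmxBl e.
  have e1 : (P^T *m B *m P)^T = P^T *m B *m P.
    by rewrite /B mulmxA PJ3 -mulmxA kindJ_sym.
  have e2 : (P^T *m B *m phi)^T = phi^T *m B *m P.
    rewrite /B !mulmxA PJ3 phiJ3; apply: row_dotP => c.
    have := os _ (hT c^T); rewrite trmxK mulmxBr raddfB /= !trace_dot => /eqP.
    rewrite subr_eq0 => /eqP e'.
    by rewrite -dot_tr trmxK !dotA !mulmxA e' dotA.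
  have e3 : (phi^T *m B *m phi)^T = phi^T *m B *m phi.
    by rewrite [_ *m phi]mx11_scalar tr_scalar_mx.
  apply/eqP; rewrite -/B -subr_eq0; apply/eqP; set D := B^T - B.
  have tB i j (X : 'M_(n, i)) (Y : 'M_(n, j)) : X^T *m D *m Y = (Y^T *m B *m X)^T - X^T *m B *m Y.
    by rewrite /D mulmxBr mulmxBl !trmx_mul trmxK mulmxA.
  have D1 : P^T *m D = 0.
    by rewrite -[LHS]mulmx1 eI mulmxDr !mulmxA !tB e1 -e2 trmxK !subrr !mul0mx addr0.
  have D2 : phi^T *m D = 0.
    by rewrite -[LHS]mulmx1 eI mulmxDr !mulmxA !tB e2 e3 !subrr !mul0mx addr0.
  rewrite -[D]mul1mx -[1%:M]trmx1 eI [(_ + _)^T]linearD /= !trmx_mul mulmxDl -!mulmxA.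
  by rewrite D1 mulmxA D2 !mulmx0 addr0.
(* Subtracting from [t] the supplied element of [T] attached to [a] leaves an element killed by [y],
   which comes from the quotient. *)
have /submxP[a ea] := yT t tT.
pose t1 := t - (phi *m (a *m J) - (P *m a^T) *m x3).
have t1T : t1 \in T by rewrite memvB.
have yt1 : y *m t1 = 0.
  by rewrite !mulmxBr !mulmx_dot yphi dotA (kJy k) dot0l scale0r scale1r subr0 ea subrr.
have et1 := quot_factor (kJC k) yt1.
have o1 : orth (quot_space P T) (s *m P).
  have e : J *m (s *m P) = P^T *m (J3 *m s) *m P by rewrite -PJ3 !mulmxA.
  by apply/(kJX k); rewrite e !trmx_mul trmxK -[s^T *m J3^T]trmx_mul sJ !mulmxA.
have t't : P' *m t1 \in quot_space P T by rewrite mem_quot -et1.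
have := o1 _ t't; rewrite -mulmxA -et1 /t1 mulmxBr raddfB /= mulmxBr raddfB /= !trace_dot.
have -> : dot (a *m J *m s) phi = dot (x3 *m s) (P *m a^T).
  have e : J *m (s *m phi) = (x3 *m s *m P)^T.
    rewrite -PJ3 -phiJ3 -!mulmxA (mulmxA J3) -sJ trmx_mul -!mulmxA.
    by rewrite !trmx_mul !trmxK !mulmxA.
  by rewrite -!dotA e dot_trC !dotA.
by rewrite subrr subr0.
Qed.
End KindJ.
End Kinds.

(** * Extending the symmetry to a target of dimension at least 4 *)

Section Cases.
Variable K : fieldType.
Lemma exists_ker m n (A : 'M[K]_(m, n)) : (m < n)%N -> exists2 c : 'cV_n, c != 0 & A *m c = 0.
Proof.
move=> mn; have [X [eX dX]] := colspace_dim A.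
have X0 : X != 0%VS by rewrite -dimv_eq0; lia.
by exists (vpick X); [rewrite vpick0|apply/eX/memv_pick].
Qed.

Variable lam : K.
Hypotheses (lam0 : lam != 0) (lam1 : lam != 1).

Section Cases.
Variables (n p : nat) (T : {vspace 'M[K]_(n, p)}) (F : 'M[K]_(p, n) -> 'rV[K]_n).
Hypothesis h : rc T F.
Hypothesis TR : forall v, (2 <= \dim (ev v T))%N -> low T F v \/ (\dim (ev v T) = 2%N /\
  exists m (P : 'M_(n, m)) P' C (J : 'M_(m, p)) z alpha, kindJ T F v P P' C J z alpha).

Section KindJ.
Variables (y : 'rV[K]_n)
    (m : nat) (P : 'M[K]_(n, m)) (P' : 'M[K]_(m, n)) (C : 'cV[K]_n) (J : 'M[K]_(m, p))
    (z : 'rV[K]_p) (alpha : K -> K).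
Hypothesis k : kindJ T F y P P' C J z alpha.
Hypothesis yT : (0 < \dim (ev y T))%N.

(** For [v] off the line of [y], [ev v T] has dimension at most 2, since a larger one would make [v]
    low and leave a nonlinear direction unexplained. If [v] lifts a basis vector, both [ev v T] and
    [ev (v + y) T] are then the span of the two other rows of [J]. Hence [ev y T] lies in all three
    such planes, whose intersection is zero. *)
Lemma caseI : \rank J = 3%N -> m = 3%N -> False.
Proof.
move=> rJ m3.
have fJ : row_free J by rewrite /row_free rJ m3.
have dim2 (v : 'rV[K]_n) : v *m P != 0 -> (\dim (ev v T) <= 2)%N.
  move=> vP; rewrite leqNgt; apply/negP => d3.
  have [[w hw]|[d2 _]] := TR (ltnW d3); last by rewrite d2 in d3.
  have [c c0 /col2_eq0[vc wc]] := exists_ker (col_mx (v *m P) (w *m P)) ltac:(by rewrite m3).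
  apply: (kindJ_nonlinear k lam0 lam1 (c := c)); last by apply: hw; rewrite dotA.
  by rewrite mulmx_free_eq0 // -[0]trmx0 (inj_eq trmx_inj).
have [u uT u0] : exists2 u, u \in ev y T & u != 0.
  by exists (vpick (ev y T)); rewrite ?memv_pick // vpick0 -dimv_eq0 -lt0n.
have [t tT eu] := evP uT.
pose e i : 'rV[K]_m := delta_mx 0 i.
have sub v i j : v *m P = e i -> i != j -> e j *m J \in ev v T.
  move=> vP ij; have := kindJ_ev k v (e i) (e j).
  rewrite !dotA vP /e /dot !trmx_delta !mul_delta_mx_cond eqxx (negPf ij) !mxE !eqxx /=.
  by rewrite scale1r scale0r subr0.
have free i j : i != j -> e i *m J != 0 /\
    ~~ (e j *m J <= e i *m J)%MS.
  move=> ij; split.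
    rewrite mulmx_free_eq0 //; apply/eqP => /matrixP/(_ 0 i); rewrite !mxE !eqxx => /eqP.
    by rewrite oner_eq0.
  apply/negP => /sub1P[l]; rewrite scalemxAl => /(row_free_inj fJ)/matrixP/(_ 0 j).
  by rewrite !mxE !eqxx [j == i]eq_sym (negPf ij) mulr0 => /eqP; rewrite oner_eq0.
have uS (i j l : 'I_m) : i != j -> i != l -> j != l ->
    (u <= col_mx (e j *m J) (e l *m J))%MS.
  move=> ij il jl; pose v : 'rV_n := e i *m P'.
  have vP : v *m P = e i by rewrite -mulmxA (kJP k) mulmx1.
  have vP' : (v + y) *m P = e i by rewrite mulmxDl vP (kJy k) addr0.
  have d0 : e i != 0.
    by apply/eqP => /matrixP/(_ 0 i); rewrite !mxE !eqxx => /eqP; rewrite oner_eq0.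
  have [f1 f2] := free _ _ jl.
  have -> : u = (v + y) *m t - v *m t by rewrite mulmxDl -eu addrC addKr.
  have v0 : v *m P != 0 by rewrite vP.
  have v0' : (v + y) *m P != 0 by rewrite vP'.
  apply: addmx_sub.
    exact: ev2_sub (dim2 _ v0') (sub _ _ _ vP' ij) (sub _ _ _ vP' il) f1 f2 (mem_ev _ tT).
  rewrite eqmx_opp.
  exact: ev2_sub (dim2 _ v0) (sub _ _ _ vP ij) (sub _ _ _ vP il) f1 f2 (mem_ev _ tT).
have /submxP[a ea] : (u <= J)%MS.
  pose i0 : 'I_m := cast_ord (esym m3) 0; pose i1 : 'I_m := cast_ord (esym m3) 1.
  pose i2 : 'I_m := cast_ord (esym m3) (Ordinal (isT : (2 < 3)%N)).
  apply: submx_trans (uS i0 i1 i2 isT isT isT) _.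
  by rewrite col_mx_sub !submxMl.
have ai (i j l : 'I_m) : i != j -> i != l -> j != l -> a 0 i = 0.
  move=> ij il jl; have /sub2P[k1 [k2]] := uS i j l ij il jl.
  rewrite ea !scalemxAl -mulmxDl => /(row_free_inj fJ) ->.
  by rewrite !mxE (negPf ij) (negPf il) !mulr0 addr0.
have a0 : a = 0.
  apply/rowP => i; rewrite [RHS]mxE.
  have [j [l [ij il jl]]] : exists j l : 'I_m, [/\ i != j, i != l & j != l].
    move: i; rewrite m3 => i.
    case: i => [[|[|[|//]]] hi]; [exists 1, (Ordinal (isT : (2 < 3)%N))
      |exists 0, (Ordinal (isT : (2 < 3)%N))|exists 0, 1]; by split.
  exact: ai ij il jl.
by move: u0; rewrite ea a0 mul0mx eqxx.
Qed.

Hypothesis rank2 : forall v m (P : 'M_(n, m)) P' C (J : 'M_(m, p)) z alpha,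
  (0 < \dim (ev v T))%N -> kindJ T F v P P' C J z alpha -> \rank J = 2%N.

(** Some combination of [a] and [b] is also annihilated by [w], so [F] is linear along it, against
    [kindJ_nonlinear]. *)
Lemma kindJ_low_contra (v w : 'rV[K]_n) (a b : 'cV[K]_m) :
  (forall c, dot v c = 0 -> dot w c = 0 -> linear_at T F c) ->
  a^T *m J != 0 -> ~~ (b^T *m J <= a^T *m J)%MS ->
  dot v (P *m a) = 0 -> dot v (P *m b) = 0 -> False.
Proof.
move=> hw a0 ba va vb.
have nl c : c^T *m J != 0 -> dot v (P *m c) = 0 -> dot w (P *m c) != 0.
  move=> c0 vc; apply/eqP => wc.
  exact: (kindJ_nonlinear k lam0 lam1 c0 (hw _ vc wc)).
pose c := dot w (P *m b) *: a - dot w (P *m a) *: b.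
have wa := nl a a0 va.
have wc : dot w (P *m c) = 0 by rewrite mulmxBr -!scalemxAr !dotE; ring.
have vc : dot v (P *m c) = 0 by rewrite mulmxBr -!scalemxAr !dotE va vb !mulr0 subrr.
suff c0 : c^T *m J != 0 by have := nl c c0 vc; rewrite wc eqxx.
apply: contra ba => /eqP; rewrite /c [(_ - _)^T]linearB /= ![(_ *: _)^T]linearZ /= mulmxBl -!scalemxAl => /eqP.
rewrite subr_eq0 => /eqP e.
by rewrite -[b^T *m J](scalerK wa) -e !scalemx_sub.
Qed.

(** As [m] exceeds the rank of [J], there is a left kernel vector [rho0], and every [v] not
    annihilating [P *m rho0] is again of symmetric type. Dividing by such a [v] gives a second
    matrix [J2] with the row space of [J], and its kernel supplies the column transverse to [y]
    required by [glue], with [x3 = 0]. *)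
Lemma caseII : (3 <= m)%N -> exists J3 : 'M[K]_(n, p),
  [/\ forall s, orth T s <-> (J3 *m s)^T = J3 *m s & \rank J3 = 2%N].
Proof.
move=> m3; have rJ := rank2 yT k.
have [a [b [a0 ba]]] := two_rows (kJrk k).
have [rho0 r00 r0J] : exists2 r : 'cV_m, r != 0 & r^T *m J = 0.
  have : kermx J != 0 by rewrite -mxrank_eq0 mxrank_ker rJ subn_eq0 -ltnNge.
  case/rowV0Pn => r /sub_kermxP rJ0 r0; exists r^T; rewrite ?trmxK //.
  by rewrite -[0]trmx0 (inj_eq trmx_inj).
pose c0 := P *m rho0.
have claimA v : dot v c0 != 0 -> [/\ \dim (ev v T) = 2%N,
    forall u, u \in ev v T -> (u <= J)%MS &
    exists m (P : 'M_(n, m)) P' C (J : 'M_(m, p)) z alpha, kindJ T F v P P' C J z alpha].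
  move=> vc0.
  have Ev (x : 'rV_m) : x *m J \in ev v T.
    have := kindJ_ev k v rho0^T x; rewrite r0J scaler0 subr0 trmxK.
    by move/(memvZ (dot v c0)^-1); rewrite scalerA mulVf // scale1r.
  have d2 : (2 <= \dim (ev v T))%N.
    rewrite leqNgt; apply/negP => d1.
    have /subvP : (<[a *m J]> <= ev v T)%VS by rewrite -memvE.
    have e : <[a *m J]>%VS = ev v T.
      by apply/eqP; rewrite eqEdim -memvE Ev dim_vline a0 -ltnS.
    have := Ev b; rewrite -e => /vlineP[l el].
    by case/negP: ba; rewrite el scalemx_sub.
  have [[w hw]|[d2' kJ]] := TR d2.
    (* Correcting by [rho0] makes [v] vanish on the lifted column without changing its product with
       [J]. *)
    pose adj (x : 'rV_m) := x^T - (dot v (P *m x^T) / dot v c0) *: rho0.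
    have adjJ x : (adj x)^T *m J = x *m J.
      by rewrite /adj [(_ - _)^T]linearB /= [(_ *: _)^T]linearZ /= trmxK mulmxBl -scalemxAl r0J scaler0 subr0.
    have adjv x : dot v (P *m adj x) = 0.
      by rewrite /adj mulmxBr -scalemxAr !dotE -/c0 divfK // subrr.
    by exfalso; apply: (kindJ_low_contra (a := adj a) (b := adj b) hw); rewrite ?adjJ ?adjv.
  split=> // u uT; apply: submx_trans (ev2_sub _ (Ev a) (Ev b) a0 ba uT) _; first by rewrite d2'.
  by rewrite col_mx_sub !submxMl.
have c00 : c0 != 0.
  by apply: contra r00 => /eqP e; rewrite -[rho0]mul1mx -(kJP k) -mulmxA -/c0 e mulmx0.
have [v vc0] := sep1c c00.
have vc0' : dot v c0 != 0 by rewrite vc0 oner_eq0.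
have claimB (x : 'rV_n) t : t \in T -> (x *m t <= J)%MS.
  move=> tT; have [xc|] := eqVneq (dot x c0) 0; last first.
    by case/claimA => _ + _; apply; apply: mem_ev.
  have : dot (x + v) c0 != 0 by rewrite dotDl xc add0r.
  case/claimA => _ /(_ _ (mem_ev _ tT)) h1 _.
  have [_ /(_ _ (mem_ev _ tT)) h2 _] := claimA v vc0'.
  by rewrite -[x](addrK v) mulmxBl addmx_sub // eqmx_opp.
have [d2v _ [m2 [P2 [P2' [C2 [J2 [z2 [alpha2 k2]]]]]]]] := claimA v vc0'.
have em : m2 = m by have := kJn k; rewrite (kJn k2) => -[].
subst m2; have rJ2 : \rank J2 = 2%N by apply: rank2 k2; rewrite d2v.
(* If [y] annihilated all lifted kernel vectors of [J2], the two lifted kernels, of equal dimension,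
   would coincide by comparison of linear directions; but [v] kills the second and not [c0], which
   is in the first. *)
have [phi0 [r [ephi rJ20 yphi0]]] : exists phi0 (r : 'rV_m),
    [/\ phi0 = P2 *m r^T, r *m J2 = 0 & dot y phi0 != 0].
  apply: NNPP => none.
  have inj m' (A : 'M[K]_(m', m)) (Q : 'M[K]_(n, m)) (Q' : 'M[K]_(m, n)) : Q' *m Q = 1%:M ->
      \rank (A *m Q^T : 'M_(m', n)) = \rank A.
    move=> e; apply: mxrankMfree; apply/row_freeP; exists Q'^T.
    by rewrite -trmx_mul e trmx1.
  have sub : (kermx J2 *m P2^T <= kermx J *m P^T)%MS.
    apply/row_subP => i; rewrite row_mul; set r := row i _.
    have rJ2' : r *m J2 = 0 by apply/sub_kermxP; apply: row_sub.
    have yr : dot y (P2 *m r^T) = 0.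
      by apply/eqP/negPn/negP => e; apply: none; exists (P2 *m r^T), r.
    have e1 := quot_col (kJC k) yr; set c' := P' *m _ in e1.
    have c'J : c'^T *m J = 0.
      apply/eqP/negPn/negP => c'0; apply: (kindJ_nonlinear k lam0 lam1 c'0).
      by rewrite -e1; apply: (kindJ_linear k2); rewrite trmxK.
    have -> : r *m P2^T = c'^T *m P^T by rewrite -trmx_mul -e1 trmx_mul trmxK.
    by apply: submxMr; apply/sub_kermxP.
  have eqr : \rank (kermx J2 *m P2^T) = \rank (kermx J *m P^T).
    by rewrite (inj _ _ _ _ (kJP k2)) (inj _ _ _ _ (kJP k)) !mxrank_ker rJ rJ2.
  have : (c0^T <= kermx J2 *m P2^T)%MS.
    have [_ le] := mxrank_leqif_sup sub; rewrite eqr eqxx in le.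
    apply: submx_trans (_ : (kermx J *m P^T <= _)%MS); last by rewrite -le.
    by rewrite trmx_mul; apply: submxMr; apply/sub_kermxP.
  case/submxP => D eD; move: vc0'; rewrite -[c0]trmxK eD mulmxA trmx_mul trmxK dotA.
  by rewrite (kJy k2) dot0l eqxx.
pose phi := (dot y phi0)^-1 *: phi0.
have yphi : dot y phi = 1 by rewrite dotZr mulVf.
have phiT (x : 'rV_m) : phi0 *m (x *m J2) \in T.
  by have := kindJ_mem k2 r x; rewrite rJ20 mulmx0 subr0 -ephi.
have J2J : (J2 <= J)%MS.
  apply/row_subP => i; have := claimB y _ (phiT (delta_mx 0 i)).
  rewrite -rowE mulmx_dot => /(scalemx_sub (dot y phi0)^-1).
  by rewrite scalerA mulVf // scale1r.
have JJ2 : (J <= J2)%MS by have [_ le] := mxrank_leqif_sup J2J; rewrite rJ rJ2 eqxx in le.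
have [J3 [e1 e2 _ e3]] := glue k yphi (claimB y) (x3 := 0) (fun x => ltac:(
  rewrite mulmx0 subr0 /phi -scalemxAl memvZ //;
  have /submxP[D ->] := submx_trans (submxMl x J) JJ2; apply: phiT)).
exists J3; split=> //; apply/eqP; rewrite eqn_leq -{1}rJ e3 //= -rJ -e2.
exact: mxrankM_maxr.
Qed.
End KindJ.
End Cases.
End Cases.

(** * The functional equation behind three-dimensional targets *)

Section Triples.
Variable K : fieldType.
Variable lam : K.
Hypotheses (lam0 : lam != 0) (lam1 : lam != 1).

(** For [b != 0] and one zero diagonal entry the system in [u], [v] is solvable, so [g1] and [g3]
    are expressed for every such [b]; comparing [b = 1] with [b = lam] kills [p2] and [r1]. Then
    [b = 0], with [d] replaced by [lam ^+ 2 * d], separates the two remaining equalities. *)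
Lemma S2_extension_equation (g1 g2 g3 alpha : K -> K) (p1 q1 r1 p2 q2 r2 : K) :
  (forall a b, g1 (a + b) = g1 a + g1 b) -> (forall a b, g2 (a + b) = g2 a + g2 b) ->
  (forall a b, g3 (a + b) = g3 a + g3 b) -> root_linear alpha -> (exists t, alpha t != 0) ->
  (forall a b d u v, u * a + v * b = p1 * a + q1 * b + r1 * d ->
     u * b + v * d = p2 * a + q2 * b + r2 * d ->
     g1 a + g2 b + g3 d = u * alpha a + v * alpha d) ->
  [/\ p2 = 0, r1 = 0, q2 = p1 & r2 = q1].
Proof.
move=> g1D g2D g3D rl [t at0] H.
have [g10 g20 g30] : [/\ g1 0 = 0, g2 0 = 0 & g3 0 = 0] by split; apply: additive0.
have a0 := root_linear0 rl.
have t0 : t != 0 by apply: contraNneq at0 => ->; rewrite a0.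
have g2E b : b != 0 -> g2 b = 0.
  move=> b0; have := H 0 b 0 q2 q1; rewrite g10 g30 a0 !mulr0 !addr0 !add0r.
  by apply.
have lam' : 1 - lam^-1 != 0.
  by rewrite subr_eq0 eq_sym -(inj_eq (mulIf lam0)) mulVf // mul1r eq_sym.
have g1E a b : b != 0 -> g1 a = (p2 * a / b + q2) * alpha a.
  move=> b0; have := H a b 0 (p2 * a / b + q2) ((p1 * a + q1 * b - (p2 * a / b + q2) * a) / b).
  rewrite g30 a0 g2E // !mulr0 !addr0; apply; first by field.
  by field.
have g3E d b : b != 0 -> g3 d = (r1 * d / b + q1) * alpha d.
  move=> b0; have := H 0 b d ((q2 * b + r2 * d - (r1 * d / b + q1) * d) / b) (r1 * d / b + q1).
  rewrite g10 a0 g2E // !mulr0 !add0r; apply; first by field.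
  by field.
have key c q a : c * a / 1 + q = c * a / lam + q -> a != 0 -> c = 0.
  move=> e an0; have : c * a * (1 - lam^-1) = 0.
    rewrite (_ : _ * _ = (c * a / 1 + q) - (c * a / lam + q)); last by rewrite divr1; ring.
    by rewrite e subrr.
  by move/eqP; rewrite !mulf_eq0 (negPf an0) (negPf lam') !orbF => /eqP.
have p20 : p2 = 0.
  apply: (key p2 q2 t _ t0); apply: (mulIf at0).
  by rewrite -(g1E t 1) ?oner_eq0 // -(g1E t lam).
have r10 : r1 = 0.
  apply: (key r1 q1 t _ t0); apply: (mulIf at0).
  by rewrite -(g3E t 1) ?oner_eq0 // -(g3E t lam).
have e a d : a != 0 -> d != 0 -> q2 * alpha a + q1 * alpha d = p1 * alpha a + r2 * alpha d.
  move=> an dn; have := H a 0 d p1 r2; rewrite p20 r10 g20 !(mul0r, mulr0, addr0, add0r).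
  rewrite (g1E a 1) ?oner_eq0 // (g3E d 1) ?oner_eq0 // p20 r10 !(mul0r, add0r).
  by apply.
have e1 := e t t t0 t0.
have e2 := e t (lam ^+ 2 * t) t0 (mulf_neq0 (expf_neq0 2 lam0) t0).
rewrite rl.2 in e2.
have : (q1 - r2) * (lam - 1) * alpha t = 0.
  rewrite (_ : _ * _ = (q2 * alpha t + q1 * (lam * alpha t) - (p1 * alpha t + r2 * (lam * alpha t)))
    - (q2 * alpha t + q1 * alpha t - (p1 * alpha t + r2 * alpha t))); last by ring.
  by rewrite e1 e2 !subrr.
move/eqP; rewrite !mulf_eq0 (negPf at0) !subr_eq0 (negPf lam1) !orbF => /eqP q1r2.
split=> //; apply/eqP; rewrite -subr_eq0; move: e1; rewrite q1r2 => /addIr/(mulIf at0) ->.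
by rewrite subrr.
Qed.

Section Triples.
Variables (p : nat) (x1 x2 b1 b1' b2 b2' : 'rV[K]_p) (alpha : K -> K).
Variable (G : 'cV[K]_p -> 'cV[K]_p -> 'cV[K]_p -> K).
Hypotheses (x10 : x1 != 0) (x21 : ~~ (x2 <= x1)%MS).
Hypotheses (rl : root_linear alpha) (alpha0 : exists t, alpha t != 0) (char2 : 2%:R = 0 :> K).

Let l1 c1 c2 := dot b1 c1 + dot b1' c2.
Let l2 c1 c2 := dot b2 c1 + dot b2' c2.
(** The three columns of an operator into a 3-dimensional target: symmetry modulo [y] for the first
    two, and the values of [x1], [x2] on the third imposed by the rest of [T]. *)
Definition triple (c1 c2 c3 : 'cV[K]_p) : Prop :=
  [/\ dot x2 c1 = dot x1 c2, dot x1 c3 = l1 c1 c2 & dot x2 c3 = l2 c1 c2].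

Hypothesis GD : forall c1 c2 c3 c1' c2' c3', triple c1 c2 c3 -> triple c1' c2' c3' ->
  G (c1 + c1') (c2 + c2') (c3 + c3') = G c1 c2 c3 + G c1' c2' c3'.
Hypothesis Grc : forall c1 c2 u v, triple c1 c2 (u *: c1 + v *: c2) ->
  G c1 c2 (u *: c1 + v *: c2) = u * alpha (dot x1 c1) + v * alpha (dot x2 c2).

Lemma tripleN c1 c2 c3 : triple c1 c2 c3 -> triple (- c1) (- c2) (- c3).
Proof. by rewrite /triple /l1 /l2 !dotE => -[-> -> ->]; split=> //; ring. Qed.

Lemma G0 c1 c2 : triple c1 c2 0 -> G c1 c2 0 = 0.
Proof.
by have := @Grc c1 c2 0 0; rewrite !scale0r addr0 !mul0r addr0.
Qed.

Lemma GN c1 c2 c3 : triple c1 c2 c3 -> G (- c1) (- c2) (- c3) = - G c1 c2 c3.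
Proof.
move=> t; apply/eqP; rewrite -addr_eq0 -GD //; last exact: tripleN.
by rewrite !addNr G0 // /triple /l1 /l2 !dot0r addr0.
Qed.

(** After correction of the third column, the conditions say that the matrix with rows [x1], [x2],
    [x3] has a symmetric product with the operator. The scalars are read off on a plane dual to
    [x1], [x2] by [S2_extension_equation]; the common kernel of [x1] and [x2] is handled through the
    relation [D]. *)
Lemma triple_solution : exists (pp qq : K) (x3 : 'rV[K]_p), forall c1 c2 c3, triple c1 c2 c3 ->
  dot x1 (c3 - pp *: c1 - qq *: c2) = dot x3 c1 /\ dot x2 (c3 - pp *: c1 - qq *: c2) = dot x3 c2.
Proof.
have [d2 /row1_eq0 x1d2 x2d2] := sep x21.
have x12 : ~~ (x1 <= x2)%MS.
  apply: contra x21 => /sub1P[k e]; have k0 : k != 0.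
    by apply: contraNneq x10 => k0; rewrite e k0 scale0r.
  by rewrite e (eqmx_scale _ k0).
have [d1 /row1_eq0 x2d1 x1d1] := sep x12.
have xE := (x1d1, x1d2, x2d1, x2d2).
pose p1 := l1 d1 0; pose q1 := l1 d2 d1; pose r1 := l1 0 d2.
pose p2 := l2 d1 0; pose q2 := l2 d2 d1; pose r2 := l2 0 d2.
pose S a b d := G (a *: d1 + b *: d2) (b *: d1 + d *: d2)
   ((p1 * a + q1 * b + r1 * d) *: d1 + (p2 * a + q2 * b + r2 * d) *: d2).
have trS a b d : triple (a *: d1 + b *: d2) (b *: d1 + d *: d2)
   ((p1 * a + q1 * b + r1 * d) *: d1 + (p2 * a + q2 * b + r2 * d) *: d2).
  rewrite /triple /l1 /l2 !dotE !xE /p1 /q1 /r1 /p2 /q2 /r2 /l1 /l2 !dot0r.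
  by split; ring.
have SD a b d a' b' d' : S (a + a') (b + b') (d + d') = S a b d + S a' b' d'.
  rewrite /S -GD //; congr G; rewrite ?scalerDl;
    rewrite ?mulrDr ?scalerDl; apply/colP => i; rewrite !mxE; ring.
have Sfe a b d u v : u * a + v * b = p1 * a + q1 * b + r1 * d ->
    u * b + v * d = p2 * a + q2 * b + r2 * d ->
    S a 0 0 + S 0 b 0 + S 0 0 d = u * alpha a + v * alpha d.
  move=> e1 e2; rewrite -!SD !addr0 !add0r /S -e1 -e2.
  have tr := trS a b d; rewrite -e1 -e2 in tr.
  have e : (u * a + v * b) *: d1 + (u * b + v * d) *: d2 =
      u *: (a *: d1 + b *: d2) + v *: (b *: d1 + d *: d2).
    by apply/colP => i; rewrite !mxE; ring.
  rewrite e in tr *; rewrite Grc // !dotE !xE.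
  by rewrite !mulr1 !mulr0 addr0 add0r.
have [p20 r10 q2p1 r2q1] : [/\ p2 = 0, r1 = 0, q2 = p1 & r2 = q1].
  apply: (@S2_extension_equation (fun a => S a 0 0) (fun b => S 0 b 0) (fun d => S 0 0 d) alpha) => //.
  - by move=> a b; rewrite -SD !addr0.
  - by move=> a b; rewrite -SD !addr0.
  - by move=> a b; rewrite -SD !addr0.
pose ker c := dot x1 c = 0 /\ dot x2 c = 0.
(* [D] relates corrected third columns to corrected values of [G]. It is stable under differences
   and relates 0 only to 0, so it is functional: a column reached with two values gives an
   equation. *)
pose D c r := exists c1 c2 c3, [/\ triple c1 c2 c3, c3 - p1 *: c1 - q1 *: c2 = c &
  G c1 c2 c3 - p1 * alpha (dot x1 c1) - q1 * alpha (dot x2 c2) = r].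
have D0 r : D 0 r -> r = 0.
  case=> c1 [c2 [c3 [tr + <-]]] => /eqP.
  rewrite -addrA -opprD subr_eq0 => /eqP e; rewrite e in tr *; rewrite Grc //; ring.
have aD := rl.1; have aN := additiveN rl.1.
have DB c r c' r' : D c r -> D c' r' -> D (c - c') (r - r').
  move=> [c1 [c2 [c3 [tr <- <-]]]] [e1 [e2 [e3 [tr' <- <-]]]].
  have trN := tripleN tr'.
  exists (c1 - e1), (c2 - e2), (c3 - e3); split.
  - case: tr trN => [h1 h2 h3] [h1' h2' h3'].
    by rewrite /triple /l1 /l2 !dotDr h1 h2 h3 h1' h2' h3' /l1 /l2; split=> //; ring.
  - by rewrite !scalerBr; apply/colP => i; rewrite !mxE; ring.
  - by rewrite GD // GN // !dotE !aD !aN; ring.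
have Deq c c' r r' : D c r -> c = c' -> r = r' -> D c' r' by move=> + <- <-.
have Dtriple c1 c2 a b d u v : ker c1 -> ker c2 ->
    u * a + v * b = l1 c1 c2 -> u * b + v * d = l2 c1 c2 ->
    D ((u * a + v * b) *: d1 + (u * b + v * d) *: d2 + u *: c1 + v *: c2)
      (u * alpha a + v * alpha d).
  move=> [k11 k21] [k12 k22] e1 e2.
  pose f1 := a *: d1 + b *: d2 + c1; pose f2 := b *: d1 + d *: d2 + c2.
  exists f1, f2, ((u + p1) *: f1 + (v + q1) *: f2).
  have xf1 : dot x1 f1 = a by rewrite /f1 !dotE !xE k11; ring.
  have xf2 : dot x2 f2 = d by rewrite /f2 !dotE !xE k22; ring.
  have x2f1 : dot x2 f1 = b by rewrite /f1 !dotE !xE k21; ring.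
  have x1f2 : dot x1 f2 = b by rewrite /f2 !dotE !xE k12; ring.
  have tr : triple f1 f2 ((u + p1) *: f1 + (v + q1) *: f2).
    have eL1 : l1 f1 f2 = p1 * a + q1 * b + r1 * d + l1 c1 c2.
      by rewrite /l1 /f1 /f2 /p1 /q1 /r1 /l1 !dotE; ring.
    have eL2 : l2 f1 f2 = p2 * a + q2 * b + r2 * d + l2 c1 c2.
      by rewrite /l2 /f1 /f2 /p2 /q2 /r2 /l2 !dotE; ring.
    split; first by rewrite x2f1 x1f2.
      by rewrite eL1 -e1 !dotDr !dotZr xf1 x1f2 r10; ring.
    by rewrite eL2 -e2 !dotDr !dotZr xf2 x2f1 p20 q2p1 r2q1; ring.
  split=> //; first by apply/colP => i; rewrite /f1 /f2 !mxE; ring.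
  by rewrite Grc // xf1 xf2; ring.
(* With zero diagonal entries and off-diagonal entry [f^-1], [alpha] contributes nothing. *)
have Df c1 c2 f : ker c1 -> ker c2 -> f != 0 ->
    D (l1 c1 c2 *: d1 + l2 c1 c2 *: d2 + (f * l2 c1 c2) *: c1 + (f * l1 c1 c2) *: c2) 0.
  move=> k1 k2 f0.
  have := @Dtriple c1 c2 0 f^-1 0 (f * l2 c1 c2) (f * l1 c1 c2) k1 k2.
  rewrite !mulr0 add0r addr0 (root_linear0 rl) !mulr0 addr0.
  rewrite (mulrC f) (mulrC f (l2 c1 c2)) !mulfK //; apply=> //.
have D1 c1 c2 e : ker c1 -> ker c2 -> D ((e * l1 c1 c2) *: c1) (l1 c1 c2 * alpha (- e)).
  move=> k1 k2.
  have h1 := @Dtriple c1 c2 0 1 (- e) (e * l1 c1 c2 + l2 c1 c2) (l1 c1 c2) k1 k2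
    ltac:(by ring) ltac:(by ring).
  apply: (Deq _ _ _ _ (DB _ _ _ _ h1 (Df c1 c2 1 k1 k2 (oner_neq0 _)))).
    by apply/colP => i; rewrite !mxE; ring.
  by rewrite (root_linear0 rl) mulr0 add0r subr0.
have D2 c1 c2 e : ker c1 -> ker c2 -> D ((e * l2 c1 c2) *: c2) (l2 c1 c2 * alpha (- e)).
  move=> k1 k2.
  have h1 := @Dtriple c1 c2 (- e) 1 0 (l2 c1 c2) (e * l2 c1 c2 + l1 c1 c2) k1 k2
    ltac:(by ring) ltac:(by ring).
  apply: (Deq _ _ _ _ (DB _ _ _ _ h1 (Df c1 c2 1 k1 k2 (oner_neq0 _)))).
    by apply/colP => i; rewrite !mxE; ring.
  by rewrite (root_linear0 rl) mulr0 addr0 subr0.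
have D3 c1 c2 f : ker c1 -> ker c2 -> f != 0 ->
    D (f *: (l2 c1 c2 *: c1 + l1 c1 c2 *: c2)) 0.
  move=> k1 k2 f0; have [g [g0 fg0]] : exists g, g != 0 /\ g + f != 0.
    have [e|] := eqVneq (1 + f) 0; last by exists 1; rewrite oner_eq0.
    exists lam; split=> //; apply: contraNneq lam1 => e'.
    by rewrite -(inj_eq (addIr f)) e e'.
  apply: (Deq _ _ _ _ (DB _ _ _ _ (Df c1 c2 (g + f) k1 k2 fg0) (Df c1 c2 g k1 k2 g0))).
    by apply/colP => i; rewrite !mxE; ring.
  by rewrite subrr.
have [t at0] := alpha0.
have ker0 : ker 0 by rewrite /ker !dot0r.
have l10 c : ker c -> l1 0 c = 0.
  move=> kc; have := D1 0 c (- t) ker0 kc; rewrite scaler0 opprK => /D0/eqP.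
  by rewrite mulf_eq0 (negPf at0) orbF => /eqP.
have l20 c : ker c -> l2 c 0 = 0.
  move=> kc; have := D2 c 0 (- t) kc ker0; rewrite scaler0 opprK => /D0/eqP.
  by rewrite mulf_eq0 (negPf at0) orbF => /eqP.
have l1E c1 c2 : ker c1 -> ker c2 -> l1 c1 c2 = dot b1 c1.
  by move=> k1 /l10; rewrite /l1 dot0r add0r => ->; rewrite addr0.
have l2E c1 c2 : ker c1 -> ker c2 -> l2 c1 c2 = dot b2' c2.
  by move=> /l20; rewrite /l2 dot0r addr0 => ->; rewrite add0r.
(* Otherwise the sum [w] is nonzero in characteristic 2, and [D3] relates every nonzero multiple of
   [c] to 0. [D1] and [D2] then force both numbers to vanish, as [alpha] does not. *)
have b12 c : ker c -> dot b1 c = dot b2' c.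
  move=> kc; apply/eqP/negPn/negP => ne.
  pose w := dot b2' c + dot b1 c.
  have w0 : w != 0.
    apply: contra ne => /eqP e; rewrite -subr_eq0.
    rewrite (_ : _ - _ = 2%:R * dot b1 c - w); last by rewrite /w; ring.
    by rewrite char2 mul0r e subrr.
  have Dc f : f != 0 -> D (f *: c) 0.
    move=> f0; have := D3 c c (f / w) kc kc (mulf_neq0 f0 (invr_neq0 w0)).
    by rewrite l1E // l2E // -scalerDl scalerA mulfVK.
  have z1 : dot b1 c = 0.
    apply/eqP/negPn/negP => b0; have t0 : - t != 0.
      by rewrite oppr_eq0; apply: contraNneq at0 => ->; rewrite (root_linear0 rl).
    have := D1 c c (- t) kc kc; rewrite l1E // opprK => h1.
    have := DB _ _ _ _ h1 (Dc _ (mulf_neq0 t0 b0)); rewrite subrr subr0 => /D0/eqP.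
    by rewrite mulf_eq0 (negPf at0) (negPf b0).
  have z2 : dot b2' c = 0.
    apply/eqP/negPn/negP => b0; have t0 : - t != 0.
      by rewrite oppr_eq0; apply: contraNneq at0 => ->; rewrite (root_linear0 rl).
    have := D2 c c (- t) kc kc; rewrite l2E // opprK => h1.
    have := DB _ _ _ _ h1 (Dc _ (mulf_neq0 t0 b0)); rewrite subrr subr0 => /D0/eqP.
    by rewrite mulf_eq0 (negPf at0) (negPf b0).
  by move: ne; rewrite z1 z2 eqxx.
pose x3 := b1 - dot b1 d1 *: x1 - dot b1 d2 *: x2.
exists p1, q1, x3 => c1 c2 c3 [h1 h2 h3].
pose c1' := c1 - dot x1 c1 *: d1 - dot x2 c1 *: d2.
pose c2' := c2 - dot x1 c2 *: d1 - dot x2 c2 *: d2.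
have kc1 : ker c1' by split; rewrite /c1' !dotE !xE; ring.
have kc2 : ker c2' by split; rewrite /c2' !dotE !xE; ring.
have x3c c : ker (c - dot x1 c *: d1 - dot x2 c *: d2) ->
    dot x3 c = dot b1 (c - dot x1 c *: d1 - dot x2 c *: d2).
  by move=> _; rewrite /x3 !dotE; ring.
have eL1 : l1 c1 c2 = p1 * dot x1 c1 + q1 * dot x2 c1 + r1 * dot x2 c2 + l1 c1' c2'.
  by rewrite /p1 /q1 /r1 /l1 /c1' /c2' !dotE -h1; ring.
have eL2 : l2 c1 c2 = p2 * dot x1 c1 + q2 * dot x2 c1 + r2 * dot x2 c2 + l2 c1' c2'.
  by rewrite /p2 /q2 /r2 /l2 /c1' /c2' !dotE -h1; ring.
rewrite !dotDr !dotNr !dotZr h2 h3 eL1 eL2 r10 p20 q2p1 r2q1 -h1 l1E // l2E // -b12 //.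
by rewrite !x3c //; split; rewrite /c1' /c2'; ring.
Qed.
End Triples.
End Triples.

(** * Extending the symmetry to a three-dimensional target *)

Section CaseIII.
Variable K : fieldType.

Lemma dim2_pair (A : vectType K) (X : {vspace A}) : (2 <= \dim X)%N ->
  exists a b : A, [/\ a \in X, b \in X, a != 0 & b \notin <[a]>%VS].
Proof.
move=> dX; have X0 : X != 0%VS by rewrite -dimv_eq0; case: (\dim X) dX.
pose a := vpick X; have a0 : a != 0 by rewrite vpick0.
have : ~~ (X <= <[a]>)%VS.
  by apply/negP => /dimvS; rewrite dim_vline a0 leqNgt dX.
case/subvPn => b bX ba; exists a, b; split=> //; exact: memv_pick.
Qed.

Lemma not_line_sub p (a b : 'rV[K]_p) : b \notin <[a]>%VS -> ~~ (b <= a)%MS.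
Proof. by apply: contra => /sub1P[k ->]; apply: memvZ; apply: memv_line. Qed.

Lemma not_sub2 p (u a b : 'rV[K]_p) : a != 0 -> ~~ (b <= a)%MS -> ~~ (u <= col_mx a b)%MS ->
  ~~ (a <= col_mx b u)%MS /\ ~~ (b <= col_mx a u)%MS.
Proof.
move=> a0 ba uab; split; apply/negP => /sub2P[k [l e]].
  have [l0|l0] := eqVneq l 0; last first.
    case/negP: uab; have -> : u = l^-1 *: a + (- (l^-1 * k)) *: b; last exact: sub_col2.
    by rewrite e scalerDr !scalerA mulVf // scaleNr scale1r addrAC subrr add0r.
  have k0 : k != 0.
    by apply: contraNneq a0 => k0; rewrite e l0 k0 !scale0r addr0.
  by case/negP: ba; rewrite e l0 scale0r addr0 (eqmx_scale _ k0).
have [l0|l0] := eqVneq l 0; first by case/negP: ba; rewrite e l0 scale0r addr0 scalemx_sub.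
case/negP: uab; have -> : u = (- (l^-1 * k)) *: a + l^-1 *: b; last exact: sub_col2.
by rewrite e scalerDr !scalerA mulVf // scaleNr scale1r addKr.
Qed.

Variable lam : K.
Hypotheses (lam0 : lam != 0) (lam1 : lam != 1).
Variables (n p : nat) (T : {vspace 'M[K]_(n, p)}) (F : 'M[K]_(p, n) -> 'rV[K]_n) (y : 'rV[K]_n)
    (P : 'M[K]_(n, 2)) (P' : 'M[K]_(2, n)) (C : 'cV[K]_n) (J : 'M[K]_(2, p))
    (z : 'rV[K]_p) (alpha : K -> K).
Hypothesis k : kindJ T F y P P' C J z alpha.
Hypothesis h : rc T F.
Hypothesis dT : (\dim T + 3 <= 2 * n)%N.
Hypothesis dy : (2 <= \dim (ev y T))%N.

Let n3 : n = 3%N. Proof. exact: kJn k. Qed.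
Let dT3 : \dim T = 3%N /\ \dim (ev y T) = 2%N.
Proof.
have := quot_dim (kJP k) (kJC k) (kJy k) T; have := kJdim k; move: dT dy n3; lia.
Qed.
Let fJ : row_free J.
Proof. by rewrite /row_free eqn_leq rank_leq_row (kJrk k). Qed.

(** Since [\dim T = 3], a larger value would make the quotient by [v] the full operator space, and
    [F] local modulo [v]; but some nonlinear direction is annihilated by [v]. *)
Lemma caseIII_dim (v : 'rV[K]_n) : v *m P != 0 -> (\dim (ev v T) <= 2)%N.
Proof.
move=> vP; rewrite leqNgt; apply/negP => d3.
have v0 : v != 0 by apply: contraNneq vP => ->; rewrite mul0mx.
have [m [Q [Q' [D [em Q'Q QQ' vQ]]]]] := quotient_line v0.
have [F' h' eF'] := quot_rc Q h.
have dq := quot_dim Q'Q QQ' vQ T.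
have [z' ez'] : rc_local (quot_space Q T) F'.
  by apply: local_small h'; case: dT3 => e1 _; rewrite e1 in dq; lia.
have [c c0 vc] := exists_ker (v *m P) (ltnSn 1).
apply: (kindJ_nonlinear k lam0 lam1 (c := c)).
  by rewrite mulmx_free_eq0 // -[0]trmx0 (inj_eq trmx_inj).
have vPc : dot v (P *m c) = 0 by rewrite dotA; apply/row1_eq0.
have E s : orth T s -> dot (F s) (P *m c) = dot (z' *m (s *m Q)) (Q' *m (P *m c)).
  move=> os; rewrite {1}(quot_col QQ' vPc) dotA -eF' // ez' //; exact: quot_orth.
move=> s l os; rewrite !E //; last exact: orthZ.
by rewrite -scalemxAl -scalemxAr dotZl.
Qed.

(** With [v] chosen so that [x *m J] lies in [ev (y + a *: v) T] for every [a != 0], the images of a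
    basis of [ev y T] along [y + a *: v] are dependent modulo [x *m J]. This is a polynomial of
    degree at most 2 in [a], with constant term 1, and it vanishes at too many points. *)
Lemma caseIII_ev (x : 'rV[K]_2) : x *m J \in ev y T.
Proof.
apply/negPn/negP => xT.
have x0 : x != 0 by apply: contraNneq xT => ->; rewrite mul0mx mem0v.
have xJ0 : x *m J != 0 by rewrite mulmx_free_eq0.
have [b bx] : exists b : 'rV[K]_2, ~~ (b <= x)%MS.
  by apply: exists_not_sub; rewrite rank_rV x0.
have [c /row1_eq0 xc bc] := sep bx.
pose v := - (c^T *m P').
have vP : v *m P = - c^T by rewrite mulNmx -mulmxA (kJP k) mulmx1.
have vT : x *m J \in ev v T.
  have := kindJ_ev k v x b; rewrite !dotA vP !dotE !dot_tr xc bc.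
  by rewrite oppr0 scale0r sub0r scaleN1r opprK.
have evv (a : K) : a != 0 -> x *m J \in ev (y + a *: v) T.
  move=> a0; have := kindJ_ev k (y + a *: v) x b.
  rewrite !dotA mulmxDl (kJy k) add0r -scalemxAl vP !dotE !dot_tr xc bc.
  by rewrite oppr0 mulr0 scale0r sub0r mulrN1 scaleNr opprK => /(memvZ a^-1); rewrite scalerA mulVf ?scale1r.
have [u1 [u2 [u1T u2T u10 u21]]] := dim2_pair dy.
have {}u21 := not_line_sub u21.
have xu : ~~ (x *m J <= col_mx u1 u2)%MS.
  apply: contra xT => /sub2P[a [a' ->]]; apply: memvD; exact: memvZ.
have [n1 n2] := not_sub2 u10 u21 xu.
have [d1 /col2_eq0[u2d1 xd1] u1d1] := sep n1.
have [d2 /col2_eq0[u1d2 xd2] u2d2] := sep n2.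
have [t1 t1T e1] := evP u1T; have [t2 t2T e2] := evP u2T.
pose A i j := dot (v *m (if i then t1 else t2)) (if j then d1 else d2).
have cV0 : v *m P != 0.
  rewrite vP oppr_eq0; apply: contraNneq (oner_neq0 K) => c0.
  by rewrite -bc -[c]trmxK c0 trmx0 dot0r.
have det (a : K) : a != 0 ->
    (1 + a * A true true) * (1 + a * A false false) - a ^+ 2 * (A true false * A false true) = 0.
  move=> a0; pose w := y + a *: v.
  have dw : (\dim (ev w T) <= 2)%N.
    apply: caseIII_dim; rewrite mulmxDl (kJy k) add0r -scalemxAl scaler_eq0 negb_or a0 //.
  have w1 := mem_ev w t1T; have w2 := mem_ev w t2T.
  have E1 : w *m t1 = u1 + a *: (v *m t1) by rewrite mulmxDl -e1 -scalemxAl.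
  have E2 : w *m t2 = u2 + a *: (v *m t2) by rewrite mulmxDl -e2 -scalemxAl.
  have d11 : dot (w *m t1) d1 = 1 + a * A true true by rewrite E1 !dotE u1d1.
  have d12 : dot (w *m t1) d2 = a * A true false by rewrite E1 !dotE u1d2 add0r.
  have d21 : dot (w *m t2) d1 = a * A false true by rewrite E2 !dotE u2d1 add0r.
  have d22 : dot (w *m t2) d2 = 1 + a * A false false by rewrite E2 !dotE u2d2.
  have [/sub1P[l e]|w1x] := boolP (w *m t1 <= x *m J)%MS.
    move: d11 d12; rewrite e !dotZl xd1 xd2 mulr0 => <- d.
    by rewrite (_ : a ^+ 2 * _ = a * A true false * (a * A false true)); [rewrite -d; ring|ring].
  have /sub2P[l [l' e]] := ev2_sub dw (evv _ a0) w1 xJ0 w1x w2.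
  move: d21 d22; rewrite e !dotDl !dotZl xd1 xd2 d11 d12 !mulr0 !add0r => e21 e22.
  rewrite -e22 (_ : a ^+ 2 * _ = a * A true false * (a * A false true)); last by ring.
  by rewrite -e21; ring.
have lam1' : 1 + lam != 0.
  by apply: contra lam1; rewrite addrC addr_eq0 => /eqP ->; rewrite -subr_eq0 -opprD oppr_eq0 -mulr2n (kJchar k).
have D1 := det _ (oner_neq0 K); have D2 := det _ lam0; have D3 := det _ lam1'.
(* Summing the polynomial over [1], [lam] and [1 + lam] cancels the terms in [t] and [d] in
   characteristic 2 and leaves 1. *)
have : (1 : K) = 0.
  pose t := A true true + A false false.
  pose d := A true true * A false false - A true false * A false true.
  have F1 : 1 + t + d = 0 by rewrite -D1 /t /d; ring.
  have F2 : 1 + lam * t + lam ^+ 2 * d = 0 by rewrite -D2 /t /d; ring.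
  have F3 : 1 + (1 + lam) * t + (1 + lam) ^+ 2 * d = 0 by rewrite -D3 /t /d; ring.
  transitivity ((1 + t + d) + (1 + lam * t + lam ^+ 2 * d) + (1 + (1 + lam) * t + (1 + lam) ^+ 2 * d)
     - 2%:R * (1 + (1 + lam) * t + (1 + lam + lam ^+ 2) * d)); first by ring.
  by rewrite F1 F2 F3 (kJchar k); ring.
by move/eqP; rewrite oner_eq0.
Qed.

(** In the basis dual to [phi 0], [phi 1], [C], operators of the space are exactly the triples of
    columns of [triple], and range-compatibility of [F] is the hypothesis of [triple_solution]. Its
    conclusion provides the column [psi] and the row [x3] for [glue]. *)
Lemma caseIII : exists J3 : 'M[K]_(n, p),
  (forall s, orth T s <-> (J3 *m s)^T = J3 *m s) /\ (2 <= \rank J3)%N.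
Proof.
have [u1 [_ [u1T _ u10 _]]] := dim2_pair dy.
have y0 : y != 0.
  by have [t _ e] := evP u1T; apply: contraNneq u10 => y0; rewrite e y0 mul0mx.
have yC : dot y C = 1.
  have : dot y C *: y = y.
    by rewrite -mulmx_dot -(kJC k) mulmxBr mulmx1 mulmxA (kJy k) mul0mx subr0.
  have [d yd] := sep1 y0; move/(congr1 (dot^~ d)).
  by rewrite dotZl yd mulr1.
have P'C : P' *m C = 0.
  have [d yd] := sep1 y0.
  have : P' *m (C *m y) = 0 by rewrite -(kJC k) mulmxBr mulmx1 mulmxA (kJP k) mul1mx subrr.
  by move/(congr1 (mulmx^~ d)); rewrite mulmxA mulmx_dotr yd scale1r mul0mx.
have I2 (i : 'I_2) : i = 0 \/ i = 1.
  by case: i => [[|[|//]] hi]; [left|right]; apply: val_inj.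
pose e (i : 'I_2) : 'rV[K]_2 := delta_mx 0 i.
have ee i j : dot (e i) (e j)^T = (i == j)%:R.
  by rewrite /dot trmx_delta mul_delta_mx_cond; case: (i == j); rewrite ?mulr1n ?mulr0n !mxE ?eqxx.
have eE (a : 'rV[K]_2) : a = a 0 0 *: e 0 + a 0 1 *: e 1.
  by apply/rowP => j; have [->|->] := I2 j; rewrite !mxE /= !(mulr1, mulr0, addr0, add0r).
have id2 : (e 0)^T *m e 0 + (e 1)^T *m e 1 = 1%:M.
  apply/matrixP => i j; rewrite !mxE !big_ord1 !mxE.
  by have [->|->] := I2 i; have [->|->] := I2 j; rewrite /= !(mulr1, mulr0, addr0, add0r).
pose x i := e i *m J; pose phi i := P *m (e i)^T; pose yy i := e i *m P'.
have yphi i j : dot (yy i) (phi j) = (i == j)%:R.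
  by rewrite dotA /yy -mulmxA (kJP k) mulmx1 ee.
have yphi0 j : dot y (phi j) = 0 by rewrite dotA (kJy k) dot0l.
have yyC i : dot (yy i) C = 0 by rewrite /yy -dotA P'C dot0r.
pose mk c1 c2 c3 : 'M[K]_(p, n) := c1 *m yy 0 + c2 *m yy 1 + c3 *m y.
have mk1 c1 c2 c3 : mk c1 c2 c3 *m phi 0 = c1.
  by rewrite !mulmxDl !mulmx_dotr !yphi yphi0 /= !scale0r scale1r !addr0.
have mk2 c1 c2 c3 : mk c1 c2 c3 *m phi 1 = c2.
  by rewrite !mulmxDl !mulmx_dotr !yphi yphi0 /= !scale0r scale1r addr0 add0r.
have mk3 c1 c2 c3 : mk c1 c2 c3 *m C = c3.
  by rewrite !mulmxDl !mulmx_dotr !yyC yC !scale0r scale1r !add0r.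
have x10 : x 0 != 0.
  rewrite mulmx_free_eq0 //; apply/eqP => /matrixP/(_ 0 0); rewrite !mxE /= => /eqP.
  by rewrite oner_eq0.
have x21 : ~~ (x 1 <= x 0)%MS.
  apply/negP => /sub1P[l]; rewrite /x scalemxAl => /(row_free_inj fJ)/matrixP/(_ 0 1).
  by rewrite !mxE /= mulr0 => /eqP; rewrite oner_eq0.
have yT t : t \in T -> (y *m t <= col_mx (x 0) (x 1))%MS.
  move=> tT; apply: ev2_sub (caseIII_ev _) (caseIII_ev _) x10 x21 (mem_ev y tT).
  by case: dT3 => _ ->.
have yTJ t : t \in T -> (y *m t <= J)%MS.
  by move=> tT; apply: submx_trans (yT t tT) _; rewrite col_mx_sub !submxMl.
have [t1 t1T e1] := evP (caseIII_ev (e 0)); have [t2 t2T e2] := evP (caseIII_ev (e 1)).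
pose tri := triple (x 0) (x 1) (- (yy 0 *m t1)) (- (yy 1 *m t1)) (- (yy 0 *m t2)) (- (yy 1 *m t2)).
have trmk c1 c2 c3 t : \tr (mk c1 c2 c3 *m t) =
    dot (yy 0 *m t) c1 + dot (yy 1 *m t) c2 + dot (y *m t) c3.
  rewrite mxtrace_mulC !mulmxDr !mxtraceD.
  by congr (_ + _ + _); rewrite mulmxA mxtrace_mulC mulmxA /mxtrace big_ord1.
have tri_orth c1 c2 c3 : tri c1 c2 c3 -> orth T (mk c1 c2 c3).
  move=> [h1 h2 h3].
  have o1 : \tr (mk c1 c2 c3 *m t1) = 0.
    by rewrite trmk -e1 h2 !dotNl; ring.
  have o2 : \tr (mk c1 c2 c3 *m t2) = 0.
    by rewrite trmk -e2 h3 !dotNl; ring.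
  move=> t tT; have /sub2P[l1 [l2 el]] := yT t tT.
  pose t0 := t - l1 *: t1 - l2 *: t2.
  have t0T : t0 \in T by rewrite !memvB // memvZ.
  have yt0 : y *m t0 = 0.
    rewrite !mulmxBr -!scalemxAr -e1 -e2 el.
    by rewrite -addrA -opprD subrr.
  have et0 := quot_factor (kJC k) yt0.
  have oP : orth (quot_space P T) (mk c1 c2 c3 *m P).
    apply/(kJX k); apply/matrixP => i j.
    have Jmk a b : (J *m (mk c1 c2 c3 *m P)) a b = dot (x a) (mk c1 c2 c3 *m phi b).
      transitivity (dot (e a *m (J *m (mk c1 c2 c3 *m P))) (e b)^T).
        by rewrite /dot /e trmx_delta -rowE -colE !mxE.
      by rewrite /x /phi !dotA !mulmxA.
    rewrite mxE !Jmk.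
    have sw : dot (x 1) (mk c1 c2 c3 *m phi 0) = dot (x 0) (mk c1 c2 c3 *m phi 1) by rewrite mk1 mk2.
    have [->|->] := I2 i; have [->|->] := I2 j => //.
  have := oP (P' *m t0); rewrite mem_quot -et0 -mulmxA -et0 => /(_ t0T).
  rewrite /t0 !mulmxBr !raddfB /= -!scalemxAr !mxtraceZ o1 o2 !mulr0 !subr0 //.
have orth_tri s : orth T s -> tri (s *m phi 0) (s *m phi 1) (s *m C).
  move=> os; have sE : s = mk (s *m phi 0) (s *m phi 1) (s *m C).
    rewrite /mk -3!(mulmxA s) -!mulmxDr -[s in LHS]mulmx1; congr (_ *m _).
    have -> : 1%:M = P *m P' + C *m y by rewrite -(kJC k) addrC subrK.
    congr (_ + _); rewrite /phi /yy -!mulmxA -mulmxDr; congr (_ *m _).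
    by rewrite !mulmxA -mulmxDl id2 mul1mx.
  split.
  - have := kindJ_swap k (e 1) (e 0) os; rewrite -!dotA => ->. 
    by [].
  - have := os t1 t1T; rewrite {1}sE trmk -e1 !dotNl => /eqP.
    by rewrite addrC addr_eq0 opprD => /eqP.
  - have := os t2 t2T; rewrite {1}sE trmk -e2 !dotNl => /eqP.
    by rewrite addrC addr_eq0 opprD => /eqP.
(* Removing the local part leaves only [alpha] in the directions [phi 0] and [phi 1]; the unknown is
   the component along [C]. *)
pose F1 s := F s - z *m s; have h1 : rc T F1 := rc_sub_local z h.
have F1phi i s : orth T s -> dot (F1 s) (phi i) = alpha (dot (x i) (s *m phi i)).
  move=> os; rewrite /F1 !dotE (kindJ_form k _ os) trmxK mulmxA -[dot (z *m s *m P) _]dotA.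
  by rewrite addrAC subrr add0r mulmxA -!dotA.
have mkD a b c a' b' c' : mk (a + a') (b + b') (c + c') = mk a b c + mk a' b' c'.
  by rewrite /mk !mulmxDl; apply/matrixP => i j; rewrite !mxE; ring.
have GD c1 c2 c3 c1' c2' c3' : tri c1 c2 c3 -> tri c1' c2' c3' ->
    dot (F1 (mk (c1 + c1') (c2 + c2') (c3 + c3'))) C =
    dot (F1 (mk c1 c2 c3)) C + dot (F1 (mk c1' c2' c3')) C.
  by move=> /tri_orth o /tri_orth o'; rewrite mkD h1.1 ?dotDl.
have Grc c1 c2 u v : tri c1 c2 (u *: c1 + v *: c2) ->
    dot (F1 (mk c1 c2 (u *: c1 + v *: c2))) C = u * alpha (dot (x 0) c1) + v * alpha (dot (x 1) c2).
  move=> /tri_orth os; set s := mk _ _ _ in os *.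
  have s0 : s *m (u *: phi 0 + v *: phi 1 - C) = 0.
    by rewrite mulmxBr mulmxDr -!scalemxAr mk1 mk2 mk3 subrr.
  have := rc_dot h1 os s0; rewrite dotDr dotNr dotDr !dotZr !F1phi // mk1 mk2 => /eqP.
  by rewrite subr_eq0 => /eqP.
have [pp [qq [x3 hx]]] := triple_solution lam0 lam1
  (G := fun c1 c2 c3 => dot (F1 (mk c1 c2 c3)) C) x10 x21 (kJrl k) (kJa k) (kJchar k) GD Grc.
pose psi := C - pp *: phi 0 - qq *: phi 1.
have ypsi : dot y psi = 1 by rewrite /psi !dotE yC !yphi0 !mulr0 !subr0.
have hT (a : 'rV[K]_2) : psi *m (a *m J) - (P *m a^T) *m x3 \in T.
  apply: double_orth => s os; rewrite mulmxBr raddfB /= !trace_dot.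
  have [h0 h1'] := hx _ _ _ (orth_tri s os).
  have es : s *m C - pp *: (s *m phi 0) - qq *: (s *m phi 1) = s *m psi.
    by rewrite /psi !mulmxBr -!scalemxAr.
  rewrite es in h0 h1'.
  rewrite [in a *m J](eE a) mulmxDl -!scalemxAl !mulmxDl -!scalemxAl !dotDl !dotZl.
  rewrite -[e 0 *m J]/(x 0) -[e 1 *m J]/(x 1) -!(dotA (x _)) h0 h1'.
  rewrite {3}(eE a) linearD /= !linearZ /= mulmxDr -!scalemxAr -/(phi 0) -/(phi 1).
  by rewrite dotDr !dotZr -!dotA subrr.
have [J3 [e3 e4 _ _]] := glue k ypsi yTJ hT.
exists J3; split=> //; apply: leq_trans (kJrk k) _; rewrite -e4.
exact: mxrankM_maxr.
Qed.
End CaseIII.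

(** * Adapted vectors and extremal configurations *)

Section Low.
Variable K : fieldType.

Lemma sub_sym1 p (a b : 'rV[K]_p) : a != 0 -> ~~ (b <= a)%MS -> ~~ (a <= b)%MS.
Proof.
move=> a0; apply: contra => /sub1P[k e]; have k0 : k != 0.
  by apply: contraNneq a0 => k0; rewrite e k0 scale0r.
by rewrite e (eqmx_scale _ k0).
Qed.

(** The elements given by hypothesis already account for [2 * n - 3] dimensions, hence for all of
    [T], so an operator orthogonal to them is in the space. The operator [s] is the rank two matrix
    with the prescribed values, built on columns dual to [x1], [x2]. *)
Lemma configuration n p (T : {vspace 'M[K]_(n, p)}) (x1 x2 : 'rV[K]_p) (w y1 y2 : 'rV[K]_n)
    (c : K) (f : 'cV[K]_n) :
  (\dim T + 3 <= 2 * n)%N -> x1 != 0 -> ~~ (x2 <= x1)%MS ->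
  dot w f = 1 -> dot y1 f = 0 -> dot y2 f = 0 ->
  (forall g, dot w g = 0 -> dot y1 g = 0 -> g *m x1 \in T) ->
  (forall g, dot w g = 0 -> dot y2 g = 0 -> g *m x2 \in T) ->
  f *m (x2 - c *: x1) \in T ->
  exists s, [/\ orth T s, x1 *m s = w + y1, x2 *m s = c *: w + y2 &
    forall g, dot (w + y1) g = 0 -> dot (c *: w + y2) g = 0 -> s *m g = 0].
Proof.
move=> dT x10 x21 wf y1f y2f h1 h2 h3.
have [c2 /row1_eq0 x1c2 x2c2] := sep x21.
have [c1 /row1_eq0 x2c1 x1c1] := sep (sub_sym1 x10 x21).
pose s := c1 *m (w + y1) + c2 *m (c *: w + y2).
exists s; split; last first.
- by move=> g g1 g2; rewrite mulmxDl !mulmx_dotr g1 g2 !scale0r addr0.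
- by rewrite mulmxDr !mulmx_dot x2c1 x2c2 scale0r scale1r add0r.
- by rewrite mulmxDr !mulmx_dot x1c1 x1c2 scale0r scale1r addr0.
(* The kernel of these three equations has dimension at least [2 * n - 3] and lies in the image of
   [T] under [t |-> (t *m c1, t *m c2)]; by dimension the two agree. *)
pose A : 'M[K]_(1 + (1 + 1), n + n) :=
  col_mx (row_mx y1 0) (col_mx (row_mx 0 y2) (row_mx w (c *: w))).
have AE (a b : 'cV[K]_n) : A *m col_mx a b = 0 <->
    [/\ dot y1 a = 0, dot y2 b = 0 & dot w a + c * dot w b = 0].
  rewrite !mul_col_mx !mul_row_col !mul0mx addr0 add0r; split=> [/eqP|[e1 e2 e3]].
    rewrite !col_mx_eq0 => /and3P[/eqP/row1_eq0 e1 /eqP/row1_eq0 e2 /eqP e3]; split=> //.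
    by have := congr1 (fun B : 'M_1 => B 0 0) e3; rewrite mxE [RHS]mxE -/(dot w a) -/(dot (c *: w) b) dotZl.
  have /row1_eq0 -> := e1; have /row1_eq0 -> := e2.
  have -> : w *m a + c *: w *m b = 0.
    by rewrite [LHS]mx11_scalar mxE -/(dot w a) -/(dot (c *: w) b) dotZl e3 raddf0.
  by rewrite !col_mx0.
have [X [eX dX]] := colspace_dim A.
have [e ee] := @hom_of_linear _ _ _ (fun t : 'M[K]_(n, p) => col_mx (t *m c1) (t *m c2))
  (fun k u v => ltac:(by rewrite /= !mulmxDl -!scalemxAl scale_col_mx add_col_mx)).
have XT : (X <= e @: T)%VS.
  apply/subvP => v /eX; rewrite -[v]vsubmxK; set a := usubmx v; set b := dsubmx v.
  move=> /AE[ya yb wab].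
  pose t := (a - dot w a *: f) *m x1 + (b - dot w b *: f) *m x2 + dot w b *: (f *m (x2 - c *: x1)).
  have tT : t \in T.
    by rewrite !memvD ?memvZ //; [apply: h1|apply: h2]; rewrite !dotE ?wf ?ya ?yb ?y1f ?y2f; ring.
  apply/memv_imgP; exists t => //; rewrite ee /t !mulmxDl -!scalemxAl !mulmx_dotr.
  rewrite !dotE x1c1 x1c2 x2c1 x2c2; congr col_mx; apply/colP => i; rewrite !mxE.
    have -> : dot w a = - (c * dot w b) by apply/eqP; rewrite -addr_eq0 wab.
    by ring.
  by ring.
have eXT : X = (e @: T)%VS.
  apply/eqP; rewrite eqEdim XT; apply: (@leq_trans (\dim T)); last by move: dX dT; lia.
  by rewrite -(limg_ker_dim e T) leq_addl.
move=> t tT.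
have /eX : e t \in X by rewrite eXT memv_img.
rewrite ee => /AE[e1 e2 e3].
rewrite mxtrace_mulC mulmxDr raddfD /= !mulmxA !(mxtrace_mulC _ (_ + _)) !mulmxA.
have tr1 (M : 'M[K]_1) : \tr M = M 0 0 by rewrite /mxtrace big_ord1.
rewrite !tr1 -!mulmxA -/(dot _ (t *m c1)) -/(dot _ (t *m c2)) !dotE e1 e2.
by rewrite !addr0.
Qed.

Lemma ev_line n p (T : {vspace 'M[K]_(n, p)}) v (a b : 'rV[K]_p) :
  (\dim (ev v T) < 2)%N -> a \in ev v T -> b \in ev v T -> a != 0 -> (b <= a)%MS.
Proof.
move=> d aT bT a0; have e : <[a]>%VS = ev v T.
  by apply/eqP; rewrite eqEdim -memvE aT dim_vline a0 -ltnS.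
by move: bT; rewrite -e => /vlineP[k ->]; apply: scalemx_sub.
Qed.

Lemma ev_det n p (T : {vspace 'M[K]_(n, p)}) v (a b : 'rV[K]_p) d1 d2 :
  (\dim (ev v T) < 2)%N -> a \in ev v T -> b \in ev v T ->
  dot a d1 * dot b d2 - dot a d2 * dot b d1 = 0.
Proof.
move=> d aT bT; have [->|a0] := eqVneq a 0; first by rewrite !dot0l; ring.
by have /sub1P[k ->] := ev_line d aT bT a0; rewrite !dotZl; ring.
Qed.

(** Take an adapted [y] in the row space of [H] and [g] outside. If nothing outside were adapted, a
    2 by 2 determinant would vanish at [g] and at every [y + a *: g] with [a != 0]; the first kills
    the quadratic coefficient, leaving [1 + a * tr = 0] at both [a = 1] and [a = lam]. *)
Lemma adapted_outside (lam : K) n p (T : {vspace 'M[K]_(n, p)}) m (H : 'M[K]_(m, n)) :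
  lam != 0 -> lam != 1 -> (exists y : 'rV_n, (2 <= \dim (ev y T))%N) -> (\rank H < n)%N ->
  exists2 y : 'rV_n, (2 <= \dim (ev y T))%N & ~~ (y <= H)%MS.
Proof.
move=> lam0 lam1 [y dy] rH; have [yH|] := boolP (y <= H)%MS; last by exists y.
have [g gH] := exists_not_sub rH.
have [u1 [u2 [u1T u2T u10 /not_line_sub u21]]] := dim2_pair dy.
have [d2 /row1_eq0 u1d2 u2d2] := sep u21.
have [d1 /row1_eq0 u2d1 u1d1] := sep (sub_sym1 u10 u21).
have [t1 t1T e1] := evP u1T; have [t2 t2T e2] := evP u2T.
apply: NNPP => none.
have nad v : ~~ (v <= H)%MS -> (\dim (ev v T) < 2)%N.
  by move=> vH; rewrite ltnNge; apply/negP => dv; apply: none; exists v.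
have out (a : K) : a != 0 -> ~~ ((y + a *: g)%R <= H)%MS.
  move=> a0; apply: contra gH => h; rewrite -[g](scalerK a0) scalemx_sub //.
  by rewrite -[a *: g](addKr y) addmx_sub // eqmx_opp.
pose A i j := dot (g *m (if i then t1 else t2)) (if j then d1 else d2).
pose tr := A true true + A false false.
pose det := A true true * A false false - A true false * A false true.
have d0 : det = 0 := ev_det d1 d2 (nad g gH) (mem_ev _ t1T) (mem_ev _ t2T).
have pol a : a != 0 -> 1 + a * tr = 0.
  move=> a0; have := ev_det d1 d2 (nad _ (out a a0)) (mem_ev _ t1T) (mem_ev _ t2T).
  rewrite !mulmxDl -!scalemxAl -e1 -e2 !dotE u1d1 u1d2 u2d1 u2d2 => e0.
  rewrite (_ : 1 + a * tr = (1 + a * A true true) * (1 + a * A false false) -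
    (0 + a * A true false) * (0 + a * A false true) - a ^+ 2 * det); last by rewrite /tr /det; ring.
  by rewrite e0 d0 mulr0 subr0.
have tr0 : tr = 0.
  have : (lam - 1) * tr = (1 + lam * tr) - (1 + 1 * tr) by ring.
  rewrite !pol ?oner_eq0 // subrr => /eqP.
  by rewrite mulf_eq0 subr_eq0 (negPf lam1) => /eqP.
by have := pol 1 (oner_neq0 _); rewrite tr0 mulr0 addr0 => /eqP; rewrite oner_eq0.
Qed.

Lemma hyperplane_exists n (X : {vspace 'cV[K]_n}) : (0 < n)%N -> (n <= \dim X + 1)%N ->
  exists2 w : 'rV_n, w != 0 & forall f, dot w f = 0 -> f \in X.
Proof.
move=> n0 dX; have [fX|] := boolP (fullv <= X)%VS.
  exists (delta_mx 0 (Ordinal n0)).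
    by apply/eqP => /matrixP/(_ 0 (Ordinal n0)); rewrite !mxE !eqxx => /eqP; rewrite oner_eq0.
  by move=> f _; apply: (subvP fX); apply: memvf.
case/subvPn => f0 _ /functional_sep[g [gl gX g0]].
have [t et] := functional_trace gl.
have tE f : g f = dot t f by rewrite et mxtrace_mulC /mxtrace big_ord1.
exists t.
  by apply: contraTneq (oner_neq0 K) => t0; rewrite -g0 tE t0 dot0l eqxx.
have [Y [eY dY]] := colspace_dim t.
have XY : (X <= Y)%VS by apply/subvP => f /gX e; apply/eY/row1_eq0; rewrite -tE.
have dYn : (\dim Y < n)%N.
  rewrite ltn_neqAle; apply/andP; split; last first.
    by apply: leq_trans (dimvS (subvf Y)) _; rewrite dimvf /dim /= muln1.
  apply/eqP => e; have : f0 \in Y.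
    have -> : Y = fullv by apply/eqP; rewrite eqEdim subvf dimvf /dim /= muln1 e leqnn.
    exact: memvf.
  by move/eY/row1_eq0; rewrite -tE g0 => /eqP; rewrite oner_eq0.
have eXY : X = Y by apply/eqP; rewrite eqEdim XY; lia.
by move=> f e; rewrite eXY; apply/eY/row1_eq0.
Qed.

(** If every [ev y T] has dimension at most 1, either some evaluation is injective on [T], so that
    [\dim T <= 1], or all rows of [T] lie on one line. In the second case [T] consists of matrices
    [c *m x0], with [c] filling at least a hyperplane, which is the excluded Type 1 situation. *)
Lemma exists_adapted n p (T : {vspace 'M[K]_(n, p)}) :
  (forall (x : 'rV_p) (w : 'rV_n), x != 0 -> w != 0 -> exists2 f : 'cV[K]_n, dot w f = 0 & f *m x \notin T) ->
  (2 <= \dim T)%N -> (n <= \dim T + 1)%N -> exists y : 'rV_n, (2 <= \dim (ev y T))%N.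
Proof.
move=> noT1 d2 dn; apply: NNPP => none.
have small y : (\dim (ev y T) < 2)%N by rewrite ltnNge; apply/negP => dy; apply: none; exists y.
have T0 : T != 0%VS by rewrite -dimv_eq0; lia.
pose t0 := vpick T; have t0T : t0 \in T by apply: memv_pick.
have [y0 y0t0] : exists y0 : 'rV_n, y0 *m t0 != 0.
  have : t0 != 0 by rewrite vpick0.
  case/matrix0Pn => i [j tij]; exists (delta_mx 0 i); rewrite -rowE.
  by apply/rV0Pn; exists j; rewrite mxE.
pose x0 := y0 *m t0.
have line (y : 'rV_n) t : t \in T -> (y *m t <= x0)%MS.
  move=> tT; apply/negPn/negP => yt.
  have inj u : u \in T -> y0 *m u = 0 -> u = 0.
    move=> uT y0u.
    have vu (v : 'rV_n) : (v *m u <= x0)%MS.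
      have [->|vu0] := eqVneq (v *m u) 0; first exact: sub0mx.
      have h1 := ev_line (small v) (mem_ev v uT) (mem_ev v t0T) vu0.
      have e : (y0 + v) *m u = v *m u by rewrite mulmxDl y0u add0r.
      have := ev_line (small (y0 + v)) (mem_ev _ uT) (mem_ev _ t0T); rewrite e => /(_ vu0).
      rewrite mulmxDl => h2; have : (x0 <= v *m u)%MS.
        by rewrite -[x0](addrK (v *m t0)) addmx_sub // eqmx_opp.
      by move/sub1P=> [k ek]; rewrite ek eqmx_scale //; apply: contraNneq y0t0 => k0; rewrite -/x0 ek k0 scale0r.
    have yu : y *m u = 0.
      apply/eqP/negPn/negP => yu0; case/negP: yt.
      exact: submx_trans (ev_line (small y) (mem_ev y uT) (mem_ev y tT) yu0) (vu y).
    apply/row_matrixP => i; rewrite row0 rowE; set v := delta_mx _ _.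
    apply/eqP/negPn/negP => vu0; case/negP: yt.
    have h1 := submx_trans (ev_line (small v) (mem_ev v uT) (mem_ev v tT) vu0) (vu v).
    have e : (y + v) *m u = v *m u by rewrite mulmxDl yu add0r.
    have := ev_line (small (y + v)) (mem_ev _ uT) (mem_ev _ tT); rewrite e => /(_ vu0) h2.
    have := submx_trans h2 (vu v); rewrite mulmxDl => h3.
    by rewrite -[y *m t](addrK (v *m t)) addmx_sub // eqmx_opp.
  have := limg_ker_dim (linfun (mulmx y0 : 'M_(n, p) -> 'rV_p)) T; rewrite -/(ev y0 T).
  rewrite (_ : (_ :&: _)%VS = 0%VS) ?dimv0 => [e|]; first by move: d2; rewrite -e add0n leqNgt small.
  apply/eqP; rewrite -subv0; apply/subvP => u; rewrite memv_cap memv_ker lfunE /= memv0.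
  by case/andP=> uT /eqP/(inj u uT) ->.
have [d xd] := sep1 y0t0; rewrite -/x0 in xd.
have tE t : t \in T -> t = (t *m d) *m x0.
  move=> tT; apply/row_matrixP => i; rewrite !row_mul rowE.
  have /sub1P[k ->] := line (delta_mx 0 i) t tT.
  by rewrite -!mulmxA mulmx_dot !dotE xd mulr1.
pose X := (linfun (mulmxr d : 'M_(n, p) -> 'cV_n) @: T)%VS.
have dX : \dim X = \dim T.
  apply: limg_dim_eq; apply/eqP; rewrite -subv0; apply/subvP => t.
  rewrite memv_cap memv_ker lfunE /= memv0 => /andP[tT /eqP e].
  by rewrite (tE t tT) e mul0mx.
have n0 : (0 < n)%N.
  rewrite lt0n; apply: contraNneq y0t0 => e; apply/eqP/rowP => j.
  by rewrite !mxE big1 // => i _; have := ltn_ord i; rewrite [X in (_ < X)%N]e.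
have [w w0 hw] := hyperplane_exists (X := X) n0 ltac:(by rewrite dX).
have [f wf] := noT1 x0 w y0t0 w0; case/negP.
have /memv_imgP[t tT ->] := hw f wf.
by rewrite lfunE /= -tE.
Qed.
End Low.

(** * The situation without quotients of symmetric type *)

Section LowKinds.
Variable K : fieldType.

Definition rc_linear n p (T : {vspace 'M[K]_(n, p)}) (F : 'M[K]_(p, n) -> 'rV[K]_n) :=
  forall s k, orth T s -> F (k *: s) = k *: F s.

(** The quotient map modulo [v] is local. *)
Definition kind0 n p (T : {vspace 'M[K]_(n, p)}) (F : 'M[K]_(p, n) -> 'rV[K]_n) (v : 'rV[K]_n) :=
  exists z, forall s, orth T s -> exists b, F s = z *m s + b *: v.

(** The quotient map modulo [v] is of Type 1, with a truly nonlinear [alpha]; everything is pulled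
    back, hence known only up to multiples of [v]. *)
Definition kind1_data n p (T : {vspace 'M[K]_(n, p)}) (F : 'M[K]_(p, n) -> 'rV[K]_n)
    (v : 'rV[K]_n) (x : 'rV[K]_p) (w : 'rV[K]_n) (z : 'rV[K]_p) (alpha : K -> K) :=
  [/\ x != 0, ~~ (w <= v)%MS, exists k, alpha k != k * alpha 1,
    exists2 s, orth T s & exists a, x *m s = w + a *: v &
    forall s, orth T s -> exists m a b,
      x *m s = m *: w + a *: v /\ F s = z *m s + alpha m *: w + b *: v].

Definition kind1 n p (T : {vspace 'M[K]_(n, p)}) F (v : 'rV[K]_n) :=
  exists x w z alpha, kind1_data T F v x w z alpha.

Lemma kind0_linear n p (T : {vspace 'M[K]_(n, p)}) F v c :
  kind0 T F v -> dot v c = 0 -> linear_at T F c.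
Proof.
move=> [z hz] vc s k os; have [b ->] := hz s os; have [b' ->] := hz _ (orthZ k os).
by rewrite -scalemxAr !dotE vc !mulr0 !addr0.
Qed.

Section Kind1.
Variables (n p : nat) (T : {vspace 'M[K]_(n, p)}) (F : 'M[K]_(p, n) -> 'rV[K]_n)
    (v : 'rV[K]_n) (x : 'rV[K]_p) (w : 'rV[K]_n) (z : 'rV[K]_p) (alpha : K -> K).
Hypothesis k1 : kind1_data T F v x w z alpha.

Lemma kind1_dot s c : orth T s -> dot v c = 0 -> dot w c = 1 ->
  dot (F s) c = dot (z *m s) c + alpha (dot (x *m s) c).
Proof.
case: k1 => _ _ _ _ h os vc wc; have [m [a [b [-> ->]]]] := h s os.
by rewrite !dotE vc wc !mulr0 !mulr1 !addr0.
Qed.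

Lemma kind1_dot0 s c : orth T s -> dot v c = 0 -> dot w c = 0 ->
  dot (F s) c = dot (z *m s) c /\ dot (x *m s) c = 0.
Proof.
case: k1 => _ _ _ _ h os vc wc; have [m [a [b [-> ->]]]] := h s os.
by rewrite !dotE vc wc !mulr0 !addr0.
Qed.

Lemma kind1_linear c : dot v c = 0 -> dot w c = 0 -> linear_at T F c.
Proof.
move=> vc wc s k os; rewrite (kind1_dot0 os vc wc).1 (kind1_dot0 (orthZ k os) vc wc).1.
by rewrite -scalemxAr dotZl.
Qed.

Lemma kind1_alpha (r : K) : (forall t, alpha t = t * r) -> False.
Proof.
by case: k1 => _ _ [k hk] _ _ e; case/negP: hk; rewrite !e mul1r.
Qed.

Lemma kind1_nonlinear c : dot v c = 0 -> dot w c = 1 -> ~ linear_at T F c.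
Proof.
move=> vc wc lin; have [_ _ _ [s os [a xs]] _] := k1.
have xsc : dot (x *m s) c = 1 by rewrite xs !dotE vc wc mulr0 addr0.
apply: (kind1_alpha (r := alpha 1)) => t.
have := lin s t os; rewrite !(kind1_dot _ vc wc) //; last exact: orthZ.
by rewrite -!scalemxAr !dotZl xsc mulr1 mulrDr => /addrI.
Qed.
End Kind1.

Section AllLow.
Variables (lam : K) (lam0 : lam != 0) (lam1 : lam != 1).
Variables (n p : nat) (T : {vspace 'M[K]_(n, p)}) (F : 'M[K]_(p, n) -> 'rV[K]_n).
Hypotheses (h : rc T F) (n3 : (3 <= n)%N) (dT : (\dim T + 3 <= 2 * n)%N).
Hypothesis noT1 : forall (x : 'rV_p) (w : 'rV_n), x != 0 -> w != 0 ->
  exists2 f : 'cV[K]_n, dot w f = 0 & f *m x \notin T.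
Hypothesis ad : exists y : 'rV_n, (2 <= \dim (ev y T))%N.

Lemma adapted_neq0 y : (2 <= \dim (ev y T))%N -> y != 0.
Proof.
case/dim2_pair => u [_ [/evP[t _ ->] _ u0 _]].
by apply: contraNneq u0 => ->; rewrite mul0mx.
Qed.

(** Three independent adapted vectors give [F s = z *m s] modulo each, with [z0], [z1], [z2]. Two
    equal ones, among the pairs with [z0], make [F] local. Otherwise the differences satisfy the
    hypotheses of [configuration], and the operator obtained kills a column on which [F] takes the
    value 1. *)
Lemma all_low_linear : rc_linear T F ->
  (forall v, (2 <= \dim (ev v T))%N -> kind0 T F v) -> rc_local T F.
Proof.
move=> _ k0.
have [y0 dy0 _] : exists2 y : 'rV_n, (2 <= \dim (ev y T))%N & True by case: ad => y; exists y.
have y00 := adapted_neq0 dy0.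
have [y1 dy1 y1y0] : exists2 y, (2 <= \dim (ev y T))%N & ~~ (y <= y0)%MS.
  by apply: adapted_outside lam0 lam1 ad _; apply: leq_ltn_trans (rank_leq_row _) _; lia.
have [y2 dy2 y2y] : exists2 y, (2 <= \dim (ev y T))%N & ~~ (y <= col_mx y0 y1)%MS.
  by apply: adapted_outside lam0 lam1 ad _; apply: leq_ltn_trans (rank_leq_row _) _; lia.
have [z0 hz0] := k0 _ dy0; have [z1 hz1] := k0 _ dy1; have [z2 hz2] := k0 _ dy2.
have [n1 n2] := not_sub2 y00 y1y0 y2y.
have [f2 /col2_eq0[y0f2 y1f2] y2f2] := sep y2y.
have [f0 /col2_eq0[y1f0 y2f0] y0f0] := sep n1.
have [f1 /col2_eq0[y0f1 y2f1] y1f1] := sep n2.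
have diff (z z' : 'rV_p) (y y' : 'rV_n) :
    (forall s, orth T s -> exists b, F s = z *m s + b *: y) ->
    (forall s, orth T s -> exists b, F s = z' *m s + b *: y') ->
    forall s, orth T s -> exists b b', (z' - z) *m s = b *: y - b' *: y' /\ F s = z *m s + b *: y.
  move=> e e' s os; have [b eb] := e s os; have [b' eb'] := e' s os; exists b, b'.
  split=> //; rewrite mulmxBl; apply/eqP; rewrite subr_eq; apply/eqP.
  by apply: (addIr (b' *: y')); rewrite -eb' eb; apply/rowP => i; rewrite !mxE; ring.
have local_eq (z z' : 'rV_p) (y y' : 'rV_n) f : dot y f = 1 -> dot y' f = 0 -> z' - z = 0 ->
    (forall s, orth T s -> exists b, F s = z *m s + b *: y) ->
    (forall s, orth T s -> exists b, F s = z' *m s + b *: y') -> rc_local T F.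
  move=> yf y'f e e1 e2; exists z => s os; have [b [b' [eb ->]]] := diff _ _ _ _ e1 e2 s os.
  have := congr1 (dot^~ f) eb; rewrite e mul0mx dot0l !dotE yf y'f mulr0 subr0 mulr1 => <-.
  by rewrite scale0r addr0.
pose d1 := z1 - z0; pose d2 := z2 - z0.
have [e1|d10] := eqVneq d1 0; first exact: (local_eq _ _ _ _ _ y0f0 y1f0 e1 hz0 hz1).
have [e2|d20] := eqVneq d2 0; first exact: (local_eq _ _ _ _ _ y0f0 y2f0 e2 hz0 hz2).
have D1 := diff _ _ _ _ hz0 hz1; have D2 := diff _ _ _ _ hz0 hz2; rewrite -/d1 -/d2 in D1 D2.
(* Were the differences proportional, [d1 *m s] would always lie on the line of [y0], the excluded
   Type 1 situation. *)
have d21 : ~~ (d2 <= d1)%MS.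
  apply/negP => /sub1P[l e]; have l0 : l != 0.
    by apply: contraNneq d20 => l0; rewrite e l0 scale0r.
  have [f y0f] := noT1 d10 y00; case/negP; apply/rank1_orthP => s os.
  have [b [b1 [eb _]]] := D1 s os; have [b' [b2 [eb' _]]] := D2 s os.
  have : b1 = 0.
    have := congr1 (dot^~ f1) eb'; rewrite e -scalemxAl eb !dotE y0f1 y1f1 y2f1.
    by rewrite !mulr0 !mulr1 subr0 sub0r mulrN => /eqP; rewrite oppr_eq0 mulf_eq0 (negPf l0) => /eqP.
  by move=> b10; rewrite eb b10 scale0r subr0 dotZl y0f mulr0.
have [s [os xs1 xs2 ks]] := @configuration K n p T d1 d2 y0 y1 y2 1 f0 dT d10 d21 y0f0 y1f0 y2f0
  (fun g g0 g1 => ltac:(by apply/rank1_orthP => s /D1[b [b' [-> _]]]; rewrite !dotE g0 g1; ring))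
  (fun g g0 g1 => ltac:(by apply/rank1_orthP => s /D2[b [b' [-> _]]]; rewrite !dotE g0 g1; ring))
  ltac:(apply/rank1_orthP => s os; have [b [b1 [eb eF]]] := D1 s os;
    have [b' [b2 [eb' eF']]] := D2 s os;
    rewrite scale1r mulmxBl eb eb'; move: eF'; rewrite eF => /addrI/(congr1 (dot^~ f0));
    by rewrite !dotE y0f0 y1f0 y2f0 => e; rewrite !mulr1 in e; rewrite e; ring).
have [b [b' [eb eF]]] := D1 s os.
pose r := f0 - f1 - f2.
have sr : s *m r = 0.
  apply: ks; rewrite /r !dotE ?y0f0 ?y0f1 ?y0f2 ?y1f0 ?y1f1 ?y1f2 ?y2f0 ?y2f1 ?y2f2; ring.
have b1 : b = 1.
  move: eb; rewrite xs1 => /(congr1 (dot^~ f0)).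
  by rewrite !dotE y0f0 y1f0 mulr0 subr0 mulr1 addr0 => <-.
have := rc_dot h os sr; rewrite eF b1 dotDl -dotA sr dot0r /r !dotE y0f0 y0f1 y0f2.
by rewrite !subr0 mulr1 add0r => /eqP; rewrite oner_eq0.
Qed.

(** Nonlinearity forces Type 1 modulo two independent adapted vectors, and the nonlinear directions
    must agree, giving a common [w]. Then [configuration] provides an operator [s] killing a column
    [r]; pairing [F (k *: s)] with [r] expresses [alpha] linearly in [k]. *)
Lemma all_low_nonlinear : ~ rc_linear T F ->
  (forall v, (2 <= \dim (ev v T))%N -> kind0 T F v \/ kind1 T F v) -> False.
Proof.
move=> nl kinds.
have [y1 dy1 [x1 [w1 [z1 [al1 k1]]]]] : exists2 y, (2 <= \dim (ev y T))%N & kind1 T F y.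
  have [y0 dy0] := ad; have [k0|] := kinds y0 dy0; last by exists y0.
  have [y dy yy0] : exists2 y, (2 <= \dim (ev y T))%N & ~~ (y <= y0)%MS.
    by apply: adapted_outside lam0 lam1 ad _; apply: leq_ltn_trans (rank_leq_row _) _; lia.
  exists y => //; have [k0'|//] := kinds y dy; case: nl => s k os; apply: row_dotP => c.
  have [d /row1_eq0 y0d yd] := sep yy0.
  have e1 : dot y (c - dot y c *: d) = 0 by rewrite !dotE yd; ring.
  have e2 : dot y0 (dot y c *: d) = 0 by rewrite !dotE y0d mulr0.
  rewrite -[c](subrK (dot y c *: d)) !(dotDr _ (c - dot y c *: d)).
  rewrite (kind0_linear k0' e1 k os) (kind0_linear k0 e2 k os).
  by rewrite -!(dotZl k).
have [x10 w1y1 _ [s1 os1 [a1 xs1]] _] := k1.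
have y10 := adapted_neq0 dy1.
have [y2 dy2 y2y] : exists2 y, (2 <= \dim (ev y T))%N & ~~ (y <= col_mx y1 w1)%MS.
  by apply: adapted_outside lam0 lam1 ad _; apply: leq_ltn_trans (rank_leq_row _) _; lia.
have [_ w1y12] := not_sub2 y10 w1y1 y2y.
have [x2 [w2 [z2 [al2 k2]]]] : kind1 T F y2.
  have [k0|//] := kinds y2 dy2; have [f /col2_eq0[y1f y2f] w1f] := sep w1y12.
  by case: (kind1_nonlinear k1 y1f w1f); apply: kind0_linear k0 y2f.
(* A column annihilated by [y1], [y2], [w2] but not by [w1] would be both a nonlinear and a linear
   direction. *)
have [c0 [b2 [a ew1]]] : exists c0 b2 a, w1 = a *: y1 + b2 *: y2 + c0 *: w2.
  have /submxP[D eD] : (w1 <= col_mx y1 (col_mx y2 w2))%MS.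
    apply/negPn/negP => /sep[f /eqP + w1f].
    rewrite mul_col_mx col_mx_eq0 => /andP[/eqP/row1_eq0 y1f /eqP/col2_eq0[y2f w2f]].
    exact: (kind1_nonlinear k1 y1f w1f (kind1_linear k2 y2f w2f)).
  have : (w1 <= col_mx y1 (col_mx y2 w2))%MS by rewrite eD submxMl.
  rewrite -addsmxE => /sub_addsmxP[[D1 D2] /= e].
  have /sub1P[a ea] : (D1 *m y1 <= y1)%MS by apply: submxMl.
  have /sub2P[b [c eb]] : (D2 *m col_mx y2 w2 <= col_mx y2 w2)%MS by apply: submxMl.
  by exists c, b, a; rewrite e ea eb addrA.
have c00 : c0 != 0.
  apply: contra w1y12 => /eqP e; rewrite ew1 e scale0r addr0; exact: sub_col2.
pose w := b2 *: y2 + c0 *: w2.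
have ew : w1 = a *: y1 + w by rewrite ew1 addrA.
have ew2 : w2 = c0^-1 *: w - (c0^-1 * b2) *: y2.
  by rewrite /w scalerDr !scalerA mulVf // scale1r addrC addKr.
clearbody w.
have wy1 : ~~ (w <= y1)%MS.
  by apply: contra w1y1 => e; rewrite ew addmx_sub ?scalemx_sub.
have y2w : ~~ (y2 <= col_mx y1 w)%MS.
  apply: contra y2y => /sub2P[k [l e]].
  have -> : y2 = (k - l * a) *: y1 + l *: w1; last exact: sub_col2.
  by rewrite e ew; apply/rowP => i; rewrite !mxE; ring.
have [n1 n2] := not_sub2 y10 wy1 y2w.
have [f2 /col2_eq0[y1f2 wf2] y2f2] := sep y2w.
have [f1 /col2_eq0[wf1 y2f1] y1f1] := sep n1.
have [f /col2_eq0[y1f y2f] wf] := sep n2.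
have w1f : dot w1 f = 1 by rewrite ew !dotE y1f wf mulr0 add0r.
have w2E g : dot w2 g = c0^-1 * dot w g - c0^-1 * b2 * dot y2 g by rewrite ew2 !dotE.
have w2f : dot w2 f = c0^-1 by rewrite w2E wf y2f mulr0 mulr1 subr0.
have k2f s : orth T s -> exists m, dot (x2 *m s) f = m * c0^-1 /\
    dot (F s) f = dot (z2 *m s) f + al2 m * c0^-1.
  case: k2 => _ _ _ _ hs /hs[m [a' [b' [-> ->]]]]; exists m.
  by rewrite !dotE y2f w2f !mulr0 !addr0.
pose c := dot (x2 *m s1) f.
have m1s1 : dot (x1 *m s1) f = 1 by rewrite xs1 !dotE y1f w1f mulr0 addr0.
(* If this fails, some [s'] has zero [x1] component and nonzero [x2] component along [f]; comparing
   both formulas for [F] on its multiples makes [al2] linear. *)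
have prop s : orth T s -> dot (x2 *m s) f = c * dot (x1 *m s) f.
  move=> os; pose s' := s - dot (x1 *m s) f *: s1.
  have os' : orth T s' by apply: orthB => //; apply: orthZ.
  have m1s' : dot (x1 *m s') f = 0.
    by rewrite /s' mulmxBr -scalemxAr !dotE m1s1 mulr1 subrr.
  have e : dot (x2 *m s') f = dot (x2 *m s) f - dot (x1 *m s) f * c.
    by rewrite /s' mulmxBr -scalemxAr !dotE.
  have [e0|ne] := eqVneq (dot (x2 *m s') f) 0.
    by apply/eqP; rewrite -subr_eq0 (mulrC c) -e e0.
  exfalso; set mu := dot (x2 *m s') f in ne.
  have al10 : al1 0 = 0.
    have := kind1_dot k1 (@orth0 _ _ _ T) y1f w1f.
    by rewrite (rc0 h) !mulmx0 !dot0l add0r.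
  apply: (kind1_alpha k2 (r := (dot (z1 *m s') f - dot (z2 *m s') f) / mu)) => t.
  pose k := t / (mu * c0).
  have [m [em eF]] := k2f _ (orthZ k os').
  have eF1 := kind1_dot k1 (orthZ k os') y1f w1f.
  rewrite -!scalemxAr !dotZl -/mu in em eF eF1; rewrite m1s' mulr0 al10 addr0 in eF1.
  have -> : al2 t = al2 m.
    congr al2; apply: (mulIf (invr_neq0 c00)).
    by rewrite -em /k; field; rewrite ne c00.
  apply: (mulIf (invr_neq0 c00)); apply: (addrI (k * dot (z2 *m s') f)).
  rewrite -eF eF1 /k; field; by rewrite ne c00.
have x1s s : orth T s -> exists m a, x1 *m s = m *: w + a *: y1.
  case: k1 => _ _ _ _ hs /hs[m [a' [b' [-> _]]]]; exists m, (m * a + a').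
  by rewrite ew; apply/rowP => i; rewrite !mxE; ring.
have x2s s : orth T s -> exists m a, x2 *m s = m *: w + a *: y2.
  case: k2 => _ _ _ _ hs /hs[m [a' [b' [-> _]]]]; exists (m * c0^-1), (a' - m * (c0^-1 * b2)).
  by rewrite [in m *: w2]ew2; apply/rowP => i; rewrite !mxE; ring.
have x20 : x2 != 0 by case: k2.
have w0 : w != 0 by apply: contraNneq wy1 => ->; apply: sub0mx.
have x21 : ~~ (x2 <= x1)%MS.
  apply/negP => /sub1P[l e]; have l0 : l != 0.
    by apply: contraNneq x20 => l0; rewrite e l0 scale0r.
  have [g wg] := noT1 x10 w0; case/negP; apply/rank1_orthP => s os.
  have [m [d ed]] := x1s s os; have [m' [d' ed']] := x2s s os.
  have : d = 0.
    have := congr1 (dot^~ f1) ed'; rewrite e -scalemxAl ed !dotE wf1 y1f1 y2f1.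
    by rewrite !mulr0 !mulr1 !add0r => /eqP; rewrite mulf_eq0 (negPf l0) => /eqP.
  by move=> d0; rewrite ed d0 scale0r addr0 dotZl wg mulr0.
have t1 g : dot w g = 0 -> dot y1 g = 0 -> g *m x1 \in T.
  move=> wg yg; apply/rank1_orthP => s os; have [m [d ->]] := x1s s os.
  by rewrite !dotE wg yg !mulr0 addr0.
have t2 g : dot w g = 0 -> dot y2 g = 0 -> g *m x2 \in T.
  move=> wg yg; apply/rank1_orthP => s os; have [m [d ->]] := x2s s os.
  by rewrite !dotE wg yg !mulr0 addr0.
have t3 : f *m (x2 - c *: x1) \in T.
  apply/rank1_orthP => s os; rewrite mulmxBl -scalemxAl dotDl dotNl dotZl prop //.
  by rewrite subrr.
have [s [os xs x2s' ks]] := configuration dT x10 x21 wf y1f y2f t1 t2 t3.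
pose r := f - f1 - c *: f2.
have sr : s *m r = 0.
  by apply: ks; rewrite /r !dotE ?wf ?wf1 ?wf2 ?y1f ?y1f1 ?y1f2 ?y2f ?y2f1 ?y2f2; ring.
apply: (kind1_alpha k1 (r := dot (z2 *m s) f1 + c * dot (z1 *m s) f2 - dot (z1 *m s) f)) => k.
have osk := orthZ k os.
have e0 : dot (F (k *: s)) r = 0.
  by apply: rc_dot h osk _; rewrite -scalemxAl sr scaler0.
have w1f2 : dot w1 f2 = 0 by rewrite ew !dotE y1f2 wf2 mulr0 addr0.
have w2f1 : dot w2 f1 = 0 by rewrite w2E wf1 y2f1; ring.
have E := kind1_dot k1 osk y1f w1f.
have [E1 _] := kind1_dot0 k2 osk y2f1 w2f1.
have [E2 _] := kind1_dot0 k1 osk y1f2 w1f2.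
move: e0; rewrite /r dotDr dotNr dotDr dotNr dotZr E E1 E2 -!scalemxAr xs !dotZl !dotDl wf y1f.
rewrite addr0 mulr1 => e0; apply/eqP; rewrite -subr_eq0 -[X in _ == X]e0.
by apply/eqP; ring.
Qed.
End AllLow.
End LowKinds.

(** * The induction on the dimension of the target *)

Section Main.
Variable K : fieldType.
Variables (lam : K) (lam0 : lam != 0) (lam1 : lam != 1).

Definition type1 n p (T : {vspace 'M[K]_(n, p)}) (F : 'M[K]_(p, n) -> 'rV[K]_n) : Prop :=
  exists (x : 'rV_p) (w : 'rV_n) (z : 'rV_p) (alpha : K -> K),
    [/\ x != 0, w != 0, exists k, alpha k != k * alpha 1, exists2 s, orth T s & x *m s = w &
     forall s, orth T s -> exists2 m, x *m s = m *: w & F s = z *m s + alpha m *: w].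

(** Types 2 and 3 in one: rank 2 is Type 2, rank 3 with [n = 3] is Type 3. The dimension equality is
    kept because the induction needs it in [kindJ]. *)
Definition typeJ n p (T : {vspace 'M[K]_(n, p)}) (F : 'M[K]_(p, n) -> 'rV[K]_n) : Prop :=
  exists (J : 'M_(n, p)) (z : 'rV_p) (alpha : K -> K),
    [/\ (\dim T + 3 = 2 * n)%N, (2 <= \rank J)%N /\ (\rank J = 2%N \/ n = 3%N),
      forall s, orth T s <-> (J *m s)^T = J *m s,
      [/\ 2%:R = 0 :> K, root_linear alpha & exists t, alpha t != 0] &
      forall s, orth T s -> F s = z *m s + \row_i alpha ((J *m s) i i)].

Lemma type1_or_local n p (T : {vspace 'M[K]_(n, p)}) F (x : 'rV[K]_p) (w : 'rV[K]_n) :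
  x != 0 -> w != 0 -> (forall c, dot w c = 0 -> c *m x \in T) ->
  (\dim T + 3 <= 2 * n)%N -> rc T F ->
  rc_local T F \/ (~ rc_linear T F /\ type1 T F).
Proof.
move=> x0 w0 hw dT h; have [z [al [alD hF]]] := type1_form x0 w0 hw dT h.
have [c wc] := sep1 w0.
have [[s0 [os0 xs0]]|none] := classic (exists s, orth T s /\ x *m s = w); last first.
  left; exists z => s os; have [m xs ->] := hF s os.
  have [->|m0] := eqVneq m 0; first by rewrite additive0 // scale0r addr0.
  case: none; exists (m^-1 *: s); split; first exact: orthZ.
  by rewrite -scalemxAr xs scalerA mulVf // scale1r.
have [[k nk]|lin] := classic (exists k, al k != k * al 1); last first.
  have {}lin k : al k = k * al 1 by apply/eqP/negPn/negP => e; apply: lin; exists k.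
  left; exists (z + al 1 *: x) => s os; have [m xs ->] := hF s os.
  by rewrite mulmxDl -scalemxAl xs lin scalerA (mulrC m).
right; split; last by exists x, w, z, al; split=> //; [exists k|exists s0].
have mE a : F (a *: s0) = z *m (a *: s0) + al a *: w.
  have [m xs ->] := hF _ (orthZ a os0); congr (_ + al _ *: _).
  have := congr1 (dot^~ c) xs; rewrite -scalemxAr xs0 !dotZl wc !mulr1; exact: esym.
move=> lin; case/negP: nk; have := lin s0 k os0; rewrite mE -[s0 in RHS]scale1r mE.
rewrite scale1r -scalemxAr scalerDr => /addrI/(congr1 (dot^~ c)).
by rewrite scalerA !dotZl wc !mulr1 => ->.
Qed.

Lemma typeJ_or_local n p (T : {vspace 'M[K]_(n, p)}) F (J : 'M[K]_(n, p)) :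
  (\dim T + 3 = 2 * n)%N -> (2 <= \rank J)%N -> (\rank J = 2%N \/ n = 3%N) ->
  (forall s, orth T s <-> (J *m s)^T = J *m s) -> rc T F ->
  rc_local T F \/ (~ rc_linear T F /\ typeJ T F).
Proof.
move=> dT r2 r3 hX h.
have hon : rc_on (fun s => (J *m s)^T = J *m s) F.
  split; first by rewrite mulmx0 trmx0.
    move=> s s' /hX os /hX os'; split; [exact/hX/orthD|exact: h.1].
  by move=> s /hX; apply: h.2.
have [z [al [rl c2 hF]]] := sym_form lam0 lam1 r2 hon.
have [[t at0]|none] := classic (exists t, al t != 0); last first.
  left; exists z => s /hX os; rewrite hF // (_ : \row_i _ = 0) ?addr0 //.
  apply/rowP => i; rewrite !mxE; apply/eqP/negPn/negP => e; apply: none; eexists; exact: e.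
have c20 : 2%:R = 0 :> K by apply/eqP/negPn/negP => /c2 e; rewrite e eqxx in at0.
right; split; last first.
  exists J, z, al; split=> //; first by split=> //; exists t.
  by move=> s /hX; apply: hF.
have [a [_ [aJ _]]] := two_rows r2; have [d aJd] := sep1 aJ.
pose s := d *m (J *m d)^T.
have ss : (J *m s)^T = J *m s by rewrite /s mulmxA trmx_mul trmxK.
have os : orth T s by apply/hX.
have q k : al (k * 1) = dot (\row_i al ((J *m (k *: s)) i i)) a^T.
  have sk : (J *m (k *: s))^T = J *m (k *: s) by rewrite -scalemxAr linearZ /= ss.
  rewrite -(root_linear_quadratic a c20 sk rl) -scalemxAr -scalemxAr dotZl; congr (al (_ * _)).
  by rewrite /s !mulmxA -mulmxA mulmx_dot aJd scale1r -dot_tr !trmxK dotA aJd.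
move=> lin; have al0 k : al k = al 1 * k.
  have q1 := q 1; rewrite scale1r mulr1 in q1.
  have osk : orth T (k *: s) := orthZ k os.
  have := congr1 (dot^~ a^T) (lin s k os).
  rewrite (hF _ ((hX _).1 osk)) (hF s ss) dotZl !dotDl -q -q1 mulr1.
  by rewrite -scalemxAr dotZl mulrDr => /addrI ->; rewrite mulrC.
have a10 : al 1 = 0.
  apply: (linear_root_linear lam0 lam1); split=> [x y|l x]; first by rewrite mulrDr.
  by rewrite -!al0; apply: rl.2.
by move: at0; rewrite al0 a10 mul0r eqxx.
Qed.

(** [T] is spanned by one [t]. Rank one gives the Type 1 situation. For rank two, with [A] the
    alternating 2 by 2 matrix, the vanishing of the trace of [t *m s] is the symmetry of
    [A *m t *m s]. *)
Lemma main2 p (T : {vspace 'M[K]_(2, p)}) F : \dim T = 1%N -> rc T F ->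
  rc_local T F \/ (~ rc_linear T F /\ (type1 T F \/ typeJ T F)).
Proof.
move=> dT h; have T0 : T != 0%VS by rewrite -dimv_eq0 dT.
pose t := vpick T; have t0 : t != 0 by rewrite vpick0.
have eT : <[t]>%VS = T.
  by apply/eqP; rewrite eqEdim -memvE memv_pick dim_vline t0 dT.
have [r1|r2] := leqP (\rank t) 1.
  have [c [x et]] : exists (c : 'cV[K]_2) (x : 'rV_p), t = c *m x.
    have rt : \rank t = 1%N by apply/eqP; rewrite eqn_leq r1 lt0n mxrank_eq0.
    by have := mulmx_base t; move: (col_base t) (row_base t); rewrite rt => c x e; exists c, x.
  have x0 : x != 0 by apply: contraNneq t0 => e; rewrite et e mulmx0.
  have c0 : c != 0 by apply: contraNneq t0 => e; rewrite et e mul0mx.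
  have [w w0 hw] := hyperplane_exists (X := <[c]>%VS) (isT : (0 < 2)%N) ltac:(by rewrite dim_vline c0).
  have hT f : dot w f = 0 -> f *m x \in T.
    by move=> /hw/vlineP[k ->]; rewrite -scalemxAl memvZ // -et memv_pick.
  have dT3 : (\dim T + 3 <= 2 * 2)%N by rewrite dT.
  have [|[nl t1]] := type1_or_local x0 w0 hT dT3 h; first by left.
  by right; split=> //; left.
have I2 (i : 'I_2) : i = 0 \/ i = 1.
  by case: i => [[|[|//]] hi]; [left|right]; apply: val_inj.
have l01 : lift ord0 ord0 = 1 :> 'I_2 by apply: val_inj.
pose A : 'M[K]_2 := delta_mx 0 1 - delta_mx 1 0.
have AA : A *m A = - 1%:M.
  apply/matrixP => i j; rewrite !mxE !big_ord_recl big_ord0 !mxE l01.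
  by have [->|->] := I2 i; have [->|->] := I2 j; rewrite /= ?mulr1n ?mulr0n; ring.
have hX s : orth T s <-> (A *m t *m s)^T = A *m t *m s.
  have -> : orth T s <-> \tr (t *m s) = 0.
    split=> [os|e u]; first by rewrite mxtrace_mulC os // memv_pick.
    by rewrite -eT => /vlineP[k ->]; rewrite -scalemxAr mxtraceZ mxtrace_mulC e mulr0.
  rewrite -mulmxA; move: (t *m s) => M; rewrite /mxtrace !big_ord_recl big_ord0 addr0.
  have AM i j : (A *m M) i j = (if i == 0 then M 1 j else - M 0 j).
    rewrite !mxE !big_ord_recl big_ord0 !mxE l01.
    by have [->|->] := I2 i; rewrite /= ?mulr1n ?mulr0n; ring.
  rewrite l01; split=> [/eqP|/matrixP/(_ 0 1)].
    rewrite addrC addr_eq0 => /eqP e; apply/matrixP => i j; rewrite mxE !AM.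
    by have [->|->] := I2 i; have [->|->] := I2 j; rewrite /= ?e ?opprK.
  by rewrite mxE !AM /= => /eqP; rewrite eq_sym -addr_eq0 addrC => /eqP.
have rJ : (2 <= \rank (A *m t))%N.
  have et : t = (- A) *m (A *m t) by rewrite mulmxA mulNmx AA opprK mul1mx.
  by apply: leq_trans r2 _; rewrite {1}et; apply: mxrankM_maxr.
have r3 : \rank (A *m t) = 2%N \/ 2%N = 3%N.
  by left; apply/eqP; rewrite eqn_leq rJ rank_leq_row.
have [|[nl tJ]] := typeJ_or_local (ltac:(by rewrite dT) : (\dim T + 3 = 2 * 2)%N) rJ r3 hX h.
  by left.
by right; split=> //; right.
Qed.

Definition dichotomy n p := forall (T : {vspace 'M[K]_(n, p)}) F,
  (\dim T + 3 <= 2 * n)%N -> rc T F -> rc_local T F \/ (~ rc_linear T F /\ (type1 T F \/ typeJ T F)).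

(** For adapted [v] the codimension drops by at least 2 and the target by 1, so the induction
    hypothesis applies to the quotient; its outcomes are pulled back. The symmetric one attains the
    bound, which forces [\dim (ev v T) = 2]. *)
Lemma kinds n p (T : {vspace 'M[K]_(n.+1, p)}) F (v : 'rV[K]_n.+1) :
  dichotomy n p -> (\dim T + 3 <= 2 * n.+1)%N -> rc T F -> (2 <= \dim (ev v T))%N ->
  [\/ kind0 T F v, kind1 T F v | \dim (ev v T) = 2%N /\
    exists m (P : 'M_(n.+1, m)) P' C (J : 'M_(m, p)) z alpha, kindJ T F v P P' C J z alpha].
Proof.
move=> IH dT h dv.
have v0 : v != 0.
  case: (dim2_pair dv) => u [_ [/evP[t _ ->] _ u0 _]].
  by apply: contraNneq u0 => ->; rewrite mul0mx.
have [m [P [P' [C [em P'P PP' vP]]]]] := quotient_line v0.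
case: em => em; subst m.
have [F' h' eF'] := quot_rc P h.
have dq := quot_dim P'P PP' vP T.
have [[z hz]|[nl [t1|tJ]]] := IH (quot_space P T) F' ltac:(lia) h'.
- apply: Or31; exists z => s os; exists (dot (F s - z *m s) C).
  rewrite -(quot_line PP') ?[_ + (_ - _)]addrC ?subrK //.
  by rewrite mulmxBl -eF' // hz ?mulmxA ?subrr //; apply: quot_orth.
- apply: Or32; case: t1 => x [w [z [al [x0 w0 alk [s0 os0 xs0] hx]]]].
  pose W := w *m P'; have WP : W *m P = w by rewrite -mulmxA P'P mulmx1.
  have Wv : ~~ (W <= v)%MS.
    apply: contra w0 => /sub1P[k e]; rewrite -WP e -scalemxAl vP scaler0 //.
  have lift (u : 'rV_n.+1) c : u *m P = c *: w -> exists a, u = c *: W + a *: v.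
    move=> e; exists (dot (u - c *: W) C); rewrite -(quot_line PP') ?[_ + (_ - _)]addrC ?subrK //.
    by rewrite mulmxBl e -scalemxAl WP subrr.
  exists x, W, z, al; split=> //.
    have [s os es] := quot_lift os0; exists s => //.
    have [a ea] : exists a, x *m s = 1 *: W + a *: v by apply: lift; rewrite -mulmxA es xs0 scale1r.
    by exists a; rewrite ea scale1r.
  move=> s os; have [m' xs Fs] := hx _ (quot_orth (P := P) os).
  have [a ea] : exists a, x *m s = m' *: W + a *: v by apply: lift; rewrite -mulmxA xs.
  have [b eb] : exists b, F s - z *m s = al m' *: W + b *: v.
    by apply: lift; rewrite mulmxBl -eF' // Fs mulmxA addrC addKr.
  by exists m', a, b; split=> //; rewrite -addrA -eb addrC subrK.
- apply: Or33; case: tJ => J [z [al [dT' [r2 r3] hX [c2 rl al0] hF]]].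
  split; first by lia.
  exists n, P, P', C, J, z, al; split=> // s os.
  by rewrite -eF' // hF //; apply: quot_orth.
Qed.

Theorem classification n p : (2 <= n)%N -> dichotomy n p.
Proof.
elim: n => [//|n IH] n2 T F dT h.
have [dsmall|dbig] := leqP (\dim T + 2) n.+1; first by left; apply: local_small.
have [[x [w [x0 [w0 hw]]]]|no] := classic (exists (x : 'rV[K]_p) (w : 'rV[K]_n.+1),
    x != 0 /\ w != 0 /\ forall c, dot w c = 0 -> c *m x \in T).
  have [|[nl t1]] := type1_or_local x0 w0 hw dT h; first by left.
  by right; split=> //; left.
have noT1 (x : 'rV_p) (w : 'rV_n.+1) : x != 0 -> w != 0 ->
    exists2 f : 'cV[K]_n.+1, dot w f = 0 & f *m x \notin T.
  move=> x0 w0; apply: NNPP => none; apply: no; exists x, w; split=> //; split=> // c wc.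
  by apply/negPn/negP => cT; apply: none; exists c.
have [n1|n3] := leqP n 1.
  have en : n = 1%N by lia.
  by subst n; apply: main2 => //; lia.
have ad := exists_adapted noT1 ltac:(lia) ltac:(lia).
have IHn : dichotomy n p := IH n3.
have kd v := @kinds n p T F v IHn dT h.
have lowk v : (2 <= \dim (ev v T))%N -> low T F v \/ (\dim (ev v T) = 2%N /\
  exists m (P : 'M_(n.+1, m)) P' C (J : 'M_(m, p)) z alpha, kindJ T F v P P' C J z alpha).
  move=> /kd[k0|[x [w [z [al k1]]]]|kJ]; [left|left|by right].
    by exists 0 => c vc _; apply: kind0_linear k0 vc.
  by exists w => c vc wc; exact: (kind1_linear k1 vc wc).
(* One quotient of symmetric type suffices to make the whole space symmetric; rank 3 is ruled out by
   [caseI], except in a 3-dimensional quotient it never survives, so [J] has rank 2 throughout. *)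
have [[v [dv [m [P [P' [C [J [z [al k]]]]]]]]]|noJ] := classic (exists v, \dim (ev v T) = 2%N /\
    exists m (P : 'M_(n.+1, m)) P' C (J : 'M_(m, p)) z alpha, kindJ T F v P P' C J z alpha).
  have rank2 v' m' (P1 : 'M_(n.+1, m')) P1' C1 (J1 : 'M_(m', p)) z1 al1 :
      (0 < \dim (ev v' T))%N -> kindJ T F v' P1 P1' C1 J1 z1 al1 -> \rank J1 = 2%N.
    move=> dv' k'; have [//|m3] := kJrk3 k'.
    have := kJrk k'; rewrite leq_eqVlt => /orP[/eqP <- //|r3].
    have rJ : \rank J1 = 3%N by apply/eqP; rewrite eqn_leq r3 -m3 rank_leq_row.
    by case: (caseI lam0 lam1 lowk k' dv' rJ m3).
  have em : m = n by have := kJn k => -[].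
  subst m; have dq := quot_dim (kJP k) (kJC k) (kJy k) T; have dJ := kJdim k.
  have dT' : (\dim T + 3 = 2 * n.+1)%N by lia.
  have [J3 [hX r2 r3]] : exists J3 : 'M[K]_(n.+1, p),
      [/\ forall s, orth T s <-> (J3 *m s)^T = J3 *m s, (2 <= \rank J3)%N &
        \rank J3 = 2%N \/ n.+1 = 3%N].
    have [n2'|n3'] := leqP n 2.
      have en : n = 2%N by lia.
      subst n; have [J3 [hX r2]] := caseIII lam0 lam1 k h dT ltac:(by rewrite dv).
      by exists J3; split=> //; right.
    have [J3 [hX r2]] := caseII lam0 lam1 lowk k ltac:(by rewrite dv) rank2 n3'.
    by exists J3; split=> //; [rewrite r2|left].
  have [|[nl tJ]] := typeJ_or_local dT' r2 r3 hX h; first by left.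
  by right; split=> //; right.
have kd' v : (2 <= \dim (ev v T))%N -> kind0 T F v \/ kind1 T F v.
  by move=> /kd[|k1|kJ]; [left|right|case: noJ; exists v].
(* A linear [F] has no Type 1 quotient, since that would show a nonlinear direction; so every
   adapted vector is then of kind 0. *)
have [lin|nl] := classic (rc_linear T F); last first.
  by case: (all_low_nonlinear lam0 lam1 h n3 dT noT1 ad nl kd').
left; apply: (all_low_linear lam0 lam1 h n3 dT noT1 ad lin) => v dv.
have [//|[x [w [z [al k1]]]]] := kd' v dv; exfalso.
have [_ wv _ _ _] := k1; have [c /row1_eq0 vc wc] := sep wv.
apply: (kind1_nonlinear k1 vc wc) => s k os; by rewrite lin // dotZl.
Qed.
End Main.

(** * Coordinates, and transport between operators and matrices *)

Section Coordinates.
Variables (K : fieldType) (W : vectType K) (d : nat) (e : d.-tuple W).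

Definition crow (v : W) : 'rV[K]_d := \row_i coord e i v.
Definition vrow (x : 'rV[K]_d) : W := \sum_i x 0 i *: e`_i.

Lemma crowD u v : crow (u + v) = crow u + crow v.
Proof. by apply/rowP => i; rewrite !mxE linearD. Qed.
Lemma crowZ k v : crow (k *: v) = k *: crow v.
Proof. by apply/rowP => i; rewrite !mxE linearZ. Qed.
Lemma crow0 : crow 0 = 0.
Proof. by apply/rowP => i; rewrite !mxE linear0. Qed.
Lemma vrowD u v : vrow (u + v) = vrow u + vrow v.
Proof. by rewrite /vrow -big_split; apply: eq_bigr => i _; rewrite mxE scalerDl. Qed.
Lemma vrowZ k v : vrow (k *: v) = k *: vrow v.
Proof. by rewrite /vrow scaler_sumr; apply: eq_bigr => i _; rewrite mxE scalerA. Qed.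

Hypothesis be : basis_of fullv e.

Lemma crowK v : vrow (crow v) = v.
Proof.
rewrite {2}(coord_basis be (memvf v)); apply: eq_bigr => i _; by rewrite mxE.
Qed.
Lemma vrowK x : crow (vrow x) = x.
Proof. by apply/rowP => i; rewrite mxE coord_sum_free // (basis_free be). Qed.
Lemma crow_inj : injective crow. Proof. exact: can_inj crowK. Qed.
Lemma crow_eq0 v : (crow v == 0) = (v == 0).
Proof. by rewrite -crow0 (inj_eq crow_inj). Qed.
End Coordinates.

Section Translation.
Variables (K : fieldType) (U V : vectType K).
Notation p := (\dim {:U}).
Notation n := (\dim {:V}).
Variables (eU : p.-tuple U) (eV : n.-tuple V).
Hypotheses (bU : basis_of fullv eU) (bV : basis_of fullv eV).

(** Transposed so that application becomes right multiplication of coordinate rows ([opmx_app]). *)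
Definition opmx (s : 'Hom(U, V)) : 'M[K]_(p, n) := (matof eU eV s)^T.

Lemma opmxP (k : K) s t : opmx (k *: s + t) = k *: opmx s + opmx t.
Proof.
by apply/matrixP => i j; rewrite !mxE add_lfunE scale_lfunE linearP.
Qed.
Lemma opmxD s t : opmx (s + t) = opmx s + opmx t.
Proof. by have := opmxP 1 s t; rewrite !scale1r. Qed.
Lemma opmx0 : opmx 0 = 0.
Proof. by apply/matrixP => i j; rewrite !mxE zero_lfunE linear0. Qed.
Lemma opmxZ k s : opmx (k *: s) = k *: opmx s.
Proof. by have := opmxP k s 0; rewrite opmx0 !addr0. Qed.

Lemma opmx_app (s : 'Hom(U, V)) u : crow eV (s u) = crow eU u *m opmx s.
Proof.
rewrite {1}(coord_basis bU (memvf u)) linear_sum; apply/rowP => j.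
rewrite mxE linear_sum [RHS]mxE; apply: eq_bigr => i _.
by rewrite !linearZ !mxE (tnth_nth 0) mulrC mulrC.
Qed.

Lemma opmx_surj (M : 'M[K]_(p, n)) : exists s, opmx s = M.
Proof.
have [s hs] := @hom_of_linear K U V (fun u => vrow eV (crow eU u *m M))
  (fun k u v => ltac:(by rewrite /= crowD crowZ mulmxDl -scalemxAl vrowD vrowZ)).
exists s; apply/row_matrixP => i; rewrite rowE (rowE i M).
have -> : delta_mx 0 i = crow eU eU`_i.
  apply/rowP => j; rewrite !mxE coord_free ?(basis_free bU) //=.
  by rewrite eq_sym.
by rewrite -opmx_app hs vrowK.
Qed.

Lemma opmx_inj : injective opmx.
Proof.
move=> s t e; apply/lfunP => u; apply: (crow_inj bV).
by rewrite !opmx_app e.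
Qed.

Lemma limg_opmx s v : v \in limg s <-> (crow eV v <= opmx s)%MS.
Proof.
split=> [/memv_imgP[u _ ->]|/submxP[D e]]; first by rewrite opmx_app submxMl.
have -> : v = s (vrow eU D); last exact/memv_img/memvf.
by apply: (crow_inj bV); rewrite opmx_app vrowK.
Qed.

Lemma app_vrow (s : 'Hom(U, V)) z : s (vrow eU z) = vrow eV (z *m opmx s).
Proof. by apply: (crow_inj bV); rewrite opmx_app !vrowK. Qed.

Variable S : {vspace 'Hom(U, V)}.

Lemma orth_space : exists T : {vspace 'M[K]_(n, p)},
  (forall s, s \in S <-> orth T (opmx s)) /\ (\dim T + \dim S = \dim {:'Hom(U, V)})%N.
Proof.
have [g eg] := hom_of_linear opmxP.
have [T [eT dT]] := dim_perp (g @: S)%VS; exists T; split.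
  move=> s; split=> [sS|/eT/memv_imgP[t tS]]; first by apply/eT; rewrite -eg memv_img.
  by rewrite eg => /opmx_inj ->.
have -> : \dim {:'Hom(U, V)} = (p * n)%N by rewrite !dimvf.
rewrite -dT; congr (_ + _)%N; apply/esym/limg_dim_eq/eqP; rewrite -subv0; apply/subvP => s.
by rewrite memv_cap memv_ker memv0 eg -opmx0 (inj_eq opmx_inj) => /andP[].
Qed.

(* The transported map: [F] read in the bases [eU], [eV]. *)
Lemma transport (F : 'Hom(U, V) -> V) : exists F' : 'M[K]_(p, n) -> 'rV[K]_n,
  forall s, F' (opmx s) = crow eV (F s).
Proof.
pose g M := proj1_sig (constructive_indefinite_description _ (opmx_surj M)).
have eg M : opmx (g M) = M by rewrite /g; case: constructive_indefinite_description.
by exists (fun M => crow eV (F (g M))) => s; congr (crow _ (F _)); apply: opmx_inj.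
Qed.

Lemma transport_rc T (F : 'Hom(U, V) -> V) F' : (forall s, s \in S <-> orth T (opmx s)) ->
  (forall s, F' (opmx s) = crow eV (F s)) -> hom_on S F -> range_compatible S F -> rc T F'.
Proof.
move=> hT eF hD hr; split=> [M N|M].
  have [s <-] := opmx_surj M; have [t <-] := opmx_surj N => /hT sS /hT tS.
  by rewrite -opmxD !eF hD // crowD.
have [s <-] := opmx_surj M => /hT sS; rewrite eF; apply/limg_opmx; exact: hr.
Qed.

Lemma mxent_ord m q (M : 'M[K]_(m, q)) (i : 'I_m) (j : 'I_q) : mxent M i j = M i j.
Proof. by rewrite /mxent !valK. Qed.

Lemma pid_mx_mul r s (i j : 'I_n) : (r <= p)%N ->
  (pid_mx r *m opmx s) i j = if (i < r)%N then mxent (matof eU eV s) j i else 0.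
Proof.
move=> rp; rewrite !mxE; case: ifP => ir.
  pose k : 'I_p := Ordinal (leq_trans ir rp).
  rewrite (bigD1 k) //= big1 ?addr0 => [|l lk]; last first.
    rewrite !mxE (_ : (_ == _ :> nat) = false) ?mul0r //.
    by apply: contraNF lk => /eqP e; apply/eqP/val_inj.
  by rewrite mxE eqxx ir mul1r mxE -[X in mxent _ _ X]/(val k) mxent_ord.
by rewrite big1 // => k _; rewrite mxE ir andbF mul0r.
Qed.

(** The symmetric type for [J = pid_mx r]: the normal form of Type 2 for [r = 2] and of Type 3 for
    [r = 3]. *)
Definition pid_sym r (s : 'Hom(U, V)) :=
  (pid_mx r *m opmx s : 'M_n)^T = pid_mx r *m opmx s.

Lemma S2_pid_sym s : (2 <= n)%N -> (2 <= p)%N ->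
  S2_vee_M (matof eU eV s) <-> pid_sym 2 s.
Proof.
move=> n2 p2; split=> [[_ [_ [h1 h2]]]|h].
  apply/matrixP => i j; rewrite mxE !pid_mx_mul //.
  case: ltnP => [i2|i2]; case: ltnP => [j2|j2] //; first exact: h1.
    by rewrite h2.
  by rewrite h2.
have hE (i j : 'I_n) := congr1 (fun A : 'M_n => A i j) h.
split=> //; split=> //; split=> [i j i2 j2|i j i2 ni j2].
  have := hE (Ordinal (leq_trans i2 n2)) (Ordinal (leq_trans j2 n2)).
  by rewrite mxE !pid_mx_mul //= i2 j2.
have := hE (Ordinal ni) (Ordinal (leq_trans j2 n2)).
by rewrite mxE !pid_mx_mul //= j2 ltnNge i2.
Qed.

Lemma S3_pid_sym s : n = 3%N -> (3 <= p)%N ->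
  S3_coprod_M (matof eU eV s) <-> pid_sym 3 s.
Proof.
move=> n3 p3; have lt3 (i : 'I_n) : (i < 3)%N by rewrite -n3.
split=> [[_ [_ h1]]|h].
  by apply/matrixP => i j; rewrite mxE !pid_mx_mul // !lt3 h1.
split=> //; split=> // i j i3 j3.
have iN : (i < n)%N by rewrite n3.
have jN : (j < n)%N by rewrite n3.
have := congr1 (fun A : 'M_n => A (Ordinal iN) (Ordinal jN)) h.
by rewrite mxE !pid_mx_mul //= i3 j3.
Qed.

(** One direction is [sym_form]. Conversely, a column killed by [s] annihilates the quadratic form
    of the symmetric product, so by [root_linear_quadratic] it annihilates the diagonal vector,
    which therefore lies in the range. *)
Lemma pid_sym_homs (lam : K) r : lam != 0 -> lam != 1 -> 2%:R = 0 :> K ->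
  (2 <= r)%N -> (r <= n)%N -> (r <= p)%N -> (forall s, s \in S <-> pid_sym r s) ->
  forall F, (hom_on S F /\ range_compatible S F) <->
    exists (y : U) (alpha : K -> K), root_linear alpha /\
      forall s, s \in S ->
        F s = s y + \sum_(k < r) alpha (mxent (matof eU eV s) k k) *: eV`_k.
Proof.
move=> lam0 lam1 c2 r2 rn rp hS F.
have sumE (alpha : K -> K) s : alpha 0 = 0 ->
    vrow eV (\row_i alpha ((pid_mx r *m opmx s : 'M_n) i i)) =
    \sum_(k < r) alpha (mxent (matof eU eV s) k k) *: eV`_k.
  move=> a0; rewrite /vrow (big_ord_widen n (fun k => alpha (mxent (matof eU eV s) k k) *: eV`_k) rn).
  rewrite [RHS]big_mkcond; apply: eq_bigr => i _; rewrite mxE pid_mx_mul //.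
  by case: ifP => // _; rewrite a0 scale0r.
split=> [[hD hr]|[y [alpha [rl hF]]]].
  have [F' eF] := transport F.
  have h : rc_on (fun M : 'M_(p, n) => (pid_mx r *m M : 'M_n)^T = pid_mx r *m M) F'.
    split; first by rewrite mulmx0 trmx0.
      move=> M N; have [s <-] := opmx_surj M; have [t <-] := opmx_surj N => /hS sS /hS tS.
      split; last by rewrite -opmxD !eF hD // crowD.
      by rewrite -opmxD; apply/hS/memvD.
    move=> M; have [s <-] := opmx_surj M => /hS sS; rewrite eF; apply/limg_opmx; exact: hr.
  have rJ : (2 <= \rank (pid_mx r : 'M[K]_(n, p)))%N by rewrite rank_pid_mx.
  have [z [alpha [rl _ hF]]] := sym_form lam0 lam1 rJ h.
  exists (vrow eU z), alpha; split=> // s sS; rewrite app_vrow -sumE ?root_linear0 //.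
  by rewrite -vrowD -hF ?eF ?crowK //; apply/hS.
have rD := rl.1; split=> [s t sS tS|s sS].
  rewrite !hF ?memvD // add_lfunE addrACA; congr (_ + _).
  rewrite -big_split; apply: eq_bigr => k _ /=; rewrite -scalerDl -rD; congr (alpha _ *: _).
  pose kn : 'I_n := widen_ord rn k; pose kp : 'I_p := widen_ord rp k.
  have e (q : 'Hom(U, V)) : mxent (matof eU eV q) k k = matof eU eV q kn kp.
    exact: (mxent_ord _ kn kp).
  by rewrite !e !mxE add_lfunE linearD.
apply/limg_opmx; rewrite hF // -sumE ?root_linear0 // crowD vrowK // opmx_app.
apply: addmx_sub; first exact: submxMl.
apply: sub_sep => c sc; have := root_linear_quadratic c^T c2 ((hS s).1 sS) rl.
rewrite trmxK => <-.
by rewrite -!dotA -mulmxA sc mulmx0 !dot0r root_linear0.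
Qed.
End Translation.

(** * Change of basis *)

Section BasisChange.
Variables (K : fieldType) (W : vectType K) (e : (\dim {:W}).-tuple W).
Hypothesis be : basis_of fullv e.
Variable Q : 'M[K]_(\dim {:W}).
Hypothesis uQ : Q \in unitmx.

Definition new_basis := [tuple vrow e (row i Q) | i < \dim {:W}].

Lemma vrow_new x : vrow new_basis x = vrow e (x *m Q).
Proof.
rewrite /vrow; transitivity (\sum_i x 0 i *: vrow e (row i Q)).
  by apply: eq_bigr => i _; rewrite -tnth_nth tnth_mktuple.
rewrite /vrow; under eq_bigr do rewrite scaler_sumr.
rewrite exchange_big; apply: eq_bigr => j _; rewrite mxE scaler_suml.
by apply: eq_bigr => i _; rewrite scalerA mxE.
Qed.

Lemma new_basisP : basis_of fullv new_basis.
Proof.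
rewrite basisEdim size_tuple leqnn andbT; apply/subvP => v _.
rewrite -(crowK be v) -[crow e v](mulmxKV uQ) -vrow_new.
apply: memv_suml => i _; apply: memvZ; apply: memv_span.
by rewrite mem_nth // size_tuple.
Qed.

Lemma crow_new v : crow new_basis v = crow e v *m invmx Q.
Proof.
apply: (can_inj (vrowK new_basisP)); rewrite (crowK new_basisP) vrow_new mulmxKV //.
by rewrite crowK.
Qed.
End BasisChange.

(** * Type 1 for operators, normal forms, and the final assembly *)

Section Final.
Variables (K : fieldType) (U V : vectType K).
Notation p := (\dim {:U}).
Notation n := (\dim {:V}).
Variables (eU : p.-tuple U) (eV : n.-tuple V).
Hypotheses (bU : basis_of fullv eU) (bV : basis_of fullv eV).
Variable S : {vspace 'Hom(U, V)}.

Lemma mem_Sx x v : v \in Sx S x <-> exists2 s, s \in S & v = (s : 'Hom(U, V)) x.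
Proof.
have [g eg] := @hom_of_linear K _ V (fun s : 'Hom(U, V) => s x)
  (fun k s t => ltac:(by rewrite /= add_lfunE scale_lfunE)).
have -> : Sx S x = (g @: S)%VS.
  rewrite -{2}(span_basis (vbasisP S)) limg_span; congr span.
  by apply: eq_map => s; rewrite eg.
split=> [/memv_imgP[s sS ->]|[s sS ->]]; first by exists s.
by rewrite -eg memv_img.
Qed.

Lemma opmx_new (R : 'M[K]_p) (Q : 'M[K]_n) s : Q \in unitmx -> R \in unitmx ->
  opmx (new_basis eU R) (new_basis eV Q) s = R *m opmx eU eV s *m invmx Q.
Proof.
move=> uQ uR; apply/row_matrixP => i; rewrite !row_mul.
rewrite -[row i R](vrowK bU) -(opmx_app _ bU) -(crow_new bV uQ).
apply/rowP => j; rewrite !mxE tnth_mktuple //.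
Qed.

(** The rank factorisation of [J] supplies the bases: its row factor changes the basis of [U], the
    transpose of its column factor that of [V], and symmetry is preserved by congruence. *)
Lemma pid_sym_new (J : 'M[K]_(n, p)) :
  (forall s, s \in S <-> (J *m opmx eU eV s)^T = J *m opmx eU eV s) ->
  exists (eU' : p.-tuple U) (eV' : n.-tuple V), [/\ basis_of fullv eU', basis_of fullv eV' &
    forall s, s \in S <-> pid_sym eU' eV' (\rank J) s].
Proof.
move=> hS; pose L := col_ebase J; pose R := row_ebase J.
have uL : L \in unitmx by apply: col_ebase_unit.
have uR : R \in unitmx by apply: row_ebase_unit.
have uLT : L^T \in unitmx by rewrite unitmx_tr.
exists (new_basis eU R), (new_basis eV L^T); split; try exact: new_basisP.
move=> s; rewrite hS /pid_sym opmx_new //; set M := opmx eU eV s.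
have -> : J *m M = L *m (pid_mx (\rank J) *m (R *m M *m invmx L^T)) *m L^T.
  by rewrite !mulmxA mulmxKV // mulmx_ebase.
set N : 'M_n := pid_mx _ *m _; clearbody N; split=> [|e]; last first.
  by rewrite !trmx_mul trmxK e mulmxA.
rewrite !trmx_mul trmxK mulmxA => /(congr1 (mulmx (invmx L))).
rewrite -!mulmxA !mulKmx // => /(congr1 (mulmx^~ (invmx L^T))).
by rewrite !mulmxK.
Qed.

Lemma represented_pid (T0 : 'M[K]_(n, p) -> Prop) r :
  (forall s, T0 (matof eU eV s) <-> pid_sym eU eV r s) ->
  represented_by S eU eV T0 <-> (forall s, s \in S <-> pid_sym eU eV r s).
Proof.
move=> hT; split=> [[h1 h2] s|hS].
  split=> [/h1/hT //|/hT/h2[t tS e]].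
  by rewrite -(_ : t = s) //; apply: (opmx_inj bU bV); rewrite /opmx e.
split=> [s /hS/hT //|M]; have [s es] := opmx_surj bU bV M^T.
have eM : matof eU eV s = M by apply: (can_inj (@trmxK _ _ _)).
by rewrite -eM => /hT/hS sS; exists s.
Qed.

Lemma type1_homs x F : (2 <= n)%N -> (\dim {:'Hom(U, V)} - \dim S <= 2 * n - 3)%N ->
  \dim (Sx S x) = 1%N ->
  (hom_on S F /\ range_compatible S F) <->
       exists (y : U) (alpha : V -> V),
         [/\ (forall v w, v \in Sx S x -> w \in Sx S x -> alpha (v + w) = alpha v + alpha w),
             (forall v, v \in Sx S x -> alpha v \in Sx S x) &
             (forall s, s \in S -> F s = s y + alpha (s x))].
Proof.
move=> n2 codim d1.
have Sxn0 : Sx S x != 0%VS by rewrite -dimv_eq0 d1.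
pose w := vpick (Sx S x); have w0 : w != 0 by rewrite vpick0.
have wS : w \in Sx S x := memv_pick _.
have eSx : <[w]>%VS = Sx S x by apply/eqP; rewrite eqEdim -memvE wS dim_vline w0 d1.
have line s : s \in S -> exists k, s x = k *: w.
  move=> sS; have : s x \in Sx S x by apply/mem_Sx; exists s.
  by rewrite -eSx => /vlineP.
split=> [[hD hr]|[y [alpha [aD aS hF]]]]; last first.
  split=> [s t sS tS|s sS].
    have sxS : s x \in Sx S x by apply/mem_Sx; exists s.
    have txS : t x \in Sx S x by apply/mem_Sx; exists t.
    by rewrite !hF ?memvD // !add_lfunE aD // addrACA.
  rewrite hF // memvD //; first exact/memv_img/memvf.
  (* If [s x] is nonzero it spans the line containing [alpha (s x)], which is thus in the range of
     [s]; if it is zero, additivity gives [alpha 0 = 0]. *)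
  have [k sx] := line s sS; have [k0|k0] := eqVneq k 0.
    rewrite sx k0 scale0r; have := aD 0 0 (mem0v _) (mem0v _); rewrite addr0 -{1}[alpha 0]addr0.
    by move/addrI <-; apply: mem0v.
  have : alpha (s x) \in Sx S x by apply: aS; apply/mem_Sx; exists s.
  rewrite -eSx => /vlineP[l ->]; apply: memvZ.
  by rewrite -[w](scalerK k0) -sx memvZ // memv_img ?memvf.
have [T [hT dT]] := orth_space bU bV S; have [F' eF] := transport bU bV F.
have h := transport_rc bU bV hT eF hD hr.
pose x' := crow eU x; pose w' := crow eV w.
have w'0 : w' != 0 by rewrite crow_eq0.
have x'0 : x' != 0.
  rewrite crow_eq0 //; apply: contraNneq w0 => x0; have [s _ ->] := (mem_Sx _ _).1 wS.
  by rewrite x0 linear0.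
have hw c : dot w' c = 0 -> c *m x' \in T.
  move=> wc; apply/rank1_orthP => M; have [s <-] := opmx_surj bU bV M => /hT/line[k sx].
  by rewrite -opmx_app // sx crowZ dotZl wc mulr0.
have [z [al [alD hF]]] := type1_form x'0 w'0 hw ltac:(lia) h.
have [c wc] := sep1 w'0.
exists (vrow eU z), (fun v => al (dot (crow eV v) c) *: w); split=> [u v _ _|v _|s sS].
- by rewrite crowD dotDl alD scalerDl.
- by rewrite memvZ.
have [m xs Fs] := hF _ ((hT s).1 sS).
apply: (crow_inj bV); rewrite crowD crowZ -eF Fs (app_vrow bU bV) vrowK // (opmx_app _ bU) xs.
by rewrite dotZl wc mulr1.
Qed.
End Final.

Theorem theorem1p9 (K : fieldType) (U V : vectType K) (S : {vspace 'Hom(U, V)})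
  (HK : exists a b c : K, [/\ a != b, b != c & a != c])
  (Hp : (1 <= \dim {:U})%N) (Hn : (2 <= \dim {:V})%N)
  (Hcodim : (\dim {:'Hom(U, V)} - \dim S <= 2 * \dim {:V} - 3)%N) :
  (* (a) *)
  (forall F, linear_on S F -> range_compatible S F -> local_map S F) /\
  (* (b) *)
  (~ Type1 S -> ~ Type2 S -> ~ Type3 S ->
     forall F, hom_on S F -> range_compatible S F -> local_map S F) /\
  (* (c) *)
  (forall x : U, \dim (Sx S x) = 1%N ->
     forall F, (hom_on S F /\ range_compatible S F) <->
       exists (y : U) (alpha : V -> V),
         [/\ (forall v w, v \in Sx S x -> w \in Sx S x -> alpha (v + w) = alpha v + alpha w),
             (forall v, v \in Sx S x -> alpha v \in Sx S x) &
             (forall s, s \in S -> F s = s y + alpha (s x))]) /\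
  (* (d) *)
  (char2 K ->
   forall (eU : (\dim {:U}).-tuple U) (eV : (\dim {:V}).-tuple V),
     basis_of fullv eU -> basis_of fullv eV ->
     represented_by S eU eV (@S2_vee_M K _ _) ->
     forall F, (hom_on S F /\ range_compatible S F) <->
       exists (y : U) (alpha : K -> K),
         root_linear alpha /\
         forall s, s \in S ->
           F s = s y + \sum_(k < 2) alpha (mxent (matof eU eV s) k k) *: eV`_k) /\
  (* (e) *)
  (char2 K ->
   forall (eU : (\dim {:U}).-tuple U) (eV : (\dim {:V}).-tuple V),
     basis_of fullv eU -> basis_of fullv eV ->
     represented_by S eU eV (@S3_coprod_M K _ _) ->
     forall F, (hom_on S F /\ range_compatible S F) <->
       exists (y : U) (alpha : K -> K),
         root_linear alpha /\
         forall s, s \in S ->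
           F s = s y + \sum_(k < 3) alpha (mxent (matof eU eV s) k k) *: eV`_k).
Proof.
have [lam [lam0 lam1]] : exists lam : K, lam != 0 /\ lam != 1.
  (* The affine map sending [a] to 0 and [b] to 1 sends the third element to neither. *)
  have [a [b [c [ab bc ac]]]] := HK; exists ((c - a) / (b - a)).
  have ba : b - a != 0 by rewrite subr_eq0 eq_sym.
  split; first by rewrite mulf_neq0 ?invr_neq0 // subr_eq0 eq_sym.
  by rewrite -(inj_eq (mulIf ba)) divfK // mul1r (inj_eq (addIr _)) eq_sym.
have bU := vbasisP {:U}; have bV := vbasisP {:V}.
have [T [hT dT]] := orth_space bU bV S.
have cl F F' : (forall s, F' (opmx (vbasis {:U}) (vbasis {:V}) s) = crow (vbasis {:V}) (F s)) ->
    hom_on S F -> range_compatible S F ->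
    rc_local T F' \/ (~ rc_linear T F' /\ (type1 T F' \/ typeJ T F')).
  move=> eF hD hr; apply: (classification lam0 lam1 Hn); first by lia.
  exact: transport_rc hT eF hD hr.
have loc F F' : (forall s, F' (opmx (vbasis {:U}) (vbasis {:V}) s) = crow (vbasis {:V}) (F s)) ->
    rc_local T F' -> local_map S F.
  move=> eF [z hz]; exists (vrow (vbasis {:U}) z) => s sS; apply: (crow_inj bV).
  by rewrite -eF hz ?(app_vrow bU bV) ?vrowK //; apply/hT.
have c2E : char2 K <-> 2%:R = 0 :> K.
  by rewrite /char2 inE /=; split=> [/eqP|/eqP].
split=> [F [hD hZ] hr|].
  have [F' eF] := transport bU bV F.
  have [/(loc _ _ eF) //|[nl _]] := cl F F' eF hD hr; case: nl => M k.
  have [s <-] := opmx_surj bU bV M => /hT sS.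
  by rewrite -opmxZ !eF hZ // crowZ.
split=> [n1 n2 n3 F hD hr|].
  have [F' eF] := transport bU bV F.
  have [/(loc _ _ eF) //|[_ [t1|tJ]]] := cl F F' eF hD hr.
    case: t1 => x [w [z [al [x0 w0 _ [M oM xM] hx]]]]; case: n1.
    exists (vrow (vbasis {:U}) x).
    have -> : Sx S (vrow (vbasis {:U}) x) = <[vrow (vbasis {:V}) w]>%VS.
      apply/vspaceP => v; apply/idP/vlineP => [/mem_Sx[s /hT/hx[m xs _] ->]|[k ->]].
        by exists m; rewrite (app_vrow bU bV) xs vrowZ.
      apply: memvZ; apply/mem_Sx; have [s es] := opmx_surj bU bV M.
      by exists s; [apply/hT; rewrite es|rewrite (app_vrow bU bV) es xM].
    by rewrite dim_vline -(crow_eq0 bV) vrowK // w0.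
  case: tJ => J [z [al [_ [r2 r3] hX [c2 _ _] _]]].
  have [eU' [eV' [bU' bV' hS]]] := pid_sym_new bU bV (fun s => iff_trans (hT s) (hX _)).
  have r_n := rank_leq_row J; have r_p := rank_leq_col J.
  have [rJ|rJ] : \rank J = 2%N \/ (\rank J = 3%N /\ \dim {:V} = 3%N) by lia.
    case: n2; split; first exact/c2E; exists eU', eV'; split=> //.
    apply/(represented_pid bU' bV' S (r := 2)); last by rewrite -rJ.
    by move=> s; apply: S2_pid_sym; rewrite -rJ.
  case: rJ => rJ nV; case: n3; split; first exact/c2E; exists eU', eV'; split=> //.
  apply/(represented_pid bU' bV' S (r := 3)); last by rewrite -rJ.
  by move=> s; apply: S3_pid_sym => //; rewrite -rJ.
split=> [x d1 F|]; first exact: (type1_homs bU bV F Hn Hcodim d1).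
split=> /c2E c2 eU eV bU' bV' hrep.
  (* The size conditions are part of the matrix predicate, so the zero operator already yields
     them. *)
  have [n2 [p2 _]] := hrep.1 _ (mem0v S).
  apply: (pid_sym_homs bU' bV' lam0 lam1 c2) => //.
  by apply: (represented_pid bU' bV' S _).1 hrep => s; apply: S2_pid_sym.
have [n3 [p3 _]] := hrep.1 _ (mem0v S).
apply: (pid_sym_homs bU' bV' lam0 lam1 c2) => //; first by rewrite n3.
by apply: (represented_pid bU' bV' S _).1 hrep => s; apply: S3_pid_sym.
Qed.
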